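(* The realization spaces of the $4$-polytopes $P_1$, $P_2$ and $P_3$ are smooth manifolds of the following dimensions: $$\dim\mathcal{R}_{\mathbf 0}(P_1)=26>25=\mathrm{NG}(P_1),\quad \dim\mathcal{R}_{\mathbf 0}(P_2)=27>26=\mathrm{NG}(P_2),\quad \dim\mathcal{R}_{\mathbf 0}(P_3)=27>26=\mathrm{NG}(P_3).$$
   Context: A $d$-polytope is a $d$-dimensional convex polytope. Polytopes are labeled: the $n=f_0(P)$ vertices and $m=f_{d-1}(P)$ facets are numbered; $f_{0,d-1}(P)$ is the number of vertex-facet incidences. A labeled $d$-polytope $Q\subset\mathbb{R}^d$ realizes $P$ if there is an isomorphism between the face lattices of $P$ and $Q$ respecting the labels. The (centered) realization space is $$\mathcal{R}_{\mathbf 0}(P)=\{(V,A)\in\mathbb{R}^{d\times(n+m)} \mid \operatorname{conv}(V)=\{\mathbf x\in\mathbb{R}^d\mid A^t\mathbf x\le\mathbf 1\}\text{ realizes }P\},$$ where $\operatorname{conv}(V)$ is the convex hull of the columns of $V$. ''Smooth manifold'' means smoothly embedded submanifold of $\mathbb{R}^{d\times(n+m)}$. The natural guess is $\mathrm{NG}(P)=d(f_0(P)+f_{d-1}(P))-f_{0,d-1}(P)$. The three combinatorial types $P_1,P_2,P_3$ of $4$-polytopes with $8$ vertices are constructed from a pyramid $R$ over a triangular prism (a $4$-polytope with $7$ vertices, whose facets are one triangular prism, two simplices and three square pyramids) by taking the convex hull of $R$ and one new point $q$. A point is beneath a facet of $R$ if it lies strictly on the same side of the supporting hyperplane of the facet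 as the interior of $R$, and beyond the facet if it lies strictly on the other side. - $P_1$: $q$ lies beyond the triangular prism facet, on the supporting hyperplane of one simplex facet, and beneath all the other facets. ($8$ vertices, $9$ facets, $43$ vertex-facet incidences.) - $P_2$: $q$ lies beyond the triangular prism facet and beneath all the other facets; that is, $P_2$ is a bipyramid over the triangular prism. ($8$ vertices, $10$ facets, $46$ incidences.) - $P_3$: $q$ lies beyond the triangular prism facet, beyond one simplex facet, and beneath all the other facets. ($8$ vertices, $11$ facets, $50$ incidences.) *)

(* Defs.v *)
From HB Require Import structures.
From mathcomp Require Export all_boot all_order all_algebra.
From mathcomp Require Export all_classical all_reals all_analysis.

Set Implicit Arguments.
Unset Strict Implicit.
Unset Printing Implicit Defensive.

Export Order.TTheory GRing.Theory Num.Theory.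
Export numFieldNormedType.Exports.

Local Open Scope classical_set_scope.
Local Open Scope ring_scope.

(* Points of R^d are column vectors 'cV[R]_d; a configuration of k points is
   the d x k matrix having them as columns. *)

Section Polytopes.
Context {R : realType}.

Definition conv_hull d (S : set 'cV[R]_d) : set 'cV[R]_d :=
  smallest (@convex_set R 'cV[R]_d) S.

Definition conv d k (V : 'M[R]_(d, k)) : set 'cV[R]_d :=
  conv_hull [set col i V | i in [set: 'I_k]].

Definition polyhedron d k (A : 'M[R]_(d, k)) : set 'cV[R]_d :=
  [set x | forall j, (A^T *m x) j 0 <= 1].

Definition aff_hull d (S : set 'cV[R]_d) : set 'cV[R]_d :=
  [set x | exists k (V : 'M[R]_(d, k)) (w : 'cV[R]_k),
     [/\ forall i, S (col i V), \sum_i w i 0 = 1 & x = V *m w]].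

(* The empty set has no dimension in this sense. *)
Definition has_dim d (S : set 'cV[R]_d) (k : nat) : Prop :=
  exists (p : 'cV[R]_d) (B : 'M[R]_(d, k)),
    \rank B = k /\ aff_hull S = [set p + B *m c | c in [set: 'cV[R]_k]].

Definition is_polytope d (P : set 'cV[R]_d) : Prop :=
  exists k (V : 'M[R]_(d, k)), P = conv V.

(* The inequality a^T x <= b is valid on P and cuts out F. The vector a may
   be 0, so that P and the empty set are faces of P. *)
Definition defines_face d (P F : set 'cV[R]_d) (a : 'cV[R]_d) (b : R) : Prop :=
  (forall x, P x -> (a^T *m x) 0 0 <= b) /\
  F = [set x | P x /\ (a^T *m x) 0 0 = b].

Definition is_face d (P F : set 'cV[R]_d) : Prop :=
  exists a b, defines_face P F a b.

Definition is_vertex d (P : set 'cV[R]_d) (v : 'cV[R]_d) : Prop :=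
  is_face P [set v].

Definition is_facet d (P F : set 'cV[R]_d) : Prop :=
  is_face P F /\ exists k, has_dim P k.+1 /\ has_dim F k.

Definition face_lattice_iso d e (P : set 'cV[R]_d) (Q : set 'cV[R]_e)
    (f : set 'cV[R]_d -> set 'cV[R]_e) : Prop :=
  set_bij (is_face P) (is_face Q) f /\
  (forall F G, is_face P F -> is_face P G -> (f F `<=` f G <-> F `<=` G)).

Definition comb_equiv d e (P : set 'cV[R]_d) (Q : set 'cV[R]_e) : Prop :=
  exists f, face_lattice_iso P Q f.

End Polytopes.

Record labeled_polytope (R : realType) (d n m : nat) := LabeledPolytope {
  body : set 'cV[R]_d;
  vert : 'I_n -> 'cV[R]_d;
  facet : 'I_m -> set 'cV[R]_d;
  body_polytope : is_polytope body;
  body_dim : has_dim body d;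
  vert_bij : set_bij [set: 'I_n] (is_vertex body) vert;
  facet_bij : set_bij [set: 'I_m] (is_facet body) facet
}.

Section RealizationSpace.
Context {R : realType} {d n m : nat}.
Implicit Types P Q : labeled_polytope R d n m.

Definition realizes Q P : Prop :=
  exists f, [/\ face_lattice_iso (body P) (body Q) f,
    forall i, f [set vert P i] = [set vert Q i] &
    forall j, f (facet P j) = facet Q j].

(* A point of R^(d x (n + m)) is the block matrix row_mx V A. The polytope
   conv V is labeled by the columns of V and of A. *)
Definition realization_space P : set 'M[R]_(d, n + m) :=
  [set M | let V := lsubmx M in let A := rsubmx M in
    exists Q,
      [/\ body Q = conv V,
          body Q = polyhedron A,
          forall i, vert Q i = col i V,
          forall j, facet Q j = [set x | body Q x /\ (A^T *m x) j 0 = 1] &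
          realizes Q P]].

Definition incidences P : nat :=
  #|[set ij : 'I_n * 'I_m | `[< facet P ij.2 (vert P ij.1) >]]|.

Definition NG P : int := (d * (n + m))%N%:Z - (incidences P)%:Z.

End RealizationSpace.

Section SmoothManifolds.
Context {R : realType}.

(* Iterated directional derivatives up to order k exist on O, and those of
   order k are continuous on O; O is meant to be open. *)
Fixpoint is_Ck (V W : normedModType R) (k : nat) (O : set V) (f : V -> W) :
    Prop :=
  match k with
  | 0 => forall x, O x -> {for x, continuous f}
  | k'.+1 => forall v, (forall x, O x -> derivable f x v) /\
                       is_Ck k' O (fun x => 'D_v f x)
  end.

Definition smooth_on (V W : normedModType R) (O : set V) (f : V -> W) : Prop :=
  forall k, is_Ck k O f.

Definition diffeo_on (V W : normedModType R) (U : set V) (U' : set W)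
    (phi : V -> W) (psi : W -> V) : Prop :=
  [/\ open U, open U', smooth_on U phi, smooth_on U' psi &
      [/\ forall x, U x -> U' (phi x), forall y, U' y -> U (psi y),
          forall x, U x -> psi (phi x) = x & forall y, U' y -> phi (psi y) = y]].

(* Embedded submanifold, by local slice charts: around each of its points, M
   is straightened by a diffeomorphism between open sets of the ambient space
   to a linear subspace of dimension k. Nonemptiness makes k unique. *)
Definition smooth_manifold_of_dim p q (M : set 'M[R]_(p, q)) (k : nat) : Prop :=
  M !=set0 /\
  forall x, M x ->
    exists (U U' : set 'M[R]_(p, q)) (phi psi : 'M[R]_(p, q) -> 'M[R]_(p, q))
           (L : {vspace 'M[R]_(p, q)}),
      [/\ U x, diffeo_on U U' phi psi, \dim L = k &
          forall y, U y -> (M y <-> phi y \in L)].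

End SmoothManifolds.

Section Constructions.
Context {R : realType}.

Definition is_simplex d (k : nat) (S : set 'cV[R]_d) : Prop :=
  (exists V : 'M[R]_(d, k.+1), S = conv V) /\ has_dim S k.

(* The dimension condition says that t is not parallel to the triangle T. *)
Definition is_triangular_prism d (B : set 'cV[R]_d) : Prop :=
  exists (T : set 'cV[R]_d) (t : 'cV[R]_d),
    [/\ is_simplex 2 T,
        B = [set y | exists x c, [/\ T x, 0 <= c, c <= 1 & y = x + c *: t]] &
        has_dim B 3].

Definition is_pyramid_over d (P B : set 'cV[R]_d) : Prop :=
  exists p, ~ aff_hull B p /\ P = conv_hull (B `|` [set p]).

(* Position of q relative to a facet F of a full-dimensional polytope P; then
   the pair (a, b) is unique up to a positive factor. *)
Definition beneath d (P F : set 'cV[R]_d) (q : 'cV[R]_d) : Prop :=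
  exists a b, defines_face P F a b /\ (a^T *m q) 0 0 < b.
Definition beyond d (P F : set 'cV[R]_d) (q : 'cV[R]_d) : Prop :=
  exists a b, defines_face P F a b /\ (a^T *m q) 0 0 > b.
Definition on_hyperplane d (P F : set 'cV[R]_d) (q : 'cV[R]_d) : Prop :=
  exists a b, defines_face P F a b /\ (a^T *m q) 0 0 = b.

Definition is_simplex_facet d (P S : set 'cV[R]_d) : Prop :=
  is_facet P S /\ exists k, is_simplex k S.

(* The types are combinatorial: they contain every polytope that is
   combinatorially equivalent to one obtained by the construction, so taking
   the prism to be a triangle times a segment is no loss of generality. *)

Definition type_P1 n m (P : labeled_polytope R 4 n m) : Prop :=
  exists (Y B S : set 'cV[R]_4) (q : 'cV[R]_4),
    [/\ is_triangular_prism B, is_pyramid_over Y B & is_simplex_facet Y S] /\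
    [/\ beyond Y B q,
        on_hyperplane Y S q,
        forall F, is_facet Y F -> F <> B -> F <> S -> beneath Y F q &
        comb_equiv (conv_hull (Y `|` [set q])) (body P)].

Definition type_P2 n m (P : labeled_polytope R 4 n m) : Prop :=
  exists (Y B : set 'cV[R]_4) (q : 'cV[R]_4),
    [/\ is_triangular_prism B & is_pyramid_over Y B] /\
    [/\ beyond Y B q,
        forall F, is_facet Y F -> F <> B -> beneath Y F q &
        comb_equiv (conv_hull (Y `|` [set q])) (body P)].

Definition type_P3 n m (P : labeled_polytope R 4 n m) : Prop :=
  exists (Y B S : set 'cV[R]_4) (q : 'cV[R]_4),
    [/\ is_triangular_prism B, is_pyramid_over Y B & is_simplex_facet Y S] /\
    [/\ beyond Y B q,
        beyond Y S q,
        forall F, is_facet Y F -> F <> B -> F <> S -> beneath Y F q &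
        comb_equiv (conv_hull (Y `|` [set q])) (body P)].

End Constructions.

(* Main.v *)
Require Import Defs.
From mathcomp Require Import all_boot all_order all_algebra.
From mathcomp Require Import all_classical all_reals all_analysis.
From mathcomp Require Import ring lra.

(** The dimension exceeds the natural guess by one because one of the incidence
    equations follows from the others.

    Near a realization the realization space is cut out by the equations
    [a_j v_i = 1] for the incident pairs (vertex [i], facet [j]) alone. Indeed,
    the incidence pattern determines the face lattice with its labels
    ([pattern_iso]), the remaining pairs satisfy the open condition
    [a_j v_i < 1], and a pair of matrices near a realization that satisfies the
    equations still describes one polytope in both ways
    ([conv_polyhedron_near]). This is [realization_near]. The definition of the
    types only fixes the polytope up to an isomorphism of face lattices; that
    such an isomorphism maps vertices to vertices and facets to facets is proved
    by following complete flags, which determine dimensions ([transfer]).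

    The equations are then solved. In coordinates where four vertices of the
    upper part (the upper triangle of the prism and the apex) are the unit
    vectors, only four vertices and the facets are unknown. All three polytopes
    have the same eight facets apart from those around the lower triangle of the
    prism: six side facets, one for each edge of the base triangle and each of
    the apex and the new point, and the two simplices over the upper triangle.
    Eliminating the side facets leaves three numbers attached to the lower
    vertices and three attached to the edges, and a lower vertex shares its
    number with an edge whenever it lies on it. These six equalities form a
    hexagon, so they say no more than that all six numbers agree, for which
    five equations suffice. This accounts for the additional dimension.
    Everything else is determined rationally and without further redundancy, by
    [prism_solved] for the eight common facets and by [bot_p_forward],
    [bot_q_forward] and [bot_k_forward] for the facets around the lower
    triangle. When the new point lies on the hyperplane of the lower simplex
    facet, this costs one of its coordinates. Thus the space is locally, in
    rational coordinates, the graph of a rational map over 27 (or 26) matrix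
    entries, and [graph_chart] turns this into a slice chart.

    It remains to see that the constructions lead to polytopes with the
    incidence patterns used above, so that the realization spaces are nonempty
    and the number of incidences is known. An affine change of coordinates puts
    a pyramid over a prism into standard position ([standard_position]), where
    the signs that locate the new point relative to the facets become
    inequalities for its coordinates. The facets of the hull are explicit, and
    both descriptions of it agree ([conv_Z1], [conv_Z2] and [conv_Z3]). *)

Set Implicit Arguments.
Unset Strict Implicit.
Unset Printing Implicit Defensive.
Import Order.TTheory GRing.Theory Num.Theory.
Import numFieldNormedType.Exports.
Local Open Scope classical_set_scope.
Local Notation conv := Defs.conv.
Local Open Scope ring_scope.

(** * Regular rational maps and slice charts *)

Section RationalMaps.
Context {R : realType} {p q : nat}.
Implicit Types (O : set 'M[R]_(p, q)) (f g : 'M[R]_(p, q) -> R).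

(** Rationality is a property of the values on [O] only (last constructor), so
    formulas that agree with a rational expression on [O], such as entries of
    [invmx] or functions defined by cases on indices, count as rational there;
    the denominators are recorded by the constructor for inverses. *)
Inductive ratf O : ('M[R]_(p, q) -> R) -> Prop :=
| ratf_coord i j : ratf O (fun y => y i j)
| ratf_cst c : ratf O (fun=> c)
| ratfD f g : ratf O f -> ratf O g -> ratf O (fun y => f y + g y)
| ratfM f g : ratf O f -> ratf O g -> ratf O (fun y => f y * g y)
| ratfV f : (forall y, O y -> f y != 0) -> ratf O f ->
    ratf O (fun y => (f y)^-1)
| ratf_eq f g : (forall y, O y -> f y = g y) -> ratf O f -> ratf O g.

Lemma ratfN O f : ratf O f -> ratf O (fun y => - f y).
Proof.
move=> rf; apply: (@ratf_eq _ (fun y => (-1) * f y)) => [y _|].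
  by rewrite mulN1r.
by apply: ratfM => //; exact: ratf_cst.
Qed.

Lemma ratfB O f g : ratf O f -> ratf O g -> ratf O (fun y => f y - g y).
Proof. by move=> rf rg; apply: ratfD => //; exact: ratfN. Qed.

Lemma ratf_div O f g : (forall y, O y -> g y != 0) ->
  ratf O f -> ratf O g -> ratf O (fun y => f y / g y).
Proof. by move=> g0 rf rg; apply: ratfM => //; exact: ratfV. Qed.

Lemma ratf_sum O (I : Type) (r : seq I) (P : pred I) (F : I -> 'M[R]_(p, q) -> R) :
  (forall i, P i -> ratf O (F i)) -> ratf O (fun y => \sum_(i <- r | P i) F i y).
Proof.
move=> rF; elim: r => [|i r IH].
  by apply: ratf_eq (ratf_cst O 0) => y _; rewrite big_nil.
case: (boolP (P i)) => Pi.
  by apply: ratf_eq (ratfD (rF i Pi) IH) => y _; rewrite big_cons Pi.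
by apply: ratf_eq IH => y _; rewrite big_cons (negbTE Pi).
Qed.

Lemma ratf_prod O (I : Type) (r : seq I) (P : pred I) (F : I -> 'M[R]_(p, q) -> R) :
  (forall i, P i -> ratf O (F i)) -> ratf O (fun y => \prod_(i <- r | P i) F i y).
Proof.
move=> rF; elim: r => [|i r IH].
  by apply: ratf_eq (ratf_cst O 1) => y _; rewrite big_nil.
case: (boolP (P i)) => Pi.
  by apply: ratf_eq (ratfM (rF i Pi) IH) => y _; rewrite big_cons Pi.
by apply: ratf_eq IH => y _; rewrite big_cons (negbTE Pi).
Qed.

Lemma ratf_sub O O' f : O `<=` O' -> ratf O' f -> ratf O f.
Proof.
move=> OO'; elim.
- by move=> *; exact: ratf_coord.
- by move=> *; exact: ratf_cst.
- by move=> *; exact: ratfD.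
- by move=> *; exact: ratfM.
- by move=> g g0 _ IH; apply: ratfV => // y /OO'; exact: g0.
- by move=> g h gh _ IH; apply: ratf_eq IH => y /OO'; exact: gh.
Qed.

Lemma ratf_cont O f x : open O -> ratf O f -> O x -> {for x, continuous f}.
Proof.
move=> oO rf Ox; elim: rf => {f}.
- by move=> i j; exact: coord_continuous.
- by move=> c; exact: cst_continuous.
- by move=> f g _ cf _ cg; exact: continuousD.
- by move=> f g _ cf _ cg; exact: continuousM.
- by move=> f f0 _ cf; apply: continuousV => //; exact: f0.
- move=> f g fg _ cf.
  have nfg : \forall y \near x, f y = g y.
    by apply: filterS (open_nbhs_nbhs (conj oO Ox)) => y; exact: fg.
  have cfg : f @ nbhs x --> g x by rewrite -(fg _ Ox); exact: cf.
  by apply: cvg_trans cfg; exact: (@near_eq_cvg _ _ (nbhs x) _ f g nfg).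
Qed.

Lemma derive_coord (x v : 'M[R]_(p, q)) i j :
  is_derive x v (fun y : 'M[R]_(p, q) => y i j) (v i j).
Proof.
have did : derivable (@id 'M[R]_(p, q)) x v by exact: derivable_id.
have dc := (derivable_mxP (@id 'M[R]_(p, q)) x v).1 did.
apply: DeriveDef; first exact: dc.
by have := derive_mx did => /matrixP/(_ i j); rewrite derive_id mxE => ->.
Qed.

Lemma ratf_derive O f v : open O -> ratf O f ->
  (forall x, O x -> derivable f x v) /\ ratf O ('D_v f).
Proof.
move=> oO; elim => {f}.
- move=> i j; split=> [x _|].
    by apply: ex_derive; exact: derive_coord.
  apply: ratf_eq (ratf_cst O (v i j)) => y _.
  by have := derive_coord y v i j; move=> /@derive_val ->.
- move=> c; split=> [x _|]; first exact: derivable_cst.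
  by apply: ratf_eq (ratf_cst O 0) => y _; rewrite derive_cst.
- move=> f g rf [df rdf] rg [dg rdg]; split=> [x Ox|].
    by apply: derivableD; [exact: df|exact: dg].
  apply: ratf_eq (ratfD rdf rdg) => y Oy.
  by rewrite deriveD //; [exact: df|exact: dg].
- move=> f g rf [df rdf] rg [dg rdg]; split=> [x Ox|].
    by apply: derivableM; [exact: df|exact: dg].
  apply: ratf_eq (ratfD (ratfM rf rdg) (ratfM rg rdf)) => y Oy.
  by rewrite deriveM //; [exact: df|exact: dg].
- move=> f f0 rf [df rdf]; split=> [x Ox|].
    by apply: derivableV; [exact: f0|exact: df].
  have rf2 := ratfM (ratfV f0 rf) (ratfV f0 rf).
  apply: ratf_eq (ratfM (ratfN rf2) rdf) => y Oy.
  rewrite deriveV; [|exact: f0|exact: df].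
  by rewrite -invfM -expr2.
- move=> f g fg rf [df rdf].
  have nfg x : O x -> \forall y \near x, f y = g y.
    by move=> Ox; apply: filterS (open_nbhs_nbhs (conj oO Ox)) => y; exact: fg.
  split=> [x Ox|].
    by apply: near_eq_derivable (df _ Ox); exact: nfg.
  by apply: ratf_eq rdf => y Oy; apply: near_eq_derive; exact: nfg.
Qed.

Definition ratm O p' q' (F : 'M[R]_(p, q) -> 'M[R]_(p', q')) :=
  forall i j, ratf O (fun y => F y i j).

Lemma mx_cvg (T : topologicalType) p' q' (F : T -> 'M[R]_(p', q')) x :
  (forall i j, {for x, continuous (fun y => F y i j)}) ->
  {for x, continuous F}.
Proof.
move=> cF; apply/cvg_mx_entourageP => A eA.
apply: filter_forall => i; apply: filter_forall => j.
have := cF i j; move/cvg_app_entourageP => /(_ _ eA).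
by apply: filterS => y yA; apply/mem_set.
Qed.

Lemma ratm_cont O p' q' (F : 'M[R]_(p, q) -> 'M[R]_(p', q')) x :
  open O -> ratm O F -> O x -> {for x, continuous F}.
Proof. by move=> oO rF Ox; apply: mx_cvg => i j; apply: (ratf_cont oO (rF i j) Ox). Qed.

(** Regular rational functions on an open set are continuous and stable under
    directional derivatives, which is all that smoothness asks for. *)
Lemma ratm_smooth O p' q' (F : 'M[R]_(p, q) -> 'M[R]_(p', q')) :
  open O -> ratm O F -> smooth_on O F.
Proof.
move=> oO + k; elim: k F => [|k IH] F rF /=.
  by move=> x Ox; exact: ratm_cont oO rF Ox.
move=> v; have dF x : O x -> derivable F x v.
  by move=> Ox; apply/derivable_mxP => i j; apply: (ratf_derive v oO _).1.
split=> //; apply: IH => i j.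
have [_] := ratf_derive v oO (rF i j); apply: ratf_eq => y Oy.
by rewrite derive_mx ?mxE//; exact: dF.
Qed.

Lemma open_preim O p' q' (F : 'M[R]_(p, q) -> 'M[R]_(p', q')) (B : set _) :
  open O -> (forall x, O x -> {for x, continuous F}) -> open B ->
  open (O `&` F @^-1` B).
Proof.
move=> oO cF oB; rewrite openE => x [Ox Bx]; apply: filterI.
  exact: open_nbhs_nbhs.
by apply: (cF x Ox); exact: open_nbhs_nbhs.
Qed.

End RationalMaps.

Lemma ratf_comp (R : realType) p q p' q' (O : set 'M[R]_(p, q))
    (O' : set 'M[R]_(p', q')) F f :
  ratm O F -> (forall y, O y -> O' (F y)) -> ratf O' f -> ratf O (f \o F).
Proof.
move=> rF OO'; elim => {f}.
- by move=> i j; exact: rF.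
- by move=> c; exact: ratf_cst.
- by move=> f g _ rf _ rg; exact: ratfD.
- by move=> f g _ rf _ rg; exact: ratfM.
- by move=> f f0 _ rf; apply: ratfV => // y Oy; exact/f0/OO'.
- by move=> f g fg _; apply: ratf_eq => y Oy; exact/fg/OO'.
Qed.

Section CoordinateSubspaces.
Context {R : realType} {p q : nat} (F : {set 'I_p * 'I_q}).

Definition coord_space : {vspace 'M[R]_(p, q)} :=
  (\sum_(ij in F) <[delta_mx ij.1 ij.2]>)%VS.

Definition coord_proj (y : 'M[R]_(p, q)) : 'M[R]_(p, q) :=
  \matrix_(i, j) (if (i, j) \in F then y i j else 0).

Lemma mem_coord_space (y : 'M[R]_(p, q)) :
  y \in coord_space <-> forall i j, (i, j) \notin F -> y i j = 0.
Proof.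
split=> [/memv_sumP[v vP ->] i j ijF|y0].
  rewrite summxE big1 // => -[k l] klF.
  have /vlineP[c ->] := vP _ klF; rewrite !mxE /=.
  have [/andP[/eqP ik /eqP jl]|] := boolP ((i == k) && (j == l)).
    by move: ijF; rewrite ik jl klF.
  by rewrite mulr0.
rewrite (matrix_sum_delta y) pair_big /=; apply: rpred_sum => -[k l] _ /=.
have [klF|klF] := boolP ((k, l) \in F); last by rewrite y0 // scale0r mem0v.
apply: memvZ; suff /subvP : (<[delta_mx k l]> <= coord_space)%VS.
  by apply; exact: memv_line.
exact: (sumv_sup (k, l)).
Qed.

Lemma dim_coord_space : \dim coord_space = #|F|.
Proof.
have /directvP -> : directv (\sum_(ij in F) <[delta_mx ij.1 ij.2 : 'M[R]_(p, q)]>)%VS.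
  apply/directv_sum_independent => u uP u0 [k l] klF.
  have [c uc] := vlineP _ _ (uP _ klF).
  have := congr1 (fun M : 'M[R]_(p, q) => M k l) u0.
  rewrite summxE mxE (bigD1 (k, l)) //= big1 ?addr0 => [|[i j] /andP[ijF ne]].
    by rewrite uc !mxE !eqxx mulr1 => ->; rewrite scale0r.
  have [d ->] := vlineP _ _ (uP _ ijF); rewrite !mxE /=.
  have [/andP[/eqP ki /eqP lj]|] := boolP ((k == i) && (l == j)).
    by rewrite ki lj eqxx in ne.
  by rewrite mulr0.
rewrite /= -sum1_card; apply: eq_bigr => -[k l] _; rewrite dim_vline.
suff -> : (delta_mx k l : 'M[R]_(p, q)) != 0 by [].
by apply/eqP => /matrixP/(_ k l); rewrite !mxE !eqxx => /eqP; rewrite oner_eq0.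
Qed.

End CoordinateSubspaces.

(** A set that is, in the coordinates [Phi], the graph of a rational map over
    the coordinates in [F] is straightened by subtracting that map. Here the
    map is encoded as [s], which keeps the coordinates in [F] and recomputes
    the others from them, so that the graph is the set of fixed points. *)
Lemma graph_chart (R : realType) p q (S : set 'M[R]_(p, q)) (x : 'M[R]_(p, q))
    (F : {set 'I_p * 'I_q}) (U0 U1 U1' O : set 'M[R]_(p, q))
    (Phi Psi s : 'M[R]_(p, q) -> 'M[R]_(p, q)) :
  open U0 -> open U1 -> open U1' -> open O -> U0 x -> U1 x -> S x ->
  ratm U1 Phi -> ratm U1' Psi -> ratm O s ->
  (forall y, U1 y -> U1' (Phi y)) -> (forall z, U1' z -> U1 (Psi z)) ->
  (forall y, U1 y -> Psi (Phi y) = y) -> (forall z, U1' z -> Phi (Psi z) = z) ->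
  O `<=` U1' ->
  (forall z z' : 'M[R]_(p, q), (forall i j, (i, j) \in F -> z i j = z' i j) ->
     s z = s z' /\ (O z -> O z')) ->
  (forall (z : 'M[R]_(p, q)) i j, (i, j) \in F -> s z i j = z i j) ->
  (forall y, U0 y -> U1 y -> (S y <-> O (Phi y) /\ s (Phi y) = Phi y)) ->
  exists (U U' : set 'M[R]_(p, q)) (phi psi : 'M[R]_(p, q) -> 'M[R]_(p, q))
           (L : {vspace 'M[R]_(p, q)}),
      [/\ U x, diffeo_on U U' phi psi, \dim L = #|F| &
          forall y, U y -> (S y <-> phi y \in L)].
Proof.
move=> oU0 oU1 oU1' oO U0x U1x Sx rPhi rPsi rs U11' U1'1 PhiK PsiK OU1' sF sF' SP.
pose phi1 (z : 'M[R]_(p, q)) := z - s z + coord_proj F z.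
pose psi1 (z : 'M[R]_(p, q)) := z + s z - coord_proj F z.
have phi1F z i j : (i, j) \in F -> phi1 z i j = z i j.
  by move=> ijF; rewrite !mxE ijF (sF' _ _ _ ijF) subrr add0r.
have psi1F z i j : (i, j) \in F -> psi1 z i j = z i j.
  by move=> ijF; rewrite !mxE ijF (sF' _ _ _ ijF) addrK.
have agree_proj (z z' : 'M[R]_(p, q)) : (forall i j, (i, j) \in F -> z i j = z' i j) ->
    coord_proj F z = coord_proj F z'.
  by move=> zz'; apply/matrixP => i j; rewrite !mxE; case: ifP => // /zz'.
have phi1O z : O z -> O (phi1 z).
  by apply: (sF _ _ _).2 => i j ijF; rewrite phi1F.
have psi1O z : O z -> O (psi1 z).
  by apply: (sF _ _ _).2 => i j ijF; rewrite psi1F.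
have phi1K z : psi1 (phi1 z) = z.
  rewrite /psi1 (sF _ _ (phi1F z)).1 (agree_proj _ _ (phi1F z)) /phi1.
  by rewrite addrAC addrK subrK.
have psi1K z : phi1 (psi1 z) = z.
  rewrite /phi1 (sF _ _ (psi1F z)).1 (agree_proj _ _ (psi1F z)) /psi1.
  by rewrite addrAC subrK addrK.
have rproj (O' : set 'M[R]_(p, q)) : ratm O' (coord_proj F).
  move=> i j; have [ijF|ijF] := boolP ((i, j) \in F).
    by apply: ratf_eq (ratf_coord O' i j) => y _; rewrite mxE ijF.
  by apply: ratf_eq (ratf_cst O' 0) => y _; rewrite mxE (negbTE ijF).
have rphi1 : ratm O phi1.
  move=> i j; have := ratfD (ratfB (ratf_coord O i j) (rs i j)) (rproj O i j).
  by apply: ratf_eq => y _; rewrite !mxE.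
have rpsi1 : ratm O psi1.
  move=> i j; have := ratfB (ratfD (ratf_coord O i j) (rs i j)) (rproj O i j).
  by apply: ratf_eq => y _; rewrite !mxE.
have [OPx sPx] := (SP x U0x U1x).1 Sx.
pose U := U0 `&` (U1 `&` Phi @^-1` O).
have rpsi : ratm O (Psi \o psi1).
  have psi1U z : O z -> U1' (psi1 z) by move=> /psi1O/OU1'.
  by move=> i j; exact: (ratf_comp rpsi1 psi1U (rPsi i j)).
pose U' := O `&` (Psi \o psi1) @^-1` U0.
have oU : open U.
  apply: openI oU0 _.
  exact: open_preim oU1 (fun y U1y => ratm_cont oU1 rPhi U1y) oO.
have oU' : open U'.
  exact: open_preim oO (fun y Oy => ratm_cont oO rpsi Oy) oU0.
exists U, U', (phi1 \o Phi), (Psi \o psi1), (coord_space F); split.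
- by split.
- split=> //.
  + apply: ratm_smooth => // i j.
    have rPhiU : ratm U Phi by move=> k l; apply: ratf_sub (rPhi k l) => y [_ []].
    have PhiO y : U y -> O (Phi y) by case=> _ [].
    exact: (ratf_comp rPhiU PhiO (rphi1 i j)).
  + apply: ratm_smooth => // i j.
    by apply: ratf_sub (rpsi i j) => y [].
  + split=> /=.
    * move=> y [U0y [U1y Oy]]; split; first exact: phi1O.
      by rewrite /= phi1K PhiK.
    * move=> z [Oz U0z]; split=> //=; split; first exact/U1'1/OU1'/psi1O.
      by rewrite /= PsiK; [exact: psi1O|exact/OU1'/psi1O].
    * by move=> y [U0y [U1y Oy]]; rewrite phi1K PhiK.
    * by move=> z [Oz U0z]; rewrite PsiK ?psi1K //; exact/OU1'/psi1O.
- exact: dim_coord_space.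
- move=> y [U0y [U1y Oy]]; rewrite SP // mem_coord_space /=; split.
    move=> [_ sy] i j ijF; rewrite /phi1 !mxE sy (negbTE ijF).
    by rewrite subrr addr0.
  move=> yL; split=> //; apply/matrixP => i j.
  have [ijF|ijF] := boolP ((i, j) \in F); first exact: sF'.
  have := yL i j ijF; rewrite /phi1 !mxE (negbTE ijF) addr0 => /eqP.
  by rewrite subr_eq0 => /eqP.
Qed.

(** * Convex hulls, affine hulls and faces *)

Section Dot.
Context {R : realType} {d : nat}.
Implicit Types a b x y : 'cV[R]_d.

Definition dot a x : R := (a^T *m x) 0 0.

Lemma dotE a x : dot a x = \sum_r a r 0 * x r 0.
Proof. by rewrite /dot mxE; apply: eq_bigr => r _; rewrite mxE. Qed.

Lemma dotDr a x y : dot a (x + y) = dot a x + dot a y.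
Proof. by rewrite /dot mulmxDr mxE. Qed.

Lemma dotBr a x y : dot a (x - y) = dot a x - dot a y.
Proof. by rewrite /dot mulmxBr !mxE. Qed.

Lemma dotZr a c x : dot a (c *: x) = c * dot a x.
Proof. by rewrite /dot -scalemxAr mxE. Qed.

Lemma dotZl a c x : dot (c *: a) x = c * dot a x.
Proof. by rewrite /dot linearZ /= -scalemxAl mxE. Qed.

Lemma dot0r a : dot a 0 = 0.
Proof. by rewrite /dot mulmx0 mxE. Qed.

Lemma dot_suml (I : Type) (r : seq I) (P : pred I) (F : I -> 'cV[R]_d) x :
  dot (\sum_(i <- r | P i) F i) x = \sum_(i <- r | P i) dot (F i) x.
Proof. by rewrite /dot linear_sum mulmx_suml summxE. Qed.

Lemma dot_sumr (I : Type) (r : seq I) (P : pred I) (F : I -> 'cV[R]_d) a :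
  dot a (\sum_(i <- r | P i) F i) = \sum_(i <- r | P i) dot a (F i).
Proof. by rewrite /dot mulmx_sumr summxE. Qed.

Lemma mulmx_sum_colE k (V : 'M[R]_(d, k)) w : V *m w = \sum_i w i 0 *: col i V.
Proof.
apply/matrixP => r c; rewrite ord1 summxE mxE.
by apply: eq_bigr => i _; rewrite !mxE mulrC.
Qed.

Lemma dot_mulmx a k (V : 'M[R]_(d, k)) w :
  dot a (V *m w) = \sum_i w i 0 * dot a (col i V).
Proof. by rewrite mulmx_sum_colE dot_sumr; apply: eq_bigr => i _; rewrite dotZr. Qed.

Lemma polyhedronE m (A : 'M[R]_(d, m)) x :
  polyhedron A x = (forall j, dot (col j A) x <= 1).
Proof.
rewrite /polyhedron /mkset; apply/propext; split=> + j => /(_ j).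
  by rewrite /dot !mxE; under eq_bigr do rewrite !mxE; under [X in _ -> X <= 1]eq_bigr do rewrite !mxE.
by rewrite /dot !mxE; under eq_bigr do rewrite !mxE; under [X in _ -> X <= 1]eq_bigr do rewrite !mxE.
Qed.

Lemma dot_col m (A : 'M[R]_(d, m)) x j : (A^T *m x) j 0 = dot (col j A) x.
Proof. by rewrite /dot !mxE; apply: eq_bigr => r _; rewrite !mxE. Qed.

End Dot.

Section ConvexHull.
Context {R : realType}.

Lemma convex_setP d (S : set 'cV[R]_d) : @convex_set R 'cV[R]_d S <->
  forall t x y, 0 <= t -> t <= 1 -> S x -> S y -> S (t *: x + (1 - t) *: y).
Proof.
split=> [cS t x y t0 t1 Sx Sy|cS x y l /set_mem Sx /set_mem Sy].
  by have := cS x y (Itv01 t0 t1) (mem_set Sx) (mem_set Sy) => /set_mem.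
by apply/mem_set; apply: cS.
Qed.

(** Peeling off the first point leaves a combination whose weights have to be
    rescaled by [1 - w 0]; when this vanishes, so do all other weights. *)
Lemma convex_comb d (S : set 'cV[R]_d) k (v : 'I_k -> 'cV[R]_d) (w : 'I_k -> R) :
  @convex_set R 'cV[R]_d S -> (forall i, S (v i)) -> (forall i, 0 <= w i) ->
  \sum_i w i = 1 -> S (\sum_i w i *: v i).
Proof.
move=> /convex_setP cS; elim: k v w => [|k IH] v w Sv w0.
  by rewrite big_ord0 => /eqP; rewrite eq_sym oner_eq0.
rewrite !big_ord_recl => w1.
have [w01|w01] := eqVneq (w ord0) 1.
  have /psumr_eq0P ws0 : \sum_(i < k) w (lift ord0 i) = 0.
    by apply: (addrI 1); rewrite -{1}w01 w1 addr0.
  rewrite w01 scale1r big1 ?addr0 // => i _.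
  by rewrite ws0 ?scale0r.
have w0lt : 0 < 1 - w ord0.
  rewrite subr_gt0 lt_neqAle w01 /= -w1 lerDl; exact: sumr_ge0.
have -> : \sum_(i < k) w (lift ord0 i) *: v (lift ord0 i) =
    (1 - w ord0) *: \sum_(i < k) (w (lift ord0 i) / (1 - w ord0)) *: v (lift ord0 i).
  rewrite scaler_sumr; apply: eq_bigr => i _; rewrite scalerA mulrC divfK //.
  by rewrite gt_eqF.
apply: cS => //; first by rewrite -subr_ge0 ltW.
apply: IH => [i|i|]; first exact: Sv.
  by apply: divr_ge0 => //; exact: ltW.
by rewrite -mulr_suml -[X in X / _](addKr (w ord0)) w1 addrC divff // gt_eqF.
Qed.

Lemma conv_hull_convex d (S : set 'cV[R]_d) :
  @convex_set R 'cV[R]_d (conv_hull S).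
Proof.
apply/convex_setP => t x y t0 t1 Sx Sy T [cT ST].
by move/convex_setP: (cT); apply => //; [apply: Sx|apply: Sy].
Qed.

Lemma sub_conv_hull d (S : set 'cV[R]_d) : S `<=` conv_hull S.
Proof. exact: sub_gen_smallest. Qed.

Lemma conv_hull_sub d (S T : set 'cV[R]_d) :
  @convex_set R 'cV[R]_d T -> S `<=` T -> conv_hull S `<=` T.
Proof. exact: smallest_sub. Qed.

Lemma convP d k (V : 'M[R]_(d, k)) x :
  conv V x <-> exists w : 'cV[R]_k,
    [/\ forall i, 0 <= w i 0, \sum_i w i 0 = 1 & x = V *m w].
Proof.
split=> [|[w [w0 w1 ->]]]; last first.
  rewrite mulmx_sum_colE; apply: convex_comb => // [|i]; first exact: conv_hull_convex.
  by apply: sub_conv_hull; exists i.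
apply: (@conv_hull_sub _ _ [set x | exists w : 'cV[R]_k,
    [/\ forall i, 0 <= w i 0, \sum_i w i 0 = 1 & x = V *m w]]).
  apply/convex_setP => t _ _ t0 t1 [w [w0 w1 ->]] [u [u0 u1 ->]].
  exists (t *: w + (1 - t) *: u); split.
  - move=> i; rewrite !mxE addr_ge0 // mulr_ge0 //; lra.
  - under eq_bigr do rewrite !mxE.
    by rewrite big_split /= -!mulr_sumr w1 u1; ring.
  - by rewrite mulmxDr -!scalemxAr.
move=> _ [i _ <-]; exists (delta_mx i 0); split.
- by move=> j; rewrite mxE ler0n.
- rewrite (bigD1 i) //= big1 => [|j /negbTE ji]; last by rewrite mxE ji.
  by rewrite addr0 mxE !eqxx.
- by rewrite colE.
Qed.

Lemma conv_col d k (V : 'M[R]_(d, k)) i : conv V (col i V).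
Proof. by apply: sub_conv_hull; exists i. Qed.

Lemma conv_convex d k (V : 'M[R]_(d, k)) t x y :
  0 <= t -> t <= 1 -> conv V x -> conv V y -> conv V (t *: x + (1 - t) *: y).
Proof. by move: t x y; apply/convex_setP; exact: conv_hull_convex. Qed.

Lemma polyhedron_convex d m (A : 'M[R]_(d, m)) :
  @convex_set R 'cV[R]_d (polyhedron A).
Proof.
apply/convex_setP => t x y t0 t1; rewrite !polyhedronE => Ax Ay j.
have := Ax j; have := Ay j; rewrite dotDr !dotZr => aj1 aj2; nra.
Qed.

End ConvexHull.

Section AffineHull.
Context {R : realType} {d : nat}.
Implicit Types (S T P F G : set 'cV[R]_d) (a : 'cV[R]_d) (b : R).

Lemma sub_aff_hull S : S `<=` aff_hull S.
Proof.
move=> x Sx; exists 1%N, x, 1; split.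
- by move=> i; suff -> : col i x = x by []; apply/matrixP => r c; rewrite !mxE !ord1.
- by rewrite big_ord1 mxE.
- by rewrite mulmx1.
Qed.

Lemma aff_hull_mono S T : S `<=` T -> aff_hull S `<=` aff_hull T.
Proof.
by move=> ST x [k [V [w [VS w1 ->]]]]; exists k, V, w; split => // i; apply: ST.
Qed.

Lemma aff_hull_const S a b :
  (forall x, S x -> dot a x = b) -> forall x, aff_hull S x -> dot a x = b.
Proof.
move=> Sab _ [k [V [w [VS w1 ->]]]]; rewrite dot_mulmx.
under eq_bigr do rewrite (Sab _ (VS _)).
by rewrite -mulr_suml w1 mul1r.
Qed.

(** An affine map between the two parametrizations has a linear part [D] with
    [B = C *m D], so ranks compare, and [D] is invertible if they agree. *)
Lemma has_dim_sub S T k l : aff_hull S `<=` aff_hull T ->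
  has_dim S k -> has_dim T l ->
  (k <= l)%N /\ (k = l -> aff_hull T `<=` aff_hull S).
Proof.
move=> ST [p [B [rB SE]]] [q [C [rC TE]]].
have : forall c : 'cV[R]_k, exists e, p + B *m c = q + C *m e.
  move=> c; have : aff_hull T (p + B *m c) by apply: ST; rewrite SE; exists c.
  by rewrite TE => -[e _ <-]; exists e.
move=> /choice[h hE].
pose D := \matrix_(i, j) (h (delta_mx j 0) - h 0) i 0.
have BCD : B = C *m D.
  have colBE j : col j B = C *m (h (delta_mx j 0) - h 0).
    rewrite mulmxBr -(addKr q (C *m h (delta_mx j 0))) -hE.
    rewrite -(addKr q (C *m h 0)) -hE mulmx0 addr0 -colE.
    by apply/matrixP => r c; rewrite !mxE; ring.
  apply/matrixP => r j; have /matrixP/(_ r 0) := colBE j; rewrite mxE => ->.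
  by rewrite !mxE; apply: eq_bigr => i _; rewrite !mxE.
split; first by rewrite -rB -rC BCD mxrankM_maxl.
move=> kl; subst l; rewrite SE TE => _ [c _ <-].
have uD : D \in unitmx.
  rewrite -row_free_unit /row_free eqn_leq rank_leq_row -{1}rB BCD.
  exact: mxrankM_maxr.
exists (invmx D *m (c - h 0)) => //.
rewrite BCD -mulmxA mulKVmx // mulmxBr.
have := hE 0; rewrite mulmx0 addr0 => ->.
by apply/matrixP => r j; rewrite !mxE; ring.
Qed.

Lemma has_dim_uniq S k l : has_dim S k -> has_dim S l -> k = l.
Proof.
move=> Sk Sl; apply/eqP; rewrite eqn_leq.
by rewrite (has_dim_sub _ Sk Sl).1 ?(has_dim_sub _ Sl Sk).1.
Qed.

Lemma face_sub P F : is_face P F -> F `<=` P.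
Proof. by move=> [a [b [_ ->]]] x []. Qed.

(** A face is cut out by a hyperplane, which contains its affine hull. *)
Lemma face_eq_dim P F G k : is_face P F -> is_face P G -> F `<=` G ->
  has_dim F k -> has_dim G k -> F = G.
Proof.
move=> [a [b [_ FE]]] fG FG dF dG; apply/seteqP; split=> // x Gx.
have GF := (has_dim_sub (aff_hull_mono FG) dF dG).2 erefl.
rewrite FE; split; first exact: (face_sub fG).
apply: (@aff_hull_const F); first by move=> y; rewrite FE => -[].
exact/GF/sub_aff_hull.
Qed.

End AffineHull.

(** * Flags *)

(** Functionals [a k] and points [x l] as along a complete flag: the matrix of
    the values [a k (x l.+1 - x 0)] is triangular, so both families are bases.
    Hence the flag starts at a single point, ends in a facet and spans. *)
Section Flag.
Context {R : realType} {d : nat} (a x : nat -> 'cV[R]_d.+1) (b : nat -> R).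
Hypothesis flag0 : forall k l, (k < d.+1)%N -> (l <= k)%N -> dot (a k) (x l) = b k.
Hypothesis flag1 : forall k, (k < d.+1)%N -> dot (a k) (x k.+1) != b k.

Let Am : 'M[R]_d.+1 := \matrix_(r, k) a k r 0.
Let X : 'M[R]_d.+1 := \matrix_(r, l) (x l.+1 - x 0) r 0.

Let AmX k l : (Am^T *m X) k l = dot (a k) (x l.+1 - x 0).
Proof. by rewrite dotE mxE; apply: eq_bigr => r _; rewrite !mxE. Qed.

Let det_AmX : \det (Am^T *m X) != 0.
Proof.
rewrite -det_tr det_trig; last first.
  apply/is_trig_mxP => i j ij; rewrite mxE AmX dotBr !flag0 ?subrr //.
apply/prodf_neq0 => i _; rewrite mxE AmX dotBr (flag0 _ (leq0n _)) //.
by rewrite subr_eq0; exact: flag1.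
Qed.

Let X_unit : X \in unitmx.
Proof. by have := det_AmX; rewrite -unitfE -unitmxE unitmx_mul => /andP[]. Qed.

Let Am_unit : Am^T \in unitmx.
Proof. by have := det_AmX; rewrite -unitfE -unitmxE unitmx_mul => /andP[]. Qed.

Lemma flag_vertex y : (forall k, (k < d.+1)%N -> dot (a k) y = b k) -> y = x 0.
Proof.
move=> ay; apply/eqP; rewrite -subr_eq0; apply/eqP.
rewrite -[LHS](mulKmx Am_unit).
suff -> : Am^T *m (y - x 0) = 0 by rewrite mulmx0.
apply/matrixP => k c; rewrite ord1 !mxE.
have := dotBr (a k) y (x 0); rewrite ay // flag0 // subrr dotE => E.
by rewrite -[RHS]E; apply: eq_bigr => r _; rewrite !mxE.
Qed.

Let comb_aff (S : set 'cV[R]_d.+1) (c : 'cV[R]_d.+1) : S (x 0) ->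
  (forall l : 'I_d.+1, c l 0 != 0 -> S (x l.+1)) -> aff_hull S (x 0 + X *m c).
Proof.
move=> S0 Sl.
pose pt (l : 'I_d.+1) := if c l 0 == 0 then x 0 else x l.+1.
pose V := \matrix_(r < d.+1, l < d.+2)
  (if unlift ord0 l is Some l' then pt l' r 0 else x 0%N r 0).
exists d.+2, V, (\col_l (if unlift ord0 l is Some l' then c l' 0 else 1 - \sum_l c l 0)).
split.
- move=> l; case: (unliftP ord0 l) => [l' ->|->].
    suff -> : col (lift ord0 l') V = pt l'.
      by rewrite /pt; case: ifPn => // /Sl.
    by apply/matrixP => r j; rewrite !mxE liftK !ord1.
  suff -> : col ord0 V = x 0%N by [].
  by apply/matrixP => r j; rewrite !mxE unlift_none !ord1.
- rewrite big_ord_recl !mxE unlift_none.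
  under [X in _ + X]eq_bigr do rewrite mxE liftK.
  by rewrite subrK.
- apply/matrixP => r j; rewrite !ord1 mxE [RHS]mxE big_ord_recl !mxE unlift_none.
  under [X in _ = _ + X]eq_bigr do rewrite !mxE liftK.
  rewrite mulrBr mulr1 -addrA; congr (_ + _).
  rewrite mulr_sumr addrC -sumrB; apply: eq_bigr => l _; rewrite !mxE /pt.
  by case: ifPn => [/eqP ->|_]; ring.
Qed.

Let decomp y : exists c, y = x 0 + X *m c.
Proof. by exists (invmx X *m (y - x 0)); rewrite mulKVmx // subrKC. Qed.

Lemma flag_full (S : set 'cV[R]_d.+1) :
  (forall l, (l <= d.+1)%N -> S (x l)) -> has_dim S d.+1.
Proof.
move=> Sx; exists 0, 1%:M; split; first by rewrite mxrank1.
apply/seteqP; split=> y _; first by exists y => //; rewrite mul1mx add0r.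
by have [c ->] := decomp y; apply: comb_aff => [|l _]; apply: Sx.
Qed.

Let colX k : col k X = x k.+1 - x 0%N.
Proof. by apply/matrixP => r j; rewrite !mxE ord1. Qed.

Let dot_last c : dot (a d) (x 0%N + X *m c) = b d -> c ord_max 0 = 0.
Proof.
rewrite dotDr dot_mulmx flag0 // => /eqP.
rewrite addrC -subr_eq0 addrK (bigD1 ord_max) //= big1 => [|k kl].
  rewrite addr0 mulf_eq0 colX dotBr (flag0 (ltnSn d) (leq0n d)) subr_eq0.
  by rewrite (negbTE (flag1 (ltnSn d))) orbF => /eqP.
rewrite colX dotBr !flag0 ?subrr ?mulr0 //.
rewrite ltn_neqAle -ltnS ltn_ord andbT.
by apply: contraNneq kl => kd; apply/eqP/val_inj.
Qed.

Lemma flag_facet_hull (S : set 'cV[R]_d.+1) :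
  (forall l, (l <= d)%N -> S (x l)) -> (forall y, S y -> dot (a d) y = b d) ->
  aff_hull S = [set y | dot (a d) y = b d].
Proof.
move=> Sx Sab; apply/seteqP; split=> y; first exact: aff_hull_const.
have [c ->] := decomp y => /= /dot_last c0; apply: comb_aff => [|l cl].
  exact: Sx.
apply: Sx; rewrite ltn_neqAle -ltnS ltn_ord andbT.
by apply: contraNneq cl => ld; rewrite -c0 (_ : l = ord_max) //; exact/val_inj.
Qed.

Lemma flag_facet_dim (S : set 'cV[R]_d.+1) :
  (forall l, (l <= d)%N -> S (x l)) -> (forall y, S y -> dot (a d) y = b d) ->
  has_dim S d.
Proof.
move=> Sx Sab.
pose B := \matrix_(r < d.+1, l < d) X r (widen_ord (leqnSn d) l).
exists (x 0%N), B; split.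
  pose D : 'M[R]_(d, d.+1) := \matrix_(l, r) invmx X (widen_ord (leqnSn d) l) r.
  have DB : D *m B = 1%:M.
    apply/matrixP => k l; have /matrixP := mulVmx X_unit.
    move=> /(_ (widen_ord (leqnSn d) k) (widen_ord (leqnSn d) l)).
    rewrite [X in X = _ -> _]mxE [in X in _ = X -> _]mxE => E.
    rewrite [LHS]mxE [RHS]mxE -[RHS]E.
    by apply: eq_bigr => r _; rewrite !mxE.
  apply/eqP; rewrite eqn_leq rank_leq_col -{1}(mxrank1 R d) -DB.
  exact: mxrankM_maxr.
rewrite flag_facet_hull //; apply/seteqP; split=> y /=.
  have [c ->] := decomp y => /dot_last c0.
  exists (\col_l c (widen_ord (leqnSn d) l) 0) => //; congr (_ + _).
  apply/matrixP => r j; rewrite !ord1 !mxE big_ord_recr /= c0 mulr0 addr0.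
  by apply: eq_bigr => l _; rewrite !mxE.
move=> [c _ <-]; rewrite dotDr dot_mulmx flag0 // big1 ?addr0 // => k _.
have -> : col k B = x k.+1 - x 0%N by apply/matrixP => r j; rewrite !mxE ord1.
by rewrite dotBr !flag0 ?subrr ?mulr0.
Qed.

End Flag.

(** * Faces of a polytope with both descriptions *)

Lemma fin_pos_lb (R : realFieldType) (T : finType) (f : T -> R) :
  (forall t, 0 < f t) -> exists2 e, 0 < e & forall t, e <= f t.
Proof.
move=> f0; exists (\big[Num.min/1]_t f t).
  by apply/bigmin_gtP; split=> [|t _]; [exact: ltr01|exact: f0].
by move=> t; exact: bigmin_le_cond.
Qed.

Definition inc (R : realType) d n m (V : 'M[R]_(d, n)) (A : 'M[R]_(d, m)) i j :=
  dot (col j A) (col i V) == 1.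

Definition Fc (R : realType) d n m (V : 'M[R]_(d, n)) (A : 'M[R]_(d, m))
    (J : {set 'I_m}) : set 'cV[R]_d :=
  [set x | conv V x /\ forall j, j \in J -> dot (col j A) x = 1].

Lemma Fc1E (R : realType) d n m (V : 'M[R]_(d, n)) (A : 'M[R]_(d, m)) j :
  [set x | conv V x /\ (A^T *m x) j 0 = 1] = Fc V A [set j]%SET.
Proof.
apply/seteqP; split=> x /= [Vx]; rewrite ?dot_col.
  by move=> xj; split=> // k; rewrite inE => /eqP ->.
by move=> /(_ j); rewrite inE eqxx => /(_ isT) xj; split; rewrite ?dot_col.
Qed.

Section Faces.
Context {R : realType} {d n m : nat} (V : 'M[R]_(d, n)) (A : 'M[R]_(d, m)).
Hypothesis VA : conv V = polyhedron A.
Local Notation inc := (inc V A).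
Local Notation Fc := (Fc V A).

Lemma dot_le1 x j : conv V x -> dot (col j A) x <= 1.
Proof. by rewrite VA polyhedronE. Qed.

(** The sum of the functionals in [J] defines the face. *)
Lemma Fc_is_face J : is_face (conv V) (Fc J).
Proof.
exists (\sum_(j in J) col j A), #|J|%:R; split=> [x Vx|].
  rewrite -/(dot _ _) dot_suml -sumr_const; apply: ler_sum => j _.
  exact: dot_le1.
apply/seteqP; split=> x [Vx xJ]; split=> //.
  by rewrite -/(dot _ _) dot_suml -sumr_const; apply: eq_bigr => j /xJ.
move: xJ; rewrite -/(dot _ _) dot_suml -sumr_const => /eqP.
rewrite eq_sym -subr_eq0 -sumrB psumr_eq0 => [/allP xJ j jJ|j _].
  apply/esym/eqP; rewrite -subr_eq0.
  by have := xJ j (mem_index_enum _); rewrite jJ.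
by rewrite subr_ge0 dot_le1.
Qed.

(** Averaging values at most 1 gives 1 only if every value with a nonzero
    weight is 1. *)
Lemma Fc_weights J x : Fc J x -> exists w : 'cV[R]_n,
  [/\ forall i, 0 <= w i 0, \sum_i w i 0 = 1, x = V *m w &
      forall i, w i 0 != 0 -> forall j, j \in J -> inc i j].
Proof.
move=> [/convP[w [w0 w1 ->]] xJ]; exists w; split=> // i wi j jJ.
have := xJ j jJ; rewrite dot_mulmx -w1 => /eqP.
rewrite eq_sym -subr_eq0 -sumrB psumr_eq0 => [/allP/(_ i (mem_index_enum _))|k _].
  rewrite /= -{1}[w i 0]mulr1 -mulrBr mulf_eq0 (negbTE wi) /= subr_eq0 eq_sym.
  by [].
by rewrite -{1}[w k 0]mulr1 -mulrBr mulr_ge0 // subr_ge0 dot_le1 //; exact: conv_col.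
Qed.

Lemma Fc_col J i : Fc J (col i V) <-> forall j, j \in J -> inc i j.
Proof.
split=> [[_ iJ] j jJ|iJ]; first exact/eqP/iJ.
by split=> [|j jJ]; [exact: conv_col|exact/eqP/iJ].
Qed.

Lemma Fc_nonempty J : Fc J !=set0 -> exists i, forall j, j \in J -> inc i j.
Proof.
move=> [x /Fc_weights[w [w0 w1 _ wJ]]].
have [[i /wJ iJ]|wall] := pselect (exists i, w i 0 != 0); first by exists i.
suff : \sum_i w i 0 = 0 by rewrite w1 => /eqP; rewrite oner_eq0.
apply: big1 => i _; apply/eqP/negPn/negP => wi; apply: wall; by exists i.
Qed.

Lemma Fc_subP J K :
  Fc J `<=` Fc K <->
  (forall i, (forall j, j \in J -> inc i j) -> forall j, j \in K -> inc i j).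
Proof.
split=> [JK i /Fc_col/JK/Fc_col //|JK x Jx].
have [w [w0 w1 xw wJ]] := Fc_weights Jx; split=> [|j jK]; first by case: Jx.
rewrite xw dot_mulmx -w1; apply: eq_bigr => i _.
have [->|wi] := eqVneq (w i 0) 0; first by rewrite mul0r.
by have /eqP -> := JK i (wJ i wi) j jK; rewrite mulr1.
Qed.

(** The center [x] of suitable witnesses lies on no facet but those containing
    the whole face; a point [y] on all of these can be reflected through [x]
    without leaving the polytope, which puts [y] on the face. *)
Lemma face_Fc F : is_face (conv V) F -> F !=set0 ->
  F = Fc [set j | `[< F `<=` Fc [set j]%SET >]].
Proof.
move=> [c [b [cb FE]]] [x0 Fx0]; set J := [set j | _]%SET.
have FV x : F x -> conv V x by rewrite FE => -[].
have Fc' x : F x -> dot c x = b by rewrite FE => -[].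
have /choice[xs xsP] : forall j, exists x, F x /\ (j \notin J -> dot (col j A) x < 1).
  move=> j; have [jJ|jJ] := boolP (j \in J); first by exists x0.
  move: jJ; rewrite inE => /asboolPn; rewrite -existsNE => -[x /not_implyP[Fx xj]].
  exists x; split=> // _; rewrite lt_neqAle dot_le1 ?andbT; last exact: FV.
  apply/eqP => xj1; apply: xj; split; first exact: FV.
  by move=> k; rewrite inE => /eqP ->.
pose N : R := m.+1%:R.
have N0 : 0 < N by rewrite ltr0n.
pose x := N^-1 *: (x0 + \sum_j xs j).
have dotx a : dot a x = N^-1 * (dot a x0 + \sum_j dot a (xs j)).
  by rewrite dotZr dotDr dot_sumr.
have xle j : dot (col j A) x <= 1.
  rewrite dotx ler_pdivrMl // mulr1 /N -natr1 addrC lerD //; last first.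
    by apply: dot_le1; exact: FV.
  rewrite -[m in leRHS]card_ord -sumr_const; apply: ler_sum => k _.
  by apply: dot_le1; apply: FV; case: (xsP k).
have xlt j : j \notin J -> dot (col j A) x < 1.
  move=> jJ; rewrite dotx ltr_pdivrMl // mulr1 /N -natr1 addrC ltr_leD //; last first.
    by apply: dot_le1; exact: FV.
  rewrite -[m in ltRHS]card_ord -sumr_const (bigD1 j) //= [ltRHS](bigD1 j) //=.
  apply: ltr_leD; first exact: (xsP j).2.
  by apply: ler_sum => k _; apply: dot_le1; apply: FV; case: (xsP k).
have cx : dot c x = b.
  rewrite dotx Fc' //; under eq_bigr do rewrite (Fc' _ (xsP _).1).
  rewrite sumr_const card_ord -mulrS -mulr_natl mulrA mulVf ?mul1r //.
  exact: lt0r_neq0.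
apply/seteqP; split=> [y Fy|y [Vy yJ]].
  split=> [|j]; first exact: FV.
  by rewrite inE => /asboolP/(_ y Fy)[_]; apply; rewrite inE.
rewrite FE; split=> //; apply/eqP; rewrite eq_le; apply/andP; split; first exact: cb.
pose t j := (1 - dot (col j A) x) / (1 + `|dot (col j A) (x - y)|).
have den j : 0 < 1 + `|dot (col j A) (x - y)| by rewrite ltr_pwDl.
have [e e0 et] : exists2 e, 0 < e & forall j, (j \notin J) ==> (e <= t j).
  have [j|e e0 et] := @fin_pos_lb R 'I_m (fun j => if j \in J then 1 else t j).
    by case: ifPn => // /xlt jx; rewrite divr_gt0 ?subr_gt0.
  by exists e => // j; apply/implyP => jJ; have := et j; rewrite (negbTE jJ).
have /cb : conv V (x + e *: (x - y)).
  rewrite VA polyhedronE => j; rewrite dotDr [X in _ + X]dotZr.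
  have [jJ|jJ] := boolP (j \in J).
    have FJ z : F z -> dot (col j A) z = 1.
      by move: jJ; rewrite inE => /asboolP Fj /Fj[_]; apply; rewrite inE.
    have xj1 : dot (col j A) x = 1.
      rewrite dotx FJ //; under eq_bigr do rewrite (FJ _ (xsP _).1).
      by rewrite sumr_const card_ord -mulrS mulVf // lt0r_neq0.
    by rewrite dotBr (yJ _ jJ) xj1 subrr mulr0 addr0.
  rewrite addrC -lerBrDr; apply: le_trans (_ : e * (1 + `|dot (col j A) (x - y)|) <= _).
    rewrite ler_pM2l // (le_trans (ler_norm _)) // lerDr ler01 //.
  by rewrite -ler_pdivlMr //; have := et j; rewrite jJ.
rewrite -/(dot _ _) dotDr [X in _ + X]dotZr dotBr cx gerDl pmulr_rle0 // subr_le0.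
by [].
Qed.

End Faces.

(** * Incidence patterns determine the labeled face lattice *)

Section PatternIso.
Context {R : realType} {d d' n m : nat}.
Context (V : 'M[R]_(d, n)) (A : 'M[R]_(d, m)).
Context (V' : 'M[R]_(d', n)) (A' : 'M[R]_(d', m)).
Hypothesis VA : conv V = polyhedron A.
Hypothesis VA' : conv V' = polyhedron A'.
Hypothesis incE : forall i j, inc V A i j = inc V' A' i j.
Hypothesis proper : forall i, exists j, ~~ inc V A i j.

Let FcT0 : Fc V A [set: 'I_m]%SET = set0.
Proof.
apply/seteqP; split=> // x Fx; have [i iT] := Fc_nonempty VA (ex_intro _ x Fx).
by have [j] := proper i; rewrite iT // inE.
Qed.

Lemma Fc_sub_iff J K : Fc V A J `<=` Fc V A K <-> Fc V' A' J `<=` Fc V' A' K.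
Proof.
rewrite !Fc_subP //; split=> JK i; have := JK i.
  by move=> JKi iJ j jK; rewrite -incE; apply: JKi => // k kJ; rewrite incE iJ.
by move=> JKi iJ j jK; rewrite incE; apply: JKi => // k kJ; rewrite -incE iJ.
Qed.

Lemma face_FcE F : is_face (conv V) F ->
  F = Fc V A [set j | `[< F `<=` Fc V A [set j]%SET >]].
Proof.
move=> fF; have [F0|/set0P F0] := eqVneq F set0; last exact: face_Fc.
suff -> : [set j | `[< F `<=` Fc V A [set j]%SET >]]%SET = [set: 'I_m]%SET.
  by rewrite FcT0.
by apply/setP => j; rewrite !inE; apply/asboolP; rewrite F0.
Qed.

End PatternIso.

(** Every face is determined by the facets that contain it, and inclusion of
    faces by the incidences, so equal incidences give isomorphic lattices. The
    empty face is the intersection of all facets because every vertex misses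
    some facet. *)
Lemma pattern_iso (R : realType) d d' n m (V : 'M[R]_(d, n)) (A : 'M[R]_(d, m))
    (V' : 'M[R]_(d', n)) (A' : 'M[R]_(d', m)) :
  conv V = polyhedron A -> conv V' = polyhedron A' ->
  (forall i j, inc V A i j = inc V' A' i j) ->
  (forall i, exists j, ~~ inc V A i j) ->
  exists2 f, face_lattice_iso (conv V) (conv V') f &
    forall J, f (Fc V A J) = Fc V' A' J.
Proof.
move=> VA VA' incE proper.
have proper' i : exists j, ~~ inc V' A' i j.
  by have [j] := proper i; rewrite incE; exists j.
have subE J K := @Fc_sub_iff _ _ _ _ _ _ _ _ _ VA VA' incE J K.
pose lab F : {set 'I_m} := [set j | `[< F `<=` Fc V A [set j]%SET >]]%SET.
pose f F := Fc V' A' (lab F).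
have fFc J : f (Fc V A J) = Fc V' A' J.
  have E : Fc V A (lab (Fc V A J)) = Fc V A J by rewrite -(face_FcE VA proper) //; exact: Fc_is_face.
  by apply/seteqP; split; apply/subE; rewrite E.
have fE F : is_face (conv V) F -> F = Fc V A (lab F) by exact: face_FcE.
exists f => //; split; last first.
  by move=> F G /fE -> /fE ->; rewrite !fFc subE.
split.
- by move=> F /fE ->; rewrite fFc; exact: Fc_is_face.
- move=> F G /set_mem/fE -> /set_mem/fE ->; rewrite !fFc => E.
  by apply/seteqP; split; apply/subE; rewrite E.
- move=> F' fF'; have := face_FcE VA' proper' fF'; set J := [set j | _]%SET => ->.
  by exists (Fc V A J); [exact: Fc_is_face|rewrite fFc].
Qed.

(** * Labeled polytopes from patterns *)

(** Vertices and facets along a complete flag. The flag lemmas apply to them, so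
    that dimensions can be read off from incidences alone. *)
Definition pat_flag d n m (I : 'I_n -> 'I_m -> bool)
    (vs : nat -> 'I_n) (js : nat -> 'I_m) : Prop :=
  forall k, (k < d)%N ->
    (forall l, (l <= k)%N -> I (vs l) (js k)) /\ ~~ I (vs k.+1) (js k).

(** The combinatorial conditions under which the columns of a pair of matrices
    with this incidence pattern are exactly the vertices and the facets. *)
Record good_pattern d n m (I : 'I_n -> 'I_m -> bool) : Prop := GoodPattern {
  gp_proper : forall i, exists j, ~~ I i j;
  gp_vertices : forall i i', (forall j, I i j = I i' j) -> i = i';
  gp_facets : forall j j', (forall i, I i j = I i j') -> j = j';
  gp_flag_vertex : forall i, exists vs js, pat_flag d I vs js /\ vs 0%N = i;
  gp_flag_facet : forall j, exists vs js, pat_flag d I vs js /\ js d.-1 = j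
}.

Section LabeledFromPattern.
Context {R : realType} {d n m : nat}.
Context (V : 'M[R]_(d.+1, n)) (A : 'M[R]_(d.+1, m)).
Hypothesis VA : conv V = polyhedron A.
Hypothesis good : good_pattern d.+1 (inc V A).

Let flagP vs js : pat_flag d.+1 (inc V A) vs js ->
  (forall k l, (k < d.+1)%N -> (l <= k)%N ->
     dot (col (js k) A) (col (vs l) V) = 1) /\
  (forall k, (k < d.+1)%N -> dot (col (js k) A) (col (vs k.+1) V) != 1).
Proof.
by move=> F; split=> [k l kd lk|k kd]; have [F1 F2] := F k kd; [exact/eqP/F1|].
Qed.

Lemma pattern_vertex i : is_vertex (conv V) (col i V).
Proof.
have [vs [js [F vi]]] := gp_flag_vertex good i.
have [F0 F1] := flagP F.
pose J : {set 'I_m} := [set j | [exists k : 'I_d.+1, j == js k]]%SET.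
rewrite /is_vertex; suff -> : [set col i V] = Fc V A J by exact: Fc_is_face.
apply/seteqP; split=> [_ ->|x [_ xJ]].
  apply/Fc_col => j; rewrite inE => /existsP[k /eqP ->].
  by rewrite -vi; apply/eqP; exact: F0.
rewrite /= -vi; apply: (flag_vertex F0 F1) => k kd; apply: xJ.
by rewrite inE; apply/existsP; exists (Ordinal kd).
Qed.

Lemma pattern_full_dim : (0 < m)%N -> has_dim (conv V) d.+1.
Proof.
case: m A VA good flagP => // m' A' VA' good' flagP' _.
have [vs [js [F _]]] := gp_flag_facet good' ord0.
have [F0 F1] := flagP' _ _ F.
by apply: (flag_full F0 F1) => l _; exact: conv_col.
Qed.

Lemma pattern_facet_dim j : has_dim (Fc V A [set j]%SET) d.
Proof.
have [vs [js [F jd]]] := gp_flag_facet good j.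
have [F0 F1] := flagP F.
apply: (flag_facet_dim F0 F1) => [l ld|y [_ ->] //]; last by rewrite inE -jd.
by apply/Fc_col => k; rewrite inE => /eqP ->; rewrite -jd; apply/eqP/F0.
Qed.

Lemma pattern_facet j : is_facet (conv V) (Fc V A [set j]%SET).
Proof.
split; first exact: Fc_is_face.
exists d; split; last exact: pattern_facet_dim.
by apply: pattern_full_dim; case: m j => // -[].
Qed.

Lemma pattern_vert_bij : set_bij [set: 'I_n] (is_vertex (conv V)) (fun i => col i V).
Proof.
split.
- by move=> i _; exact: pattern_vertex.
- move=> i i' _ _ E; apply: (gp_vertices good) => j.
  by rewrite /inc E.
- move=> v vv; have := face_Fc VA vv (ex_intro _ v erefl).
  set J := [set j | _]%SET => E.
  have [|i iJ] := @Fc_nonempty _ _ _ _ _ _ VA J; first by rewrite -E; exists v.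
  exists i => //.
  by have /(Fc_col V A J i) : forall j, j \in J -> inc V A i j by []; rewrite -E.
Qed.

(** A facet lies on some [A]-facet, for otherwise it would be the whole
    polytope, and it fills that facet for reasons of dimension. *)
Lemma pattern_facet_cases F : is_facet (conv V) F -> exists j, F = Fc V A [set j]%SET.
Proof.
move=> [fF [k [dV dF]]].
have F0 : F !=set0.
  apply/set0P/negP => /eqP F0; move: dF => [p [B [_]]].
  rewrite F0 => /seteqP[_ /(_ (p + B *m 0))].
  move=> H; have [|k' [W [w [WF w1 _]]]] := H; first by exists 0.
  suff : \sum_i w i 0 = 0 by rewrite w1 => /eqP; rewrite oner_eq0.
  by apply: big1 => i; have := WF i.
have := face_Fc VA fF F0; set J := [set j | _]%SET => FE.
have [J0|[j jJ]] := set_0Vmem J.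
  have FV : F = conv V.
    rewrite FE J0; apply/seteqP; split=> [x []//|x Vx]; split=> // j.
    by rewrite inE.
  by rewrite FV in dF; have := has_dim_uniq dV dF => /eqP; rewrite eqn_leq ltnn.
exists j; apply: (@face_eq_dim _ _ (conv V) _ _ d) => //.
- exact: Fc_is_face.
- by rewrite FE => x [Vx xJ]; split=> // l; rewrite inE => /eqP ->; apply: xJ.
- have dV' := pattern_full_dim (_ : (0 < m)%N).
  have m0 : (0 < m)%N by exact: leq_ltn_trans (ltn_ord j).
  by have [kd] := has_dim_uniq dV (dV' m0); rewrite kd in dF.
- exact: pattern_facet_dim.
Qed.

Lemma pattern_facet_bij : set_bij [set: 'I_m] (is_facet (conv V))
  (fun j => [set x | conv V x /\ (A^T *m x) j 0 = 1]).
Proof.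
split.
- by move=> j _; rewrite Fc1E; exact: pattern_facet.
- move=> j j' _ _; rewrite !Fc1E => E; apply: (gp_facets good) => i.
  have Fi k : inc V A i k <-> Fc V A [set k]%SET (col i V).
    rewrite Fc_col; split=> [ik l|]; first by rewrite inE => /eqP ->.
    by apply; rewrite inE.
  by apply/idP/idP => /Fi; [rewrite E|rewrite -E] => /Fi.
- by move=> F /pattern_facet_cases[j ->]; exists j; rewrite // Fc1E.
Qed.

Definition pattern_polytope (m0 : (0 < m)%N) : labeled_polytope R d.+1 n m :=
  LabeledPolytope (ex_intro _ n (ex_intro _ V erefl)) (pattern_full_dim m0)
    pattern_vert_bij pattern_facet_bij.

End LabeledFromPattern.

(** * Stability of the two descriptions *)

(** A bounded polyhedron, every nonempty face of which contains one of the given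
    points, is the convex hull of these points. *)
Section RayShooting.
Context {R : realType} {d n m : nat} (V : 'M[R]_(d, n)) (A : 'M[R]_(d, m)) (D : R).
Hypothesis VA_le : forall i j, dot (col j A) (col i V) <= 1.
Hypothesis A_bounded : forall x, polyhedron A x -> `|x| <= D.
Hypothesis A_faces : forall (J : {set 'I_m}) x, polyhedron A x ->
  (forall j, j \in J -> dot (col j A) x = 1) ->
  exists i, forall j, j \in J -> inc V A i j.

Lemma no_ray x y : y != 0 -> ~ (forall t, 0 <= t -> polyhedron A (x + t *: y)).
Proof.
move=> y0 ray; have ny : 0 < `|y| by rewrite normr_gt0.
pose t := (D + `|x| + 1) / `|y|.
have D0 : 0 <= D.
  by apply: le_trans (A_bounded (ray 0 (lexx 0))); exact: normr_ge0.
have t0 : 0 <= t by rewrite divr_ge0 ?addr_ge0 // ltW.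
have := A_bounded (ray t t0); apply/negP; rewrite -ltNge.
have tyE : `|t *: y| = D + `|x| + 1.
  by rewrite normrZ ger0_norm // divfK // gt_eqF.
have := lerB_normD (t *: y) x; rewrite tyE [t *: y + x]addrC.
set z := `|x + _|; have := normr_ge0 x; lra.
Qed.

(** From a vertex [v] of the smallest face through [x], the ray through [x]
    leaves the polyhedron on a facet that misses [v]; the exit point lies on a
    face with fewer vertices. *)
Lemma face_in_conv N (J : {set 'I_m}) x :
  (#|[set i | [forall j in J, inc V A i j]]%SET| <= N)%N ->
  polyhedron A x -> (forall j, j \in J -> dot (col j A) x = 1) -> conv V x.
Proof.
elim: N J x => [|N IH] J x.
  rewrite leqn0 cards_eq0 => /eqP W0 Ax xJ.
  have [i iJ] := A_faces Ax xJ; exfalso.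
  move/finset.setP: W0 => /(_ i); rewrite !inE => /negbT/negP; apply.
  exact/forall_inP.
move=> W Ax xJ; have [i iJ] := A_faces Ax xJ.
have [xi|xi] := eqVneq x (col i V); first by rewrite xi; exact: conv_col.
pose v := col i V; pose y := x - v.
have y0 : y != 0 by rewrite subr_eq0.
have xE : x = v + y by rewrite subrKC.
pose s j := dot (col j A) y.
have [j0 sj0] : exists j, 0 < s j.
  apply: contrapT => /forallNP sle; apply: (@no_ray v y y0) => t t0.
  rewrite polyhedronE => j; rewrite dotDr dotZr -[leRHS]addr0.
  apply: lerD; first exact: VA_le.
  by rewrite mulr_ge0_le0 // leNgt; exact/negP/sle.
pose t j := (1 - dot (col j A) v) / s j.
case: (@Order.TotalTheory.arg_minP _ _ _ j0 (fun j => 0 < s j) t sj0) => j sj tmin.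
have Axj k : dot (col k A) v + s k <= 1 by rewrite -dotDr -xE; move: Ax; rewrite polyhedronE.
have tj1 : 1 <= t j by rewrite ler_pdivlMr // mul1r lerBrDl.
have tj0 : 0 < t j by apply: lt_le_trans tj1; exact: ltr01.
pose z := v + t j *: y.
have dotz k : dot (col k A) z = dot (col k A) v + t j * s k by rewrite dotDr dotZr.
have Az : polyhedron A z.
  rewrite polyhedronE => k; rewrite dotz.
  have [sk|sk] := ltrP 0 (s k).
    by have := tmin k sk; rewrite ler_pdivlMr // => H; lra.
  have := VA_le i k; rewrite -/v; have := mulr_ge0_le0 (ltW tj0) sk; lra.
have zj : dot (col j A) z = 1.
  by rewrite dotz divfK ?gt_eqF // subrKC.
have vz : conv V z.
  apply: (IH (j |: J)%SET z) => //.
    rewrite -ltnS; apply: leq_trans W; apply: proper_card; apply/properP; split.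
      apply/fintype.subsetP => k; rewrite !inE => /forall_inP kJ.
      by apply/forall_inP => l lJ; apply: kJ; apply/setU1P; right.
    exists i; first by rewrite inE; apply/forall_inP.
    rewrite inE; apply/forall_inP => /(_ j); rewrite setU11 => /(_ isT)/eqP ij.
    by have := Axj j; rewrite -/v in ij; rewrite ij; have := sj; lra.
  move=> k; rewrite !inE => /predU1P[->//|kJ].
  rewrite dotz; have /eqP vk := iJ k kJ; rewrite -/v in vk.
  suff -> : s k = 0 by rewrite vk mulr0 addr0.
  by rewrite /s dotBr vk xJ // subrr.
have -> : x = (1 - (t j)^-1) *: v + (1 - (1 - (t j)^-1)) *: z.
  rewrite subKr scalerDr scalerA mulVf ?gt_eqF // scale1r addrA -scalerDl subrK.
  by rewrite scale1r.
apply: conv_convex => //; last exact: conv_col.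
  by rewrite subr_ge0 invf_le1.
by rewrite gerBl invr_ge0 ltW.
Qed.

Lemma conv_eq_polyhedron : conv V = polyhedron A.
Proof.
apply/seteqP; split=> x; last first.
  by move=> Ax; apply: (@face_in_conv _ finset.set0 x (leqnn _) Ax) => j; rewrite inE.
apply: conv_hull_sub; first exact: polyhedron_convex.
by move=> _ [i _ <-]; rewrite polyhedronE.
Qed.

End RayShooting.

Section Norms.
Context {R : realType} {d : nat}.
Implicit Types x y : 'cV[R]_d.

Lemma mx_entry_le (p q : nat) (M : 'M[R]_(p, q)) i j : `|M i j| <= `|M|.
Proof.
rewrite [leRHS]/Num.Def.normr /= mx_normrE.
by rewrite (le_trans _ (le_bigmax _ _ (i, j))).
Qed.

Lemma dot_norm_le (a x : 'cV[R]_d) e : (forall r, `|a r 0| <= e) -> `|dot a x| <= d%:R * e * `|x|.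
Proof.
move=> ae; rewrite dotE (le_trans (ler_norm_sum _ _ _)) //.
rewrite -mulrA mulr_natl -[X in _ *+ X]card_ord -sumr_const; apply: ler_sum => r _.
by rewrite normrM ler_pM //; exact: mx_entry_le.
Qed.

Lemma conv_bounded n (V : 'M[R]_(d, n)) :
  exists2 C, 0 <= C & forall x, conv V x -> `|x| <= C.
Proof.
exists (\sum_i `|col i V|); first exact: sumr_ge0.
move=> _ /convP[w [w0 w1 ->]]; rewrite mulmx_sum_colE.
rewrite (le_trans (ler_norm_sum _ _ _)) //; apply: ler_sum => i _.
rewrite normrZ ger0_norm // ler_piMl // -w1 (bigD1 i) //= lerDl.
exact: sumr_ge0.
Qed.

End Norms.

Lemma near_forall2 (T : topologicalType) (x : T) (I J : finType)
    (P : T -> I -> J -> Prop) :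
  (forall i j, nbhs x (fun y => P y i j)) -> nbhs x (fun y => forall i j, P y i j).
Proof.
move=> H; apply: (@filter_forall _ _ (fun i y => forall j, P y i j)) => i.
by apply: (@filter_forall _ _ (fun j y => P y i j)) => j; exact: H.
Qed.

Section Stability.
Context {R : realType} {d n m : nat} (M0 : 'M[R]_(d, n + m)).
Let V0 := lsubmx M0.
Let A0 := rsubmx M0.
Hypothesis VA0 : conv V0 = polyhedron A0.

Lemma near_entry (e : R) : 0 < e -> \forall M \near M0,
  forall i j, `|(M : 'M[R]_(d, n + m)) i j - M0 i j| < e.
Proof.
move=> e0; apply: near_forall2 => i j.
have /cvgrPdist_lt/(_ e e0) := @coord_continuous R d (n + m) i j M0.
by apply: filterS => M; rewrite distrC.
Qed.

Lemma near_slack : \forall M \near M0, forall i j,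
  ~~ inc V0 A0 i j -> dot (col j (rsubmx M)) (col i (lsubmx M)) < 1.
Proof.
apply: near_forall2 => i j.
have [ij|ij] := boolP (inc V0 A0 i j); first by apply: filterS filterT => M _.
pose f (M : 'M[R]_(d, n + m)) := dot (col j (rsubmx M)) (col i (lsubmx M)).
have f0 : f M0 < 1 by rewrite lt_neqAle ij (dot_le1 VA0) //; exact: conv_col.
have rf : ratf [set: 'M[R]_(d, n + m)] f.
  have : ratf [set: 'M[R]_(d, n + m)]
      (fun M => \sum_r M r (rshift n j) * M r (lshift m i)).
    by apply: ratf_sum => r _; apply: ratfM; exact: ratf_coord.
  by apply: ratf_eq => M _; rewrite /f dotE; apply: eq_bigr => r _; rewrite !mxE.
have cf : {for M0, continuous f} by exact: ratf_cont openT rf I.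
have /(_ (nbhs_filter M0)) := cvgr_lt _ cf _ f0.
by apply: filterS => M fM _.
Qed.

(** Near [M0] the polyhedron stays bounded, and a face can be nonempty only if
    it has a vertex; so the two descriptions continue to agree as long as the
    incidences persist. Both facts come from comparison with [M0]: shrinking a
    point of the new polyhedron by a factor close to 1 moves it into the old
    polytope, where a set [J] of facets without a common vertex cannot be nearly
    tight, because each vertex has slack at least [dl] on one facet of [J]. *)
Lemma conv_polyhedron_near : \forall M \near M0,
  (forall i j, inc V0 A0 i j -> inc (lsubmx M) (rsubmx M) i j) ->
  conv (lsubmx M) = polyhedron (rsubmx M) /\
  forall i j, inc V0 A0 i j = inc (lsubmx M) (rsubmx M) i j.
Proof.
have [C C0 V0C] := conv_bounded V0.
pose del (ij : 'I_n * 'I_m) :=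
  if inc V0 A0 ij.1 ij.2 then 1 else 1 - dot (col ij.2 A0) (col ij.1 V0).
have [ij|del0 del00 delP] := fin_pos_lb (f := del).
  rewrite /del; case: ifPn => // ne; rewrite subr_gt0 lt_neqAle ne /=.
  by apply: (dot_le1 VA0); exact: conv_col.
pose dl := Num.min 1 del0.
have dl0 : 0 < dl by rewrite lt_min ltr01.
have dl1 : dl <= 1 by rewrite ge_min lexx.
have slack i j : ~~ inc V0 A0 i j -> dot (col j A0) (col i V0) <= 1 - dl.
  move=> ne; have := delP (i, j); rewrite /del /= (negbTE ne) => H.
  have : dl <= del0 by rewrite ge_min lexx orbT.
  by lra.
pose eta := dl / (4 * (C + 1) * (m.+1)%:R).
have eta0 : 0 < eta by rewrite divr_gt0 // !mulr_gt0 // ltr_wpDl.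
have m1 : 1 <= (m.+1)%:R :> R by rewrite ler1n.
have etaE : eta * (4 * (C + 1) * (m.+1)%:R) = dl.
  by rewrite divfK // gt_eqF // !mulr_gt0 // ltr_wpDl.
near=> M => incM.
have Mslack : forall i j, ~~ inc V0 A0 i j ->
    dot (col j (rsubmx M)) (col i (lsubmx M)) < 1 by near: M; exact: near_slack.
have Meta : forall i j, `|(M : 'M[R]_(d, n + m)) i j - M0 i j| < eta / d.+1%:R.
  by near: M; apply: near_entry; rewrite divr_gt0.
set V := lsubmx M in incM Mslack *; set A := rsubmx M in incM Mslack *.
have incE i j : inc V0 A0 i j = inc V A i j.
  have [/incM //|ne] := boolP (inc V0 A0 i j).
  by apply/esym/negbTE; rewrite /inc neq_lt Mslack.
split=> //.
have Adist x j : `|dot (col j A) x - dot (col j A0) x| <= eta * `|x|.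
  have -> : dot (col j A) x - dot (col j A0) x = dot (col j A - col j A0) x.
    by rewrite /dot linearB /= mulmxBl !mxE.
  have H r : `|(col j A - col j A0) r 0| <= eta / d.+1%:R by rewrite !mxE ltW.
  apply: le_trans (dot_norm_le _ H) _; rewrite ler_wpM2r // mulrCA ler_piMr ?ltW //.
  by rewrite ltr_pdivrMr // mul1r ltr_nat.
have scaled x : polyhedron A x -> conv V0 ((1 + eta * `|x|)^-1 *: x).
  move=> Ax; have p0 : 0 < 1 + eta * `|x| by rewrite ltr_pwDl // mulr_ge0 // ltW.
  rewrite VA0 polyhedronE => j; rewrite dotZr ler_pdivrMl // mulr1.
  have := Adist x j; rewrite ler_norml => /andP[+ _].
  by move: Ax; rewrite polyhedronE => /(_ j); lra.
have etaC : eta * C <= 1 / 4.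
  have : 0 <= eta * C by rewrite mulr_ge0 // ltW.
  nra.
have bounded x : polyhedron A x -> `|x| <= 2 * C.
  move=> Ax; have p0 : 0 < 1 + eta * `|x| by rewrite ltr_pwDl // mulr_ge0 // ltW.
  have := V0C _ (scaled x Ax).
  rewrite normrZ normfV (gtr0_norm p0) ler_pdivrMl //.
  have := normr_ge0 x; nra.
apply: (conv_eq_polyhedron (D := 2 * C)) => //.
  move=> i j; have [ij|ij] := boolP (inc V A i j); first by rewrite (eqP ij).
  by apply/ltW/Mslack; rewrite incE.
move=> J x Ax xJ; apply: contrapT => noV.
have [w [w0 w1 xw]] := (convP _ _).1 (scaled x Ax).
pose e := eta * `|x|.
have e0 : 0 <= e by rewrite mulr_ge0 // ltW.
have x0 : x = (1 + e) *: (V0 *m w).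
  by rewrite -xw scalerA mulfV ?scale1r // gt_eqF // ltr_pwDl.
have lo : #|J|%:R * (1 - e) <= \sum_(j in J) dot (col j A0) x.
  rewrite mulr_natl -sumr_const; apply: ler_sum => j jJ.
  by have := Adist x j; rewrite xJ // -/e ler_norml => /andP[_]; lra.
have hi : \sum_(j in J) dot (col j A0) x <= (1 + e) * (#|J|%:R - dl).
  rewrite x0; under eq_bigr do rewrite dotZr dot_mulmx.
  rewrite -mulr_sumr ler_wpM2l ?addr_ge0 // exchange_big /=.
  rewrite -[leRHS]mul1r -[X in _ <= X * _]w1 mulr_suml; apply: ler_sum => i _.
  rewrite -mulr_sumr ler_wpM2l //.
  have [j jJ ij] : exists2 j, j \in J & ~~ inc V0 A0 i j.
    apply: contrapT => H; apply: noV; exists i => j jJ; rewrite -incE.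
    by apply: contrapT => /negP ij; apply: H; exists j.
  rewrite -sumr_const (bigD1 j) //= [X in _ <= X - _](bigD1 j) //=.
  rewrite addrAC; apply: lerD.
    exact: slack.
  by apply: ler_sum => k _; apply: (dot_le1 VA0); exact: conv_col.
have Jm : #|J|%:R <= m%:R :> R.
  by rewrite ler_nat -[m in X in (_ <= X)%N]card_ord max_card.
have J0 : 0 <= #|J|%:R :> R by [].
have eb : e <= eta * (2 * C) by rewrite ler_wpM2l ?bounded // ltW.
have mS : m.+1%:R = m%:R + 1 :> R by rewrite -natr1.
have em : e * #|J|%:R <= eta * (2 * C) * m%:R by rewrite ler_pM.
have : 0 < eta * m.+1%:R by rewrite mulr_gt0.
have : 0 <= e * dl by rewrite mulr_ge0 // ltW.
have : 0 <= eta * C by rewrite mulr_ge0 // ltW.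
have : 0 <= eta * m%:R by rewrite mulr_ge0 // ltW.
have := le_trans lo hi; move: etaE; rewrite mS; lra.
Unshelve. all: by end_near. Qed.

End Stability.

(** * Realization spaces are locally given by the incidence equations *)

Section LatticeIso.
Context {R : realType}.

Lemma face_set0 d (P : set 'cV[R]_d) : is_face P set0.
Proof.
exists 0, 1; split=> [x _|]; first by rewrite trmx0 mul0mx mxE ler01.
apply/seteqP; split=> x //= [_]; rewrite trmx0 mul0mx mxE => /eqP.
by rewrite eq_sym oner_eq0.
Qed.

Lemma face_self d (P : set 'cV[R]_d) : is_face P P.
Proof.
exists 0, 0; split=> [x _|]; first by rewrite trmx0 mul0mx mxE.
by apply/seteqP; split=> x; [move=> Px; rewrite /= trmx0 mul0mx mxE|case].
Qed.

Lemma face_lattice_iso_comp d1 d2 d3 (P : set 'cV[R]_d1) (Q : set 'cV[R]_d2)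
    (T : set 'cV[R]_d3) f g :
  face_lattice_iso P Q f -> face_lattice_iso Q T g -> face_lattice_iso P T (g \o f).
Proof.
move=> [bf sf] [bg sg]; split; first exact: set_bij_comp bg.
have [ff _ _] := bf; move=> F G fF fG.
by rewrite /= sg ?sf //; exact: ff.
Qed.

Lemma face_lattice_iso_inv d e (P : set 'cV[R]_d) (Q : set 'cV[R]_e) f :
  face_lattice_iso P Q f -> exists2 g, face_lattice_iso Q P g &
    forall F, is_face P F -> g (f F) = F.
Proof.
move=> [[fun_f inj_f surj_f] sub_f].
have /choice[g gP] : forall G, exists F, is_face Q G -> is_face P F /\ f F = G.
  move=> G; have [/surj_f[F fF fE]|nG] := pselect (is_face Q G); first by exists F.
  by exists set0.
have gf F : is_face P F -> g (f F) = F.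
  move=> fF; have [fgF E] := gP _ (fun_f _ fF).
  by apply: inj_f => //; exact: mem_set.
exists g => //; split; last first.
  move=> F G /gP[fF FE] /gP[fG GE].
  by rewrite -(sub_f _ _ fF fG) FE GE.
split.
- by move=> G /gP[].
- move=> G H /set_mem fG /set_mem fH E.
  by have [_ <-] := gP G fG; have [_ <-] := gP H fH; rewrite E.
- by move=> F fF; exists (f F); [exact: fun_f|exact: gf].
Qed.

End LatticeIso.

Section GoodFaces.
Context {R : realType} {d n m : nat} (V : 'M[R]_(d.+1, n)) (A : 'M[R]_(d.+1, m)).
Hypothesis VA : conv V = polyhedron A.
Hypothesis good : good_pattern d.+1 (inc V A).

(** A vertex is the only point on all the facets through it. *)
Lemma vertex_Fc i : [set col i V] = Fc V A [set j | inc V A i j]%SET.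
Proof.
have := face_Fc VA (pattern_vertex VA good i) (ex_intro _ _ erefl).
set J := [set j | _]%SET => E; apply/seteqP; split=> [_ ->|x [Vx xi]].
  by apply/Fc_col => j; rewrite inE.
have iJ : forall j, j \in J -> inc V A i j by apply/Fc_col; rewrite -E.
by rewrite E; split=> // j /iJ ij; apply: xi; rewrite inE.
Qed.

Lemma inc_sub i j : inc V A i j <-> [set col i V] `<=` Fc V A [set j]%SET.
Proof.
split=> [ij _ ->|H]; first by apply/Fc_col => k; rewrite inE => /eqP ->.
by have /Fc_col := H _ erefl; apply; rewrite inE.
Qed.

End GoodFaces.

Section RealizationSpaceLocal.
Context {R : realType} {d n m : nat} (P : labeled_polytope R d.+1 n m).

Definition pattern_of i j : bool := `[< facet P j (vert P i) >].

Lemma pattern_ofP i j : pattern_of i j <-> [set vert P i] `<=` facet P j.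
Proof. by split=> [/asboolP ij _ -> //|H]; apply/asboolP; exact: H. Qed.

Lemma vert_face i : is_face (body P) [set vert P i].
Proof. by have [+ _ _] := vert_bij P; apply. Qed.

Lemma facet_face j : is_face (body P) (facet P j).
Proof. by have [/(_ j I)[]] := facet_bij P. Qed.

Lemma facet_dim j : has_dim (facet P j) d.
Proof.
have [/(_ j I)[_ [k [dP dF]]] _ _] := facet_bij P.
by have [kd] := has_dim_uniq dP (body_dim P); rewrite kd in dF.
Qed.

(** A lattice isomorphism that respects the labels preserves the relation
    between vertices and facets of being contained. *)
Lemma realization_pattern M : realization_space P M ->
  conv (lsubmx M) = polyhedron (rsubmx M) /\
  forall i j, inc (lsubmx M) (rsubmx M) i j = pattern_of i j.
Proof.
move=> [Q [QV QA vQ fQ [f [[bf sf] fv ff]]]].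
have VA : conv (lsubmx M) = polyhedron (rsubmx M) by rewrite -QV.
split=> // i j; apply/idP/idP.
  move=> /inc_sub; rewrite -vQ -Fc1E -QV -fQ -ff -fv sf => [H||].
  - by apply/pattern_ofP.
  - exact: vert_face.
  - exact: facet_face.
move=> /pattern_ofP /(sf _ _ (vert_face i) (facet_face j)).
by rewrite fv ff fQ QV Fc1E vQ => /inc_sub.
Qed.

Hypothesis good : good_pattern d.+1 pattern_of.
Hypothesis m_gt0 : (0 < m)%N.

Lemma realization_of_iso M (f : set 'cV[R]_d.+1 -> set 'cV[R]_d.+1) :
  conv (lsubmx M) = polyhedron (rsubmx M) ->
  (forall i j, inc (lsubmx M) (rsubmx M) i j = pattern_of i j) ->
  face_lattice_iso (body P) (conv (lsubmx M)) f ->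
  (forall i, f [set vert P i] = [set col i (lsubmx M)]) ->
  (forall j, f (facet P j) = Fc (lsubmx M) (rsubmx M) [set j]%SET) ->
  realization_space P M.
Proof.
move=> VA incE isof fv ff.
have good' : good_pattern d.+1 (inc (lsubmx M) (rsubmx M)).
  suff -> : inc (lsubmx M) (rsubmx M) = pattern_of by [].
  by apply/funext => i; apply/funext => j; exact: incE.
exists (pattern_polytope VA good' m_gt0); split=> //.
by exists f; split=> // j; rewrite ff /= Fc1E.
Qed.

(** Non-incidences are open conditions and the two descriptions stay compatible
    near a realization, so the equations for the incidences are all that is
    left of the definition. *)
Lemma realization_near M0 : realization_space P M0 ->
  \forall M \near M0, realization_space P M <->
    (forall i j, pattern_of i j -> inc (lsubmx M) (rsubmx M) i j).
Proof.
move=> RM0; have [VA0 inc0] := realization_pattern RM0.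
have := conv_polyhedron_near VA0; apply: filterS => M nearM; split.
  by move=> /realization_pattern[_ incE] i j; rewrite incE.
move=> incM; have [|VA incE] := nearM.
  by move=> i j; rewrite inc0; exact: incM.
have incP i j : inc (lsubmx M) (rsubmx M) i j = pattern_of i j by rewrite -incE inc0.
have goodM0 : good_pattern d.+1 (inc (lsubmx M0) (rsubmx M0)).
  suff -> : inc (lsubmx M0) (rsubmx M0) = pattern_of by [].
  by apply/funext => i; apply/funext => j; exact: inc0.
have goodM : good_pattern d.+1 (inc (lsubmx M) (rsubmx M)).
  suff -> : inc (lsubmx M) (rsubmx M) = pattern_of by [].
  by apply/funext => i; apply/funext => j; exact: incP.
have [g isog gFc] := pattern_iso VA0 VA incE (gp_proper goodM0).
have [Q [QV QA vQ fQ [f [isof fv ff]]]] := RM0.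
apply: (@realization_of_iso M (g \o f)) => //.
- by apply: face_lattice_iso_comp isof _; rewrite QV.
- move=> i; rewrite /= fv vQ (vertex_Fc VA0 goodM0) gFc (vertex_Fc VA goodM).
  by congr (Fc _ _ _); apply/setP => j; rewrite !inE incE.
- by move=> j; rewrite /= ff fQ QV Fc1E gFc.
Qed.

End RealizationSpaceLocal.

Lemma good_relabel d n m n' m' (I : 'I_n -> 'I_m -> bool)
    (s : 'I_n' -> 'I_n) (t : 'I_m' -> 'I_m) :
  bijective s -> bijective t -> good_pattern d I ->
  good_pattern d (fun i j => I (s i) (t j)).
Proof.
move=> [s' sK s'K] [t' tK t'K] [g1 g2 g3 g4 g5]; split.
- by move=> i; have [j] := g1 (s i); rewrite -(t'K j); exists (t' j).
- move=> i i' H; rewrite -(sK i) -(sK i'); congr (s' _); apply: g2 => j.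
  by have := H (t' j); rewrite t'K.
- move=> j j' H; rewrite -(tK j) -(tK j'); congr (t' _); apply: g3 => i.
  by have := H (s' i); rewrite s'K.
- move=> i; have [vs [js [F v0]]] := g4 (s i).
  exists (s' \o vs), (t' \o js); split; last by rewrite /= v0 sK.
  move=> k kd; have [F1 F2] := F k kd; rewrite /= s'K t'K; split=> // l lk.
  by rewrite s'K; exact: F1.
- move=> j; have [vs [js [F j0]]] := g5 (t j).
  exists (s' \o vs), (t' \o js); split; last by rewrite /= j0 tK.
  move=> k kd; have [F1 F2] := F k kd; rewrite /= s'K t'K; split=> // l lk.
  by rewrite s'K; exact: F1.
Qed.

(** * Transfer along a combinatorial equivalence *)

(** A combinatorial equivalence is only an isomorphism of face lattices. That it
    maps the vertices and facets of [conv V] to those of [P] has to be proved: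
    faces in the lattice have no dimension, but images of flags are flags. *)
Section Transfer.
Context {R : realType} {d n m n0 m0 : nat}.
Context (V : 'M[R]_(d.+1, n0)) (A : 'M[R]_(d.+1, m0)).
Hypothesis VA : conv V = polyhedron A.
Hypothesis good : good_pattern d.+1 (inc V A).
Hypothesis m0_gt0 : (0 < m0)%N.
Context (P : labeled_polytope R d.+1 n m) (f : set 'cV[R]_d.+1 -> set 'cV[R]_d.+1).
Hypothesis iso : face_lattice_iso (conv V) (body P) f.

Let vface k : is_face (conv V) [set col k V].
Proof. exact: (pattern_vertex VA good). Qed.

Let fface j : is_face (conv V) (Fc V A [set j]%SET).
Proof. exact: Fc_is_face. Qed.

Let f_face F : is_face (conv V) F -> is_face (body P) (f F).
Proof. by have [[+ _ _] _] := iso; apply. Qed.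

Let f_sub F G : is_face (conv V) F -> is_face (conv V) G ->
  (f F `<=` f G <-> F `<=` G).
Proof. exact: iso.2. Qed.

Let f_nonempty F : is_face (conv V) F -> F !=set0 -> f F !=set0.
Proof.
move=> fF F0; have [[_ _ sf] _] := iso.
have [E fE E0] := sf _ (face_set0 (body P)).
apply/set0P/negP => /eqP fF0.
have : F `<=` set0.
  by apply/(f_sub fF (face_set0 _)); rewrite fF0.
by move: F0 => [x Fx] /(_ x Fx).
Qed.

(** The images of the facets of a flag supply the functionals, and points of
    the images of its vertices that avoid the next facet supply the points. *)
Let flag_image vs js : pat_flag d.+1 (inc V A) vs js ->
  (exists x, f [set col (vs 0%N) V] = [set x]) /\
  has_dim (f (Fc V A [set js d]%SET)) d.
Proof.
move=> F.
have /choice[ab abP] : forall k, exists ab : 'cV[R]_d.+1 * R,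
    defines_face (body P) (f (Fc V A [set js k]%SET)) ab.1 ab.2.
  by move=> k; have [a [b ab]] := f_face (fface (js k)); exists (a, b).
have sub_js k l : (k < d.+1)%N -> (l <= k)%N ->
    f [set col (vs l) V] `<=` f (Fc V A [set js k]%SET).
  move=> kd lk; apply/(f_sub (vface _) (fface _)); apply/inc_sub.
  by have [+ _] := F k kd; apply.
have /choice[x xP] : forall l, exists x, f [set col (vs l) V] x /\
    ((0 < l <= d.+1)%N -> ~ f (Fc V A [set js l.-1]%SET) x).
  case=> [|l].
    have [x fx] := f_nonempty (vface (vs 0%N)) (ex_intro _ _ erefl).
    by exists x.
  have [ld|ld] := boolP (l < d.+1)%N; last first.
    have [x fx] := f_nonempty (vface (vs l.+1)) (ex_intro _ _ erefl); exists x.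
    by split=> //; rewrite /= (negbTE ld).
  have [_ nI] := F l ld; apply: contrapT => /forallNP H.
  move/negP: nI; apply; apply/inc_sub/(f_sub (vface _) (fface _)) => y fy.
  by apply: contrapT => nfy; apply: (H y).
have flag0 k l : (k < d.+1)%N -> (l <= k)%N -> dot (ab k).1 (x l) = (ab k).2.
  move=> kd lk; have [_ E] := abP k.
  by have := sub_js k l kd lk _ (xP l).1; rewrite E => -[].
have flag1 k : (k < d.+1)%N -> dot (ab k).1 (x k.+1) != (ab k).2.
  move=> kd; apply/eqP => E; have [fx nfx] := xP k.+1.
  apply: nfx => //; have [_ ->] := abP k; split=> //.
  exact: (face_sub (f_face (vface (vs k.+1)))).
split.
  exists (x 0%N); apply/seteqP; split=> [y fy|_ ->]; last exact: (xP 0%N).1.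
  apply: (flag_vertex flag0 flag1) => k kd.
  by have := sub_js k 0%N kd (leq0n k) y fy; have [_ ->] := abP k => -[].
apply: (flag_facet_dim flag0 flag1) => [l ld|y].
  exact: sub_js (xP l).1.
by have [_ ->] := abP d => -[].
Qed.

Let vert_image k : exists i, f [set col k V] = [set vert P i].
Proof.
have [vs [js [F vk]]] := gp_flag_vertex good k.
have [[x fx] _] := flag_image F; rewrite vk in fx.
have [_ _ sv] := vert_bij P.
have [|i _ ix] := sv x; first by rewrite /is_vertex -fx; exact: f_face (vface k).
by exists i; rewrite fx ix.
Qed.

Let facet_image j : exists j', f (Fc V A [set j]%SET) = facet P j'.
Proof.
have [vs [js [F jd]]] := gp_flag_facet good j.
have [_] := flag_image F; rewrite /= in jd; rewrite jd => dF.
have [_ _ sf] := facet_bij P.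
have [|j' _ E] := sf (f (Fc V A [set j]%SET)); last by exists j'.
split; first exact: f_face (fface j).
by exists d; split=> //; exact: body_dim.
Qed.

Let vert_preimage i : exists k, f [set col k V] = [set vert P i].
Proof.
have [[_ _ sf] _] := iso; have [F fF FE] := sf _ (vert_face P i).
have F0 : F !=set0.
  apply/set0P/negP => /eqP F0.
  have [E fE E0] := sf _ (face_set0 (body P)).
  have : f F `<=` f E by apply/(f_sub fF fE); rewrite F0.
  by rewrite FE E0 => /(_ _ erefl).
have [k kF] : exists k, F (col k V).
  have := face_Fc VA fF F0; set J := [set j | _]%SET => E.
  have [|k kJ] := @Fc_nonempty _ _ _ _ _ _ VA J; first by rewrite -E.
  by exists k; rewrite E; apply/Fc_col.
exists k; apply/seteqP; split.
  by rewrite -FE; apply/(f_sub (vface k) fF) => _ ->.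
move=> _ ->.
have [y fy] := f_nonempty (vface k) (ex_intro _ _ erefl).
have : f F y by have : f [set col k V] `<=` f F; [apply/(f_sub (vface k) fF) => _ ->|apply].
by rewrite FE => yi; rewrite -yi.
Qed.

Let facet_preimage j : exists k, f (Fc V A [set k]%SET) = facet P j.
Proof.
have [[_ _ sf] _] := iso; have [F fF FE] := sf _ (facet_face P j).
have := face_FcE VA (gp_proper good) fF; set J := [set j | _]%SET => E.
have [J0|[k kJ]] := set_0Vmem J.
  have FV : F = conv V.
    rewrite E J0; apply/seteqP; split=> [x []//|x Vx]; split=> // l.
    by rewrite inE.
  have [G fG GE] := sf _ (face_self (body P)).
  have PF : body P `<=` facet P j.
    by rewrite -FE -GE; apply/(f_sub fG fF); rewrite FV; exact: face_sub.
  have E' : facet P j = body P.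
    by apply/seteqP; split=> //; exact: face_sub (facet_face P j).
  have := facet_dim P j; rewrite E' => /(has_dim_uniq (body_dim P)) dd.
  by exfalso; have := ltnSn d; rewrite [X in (_ < X)%N]dd ltnn.
exists k; apply/esym; apply: (@face_eq_dim _ _ (body P) _ _ d).
- exact: facet_face.
- exact: f_face (fface k).
- rewrite -FE; apply/(f_sub fF (fface k)); rewrite E => x [Vx xJ]; split=> // l.
  by rewrite inE => /eqP ->; exact: xJ.
- exact: facet_dim.
- have [vs [js [Fl jd]]] := gp_flag_facet good k.
  by have [_] := flag_image Fl; rewrite /= in jd; rewrite jd.
Qed.

Let f_inj F G : is_face (conv V) F -> is_face (conv V) G -> f F = f G -> F = G.
Proof. by move=> fF fG E; have [[_ inj _] _] := iso; apply: inj => //; exact: mem_set. Qed.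

Let set1_inj (x y : 'cV[R]_d.+1) : [set x] = [set y] -> x = y.
Proof. by move=> E; have : [set y] x by rewrite -E. Qed.

(** Besides the relabelings this gives a realization: permuting the columns of
    [V] and [A] labels [conv V] as [P] is labeled. *)
Lemma transfer : exists (s : 'I_n -> 'I_n0) (t : 'I_m -> 'I_m0),
  [/\ bijective s, bijective t,
      forall i j, pattern_of P i j = inc V A (s i) (t j) &
      exists M, realization_space P M].
Proof.
have /choice[s sP] := vert_preimage; have /choice[s' s'P] := vert_image.
have /choice[t tP] := facet_preimage; have /choice[t' t'P] := facet_image.
have vP_inj : injective (vert P).
  by move=> i i' E; have [_ inj _] := vert_bij P; apply: inj; rewrite ?inE.
have fP_inj : injective (facet P).
  by move=> j j' E; have [_ inj _] := facet_bij P; apply: inj; rewrite ?inE.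
have vV_inj : injective (fun k => col k V).
  by move=> k k' E; have [_ inj _] := pattern_vert_bij VA good; apply: inj; rewrite ?inE.
have sK : cancel s s' by move=> i; apply: vP_inj; apply: set1_inj; rewrite -s'P sP.
have s'K : cancel s' s.
  move=> k; apply: vV_inj; apply: set1_inj; apply: (f_inj (vface _) (vface _)).
  by rewrite sP s'P.
have tK : cancel t t' by move=> j; apply: fP_inj; rewrite -t'P tP.
have t'K : cancel t' t.
  move=> k; have [_ inj _] := pattern_facet_bij VA good; apply: inj; rewrite ?inE //.
  by rewrite !Fc1E; apply: (f_inj (fface _) (fface _)); rewrite tP t'P.
exists s, t.
have incE i j : pattern_of P i j = inc V A (s i) (t j).
  apply/idP/idP.
    move=> /pattern_ofP; rewrite -sP -tP => /(f_sub (vface _) (fface _)).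
    by move/inc_sub.
  move=> /inc_sub/(f_sub (vface _) (fface _)).
  by rewrite sP tP => /pattern_ofP.
split=> //; [by exists s'|by exists t'|].
pose V' : 'M[R]_(d.+1, n) := \matrix_(r, i) V r (s i).
pose A' : 'M[R]_(d.+1, m) := \matrix_(r, j) A r (t j).
have colV' i : col i V' = col (s i) V by apply/matrixP => r c; rewrite !mxE.
have colA' j : col j A' = col (t j) A by apply/matrixP => r c; rewrite !mxE.
have convV' : conv V' = conv V.
  rewrite /Defs.conv; congr conv_hull; apply/seteqP; split=> _ [i _ <-].
    by exists (s i); rewrite // colV'.
  by exists (s' i); rewrite // colV' s'K.
have polA' : polyhedron A' = polyhedron A.
  apply/funext => x; rewrite !polyhedronE; apply/propext; split=> H j.
    by have := H (t' j); rewrite colA' t'K.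
  by rewrite colA'.
have VA' : conv V' = polyhedron A' by rewrite convV' polA'.
have incE' i j : inc V' A' i j = pattern_of P i j by rewrite /inc colV' colA' incE.
have FcE j : Fc V' A' [set j]%SET = Fc V A [set t j]%SET.
  rewrite -!Fc1E convV'; apply/seteqP; split=> x /= [Vx]; rewrite !dot_col colA'; by [].
have [g isog gf] := face_lattice_iso_inv iso.
exists (row_mx V' A').
apply: (@realization_of_iso _ _ _ _ _ _ _ _ g); rewrite ?row_mxKl ?row_mxKr //.
- have -> : pattern_of P = (fun i j => inc V A (s i) (t j)).
    by apply/funext => i; apply/funext => j.
  by apply: good_relabel good; [exists s'|exists t'].
- exact: leq_ltn_trans (leq0n _) (ltn_ord (t' (Ordinal m0_gt0))).
- by rewrite convV'.
- by move=> i; rewrite colV' -sP gf.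
- by move=> j; rewrite FcE -tP gf.
Qed.

End Transfer.

(** * Coordinates relative to four vertices *)

Section RationalMatrices.
Context {R : realType} {p q : nat} (O : set 'M[R]_(p, q)).

Lemma ratf_det k (F : 'M[R]_(p, q) -> 'M[R]_k) :
  ratm O F -> ratf O (fun y => \det (F y)).
Proof.
move=> rF; apply: ratf_sum => s _; apply: ratfM; first exact: ratf_cst.
by apply: ratf_prod => i _; exact: rF.
Qed.

Lemma ratm_inv k (F : 'M[R]_(p, q) -> 'M[R]_k) :
  (forall y, O y -> \det (F y) != 0) -> ratm O F -> ratm O (fun y => invmx (F y)).
Proof.
move=> dF rF i j.
apply: (@ratf_eq _ _ _ _ (fun y => (\det (F y))^-1 * ((-1) ^+ (j + i) *
    \det (row' j (col' i (F y)))))) => [y Oy|].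
  by rewrite /invmx unitmxE unitfE dF // !mxE.
apply: ratfM; first by apply: ratfV => //; exact: ratf_det.
apply: ratfM; first exact: ratf_cst.
apply: ratf_det => k' l; apply: ratf_eq (rF (lift j k') (lift i l)) => y _.
by rewrite !mxE.
Qed.

Lemma ratm_mul k l o (F : 'M[R]_(p, q) -> 'M[R]_(k, l)) (H : 'M[R]_(p, q) -> 'M[R]_(l, o)) :
  ratm O F -> ratm O H -> ratm O (fun y => F y *m H y).
Proof.
move=> rF rH i j; apply: (@ratf_eq _ _ _ _ (fun y => \sum_s F y i s * H y s j)).
  by move=> y _; rewrite mxE.
by apply: ratf_sum => s _; exact: ratfM.
Qed.

Lemma ratm_tr k l (F : 'M[R]_(p, q) -> 'M[R]_(k, l)) :
  ratm O F -> ratm O (fun y => (F y)^T).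
Proof. by move=> rF i j; apply: ratf_eq (rF j i) => y _; rewrite mxE. Qed.

Lemma ratm_row k l o (F : 'M[R]_(p, q) -> 'M[R]_(k, l)) (H : 'M[R]_(p, q) -> 'M[R]_(k, o)) :
  ratm O F -> ratm O H -> ratm O (fun y => row_mx (F y) (H y)).
Proof.
move=> rF rH i j; case: (fintype.splitP j) => j' jE.
  apply: ratf_eq (rF i j') => y _; rewrite (_ : j = lshift o j') ?row_mxEl //.
  exact: val_inj.
apply: ratf_eq (rH i j') => y _; rewrite (_ : j = rshift l j') ?row_mxEr //.
exact: val_inj.
Qed.

Lemma open_neq0 (f : 'M[R]_(p, q) -> R) :
  open O -> ratf O f -> open (O `&` [set y | f y != 0]).
Proof.
move=> oO rf; rewrite openE => y [Oy fy]; apply: filterI; first exact: open_nbhs_nbhs.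
have cf : {for y, continuous f} by exact: ratf_cont rf Oy.
have oN : open [set t : R | t != 0].
  rewrite (_ : [set t : R | t != 0] = ~` [set 0]); last first.
    by apply/seteqP; split=> t /= => [/eqP//|/eqP].
  by apply: closed_openC; exact: closed_eq.
exact: cf _ (open_nbhs_nbhs (conj oN fy)).
Qed.

End RationalMatrices.

Section Frame.
Context {R : realType} {m : nat}.

(** The change of coordinates replaces the last four vertices and all facets by
    their coordinates relative to the first four vertices and keeps the latter,
    which still parametrize the choice of the frame. *)
Definition frame (V : 'M[R]_(4, 8)) : 'M[R]_4 := \matrix_(r, k) V r (inord k).

Definition to_frame (V : 'M[R]_(4, 8)) : 'M[R]_(4, 8) :=
  \matrix_(r, i) (if (i < 4)%N then V r i else (invmx (frame V) *m V) r i).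

Definition from_frame (V : 'M[R]_(4, 8)) : 'M[R]_(4, 8) :=
  \matrix_(r, i) (if (i < 4)%N then V r i else (frame V *m V) r i).

Lemma inord_lt4 (k : 'I_4) : (@inord 7 k < 4)%N.
Proof. by rewrite inordK // (leq_trans (ltn_ord k)). Qed.

Lemma frame_to V : frame (to_frame V) = frame V.
Proof. by apply/matrixP => r k; rewrite !mxE inord_lt4. Qed.

Lemma frame_from V : frame (from_frame V) = frame V.
Proof. by apply/matrixP => r k; rewrite !mxE inord_lt4. Qed.

Lemma to_frameK V : \det (frame V) != 0 -> from_frame (to_frame V) = V.
Proof.
move=> dV; have uV : frame V \in unitmx by rewrite unitmxE unitfE.
apply/matrixP => r i; rewrite mxE; case: ifPn => i4; first by rewrite mxE i4.
rewrite frame_to mxE (eq_bigr (fun k => frame V r k * (invmx (frame V) *m V) k i)).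
  by have := mulKVmx uV V => /matrixP/(_ r i); rewrite mxE.
by move=> k _; rewrite [to_frame V k i]mxE (negbTE i4).
Qed.

Lemma from_frameK V : \det (frame V) != 0 -> to_frame (from_frame V) = V.
Proof.
move=> dV; have uV : frame V \in unitmx by rewrite unitmxE unitfE.
apply/matrixP => r i; rewrite mxE; case: ifPn => i4; first by rewrite mxE i4.
rewrite frame_from mxE (eq_bigr (fun k => invmx (frame V) r k * (frame V *m V) k i)).
  by have := mulKmx uV V => /matrixP/(_ r i); rewrite mxE.
by move=> k _; rewrite [from_frame V k i]mxE (negbTE i4).
Qed.

(** Entries by natural numbers, so that positions can be given by cases;
    columns 0 to 7 are vertices and column [8 + j] is facet [j]. *)
Definition ent (z : 'M[R]_(4, 8 + m)) r c : R := z (inord r) (@inord (7 + m) c).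

(** The value of facet functional [j] on vertex [i] in coordinates where the
    first four vertices are the unit vectors. *)
Definition dotv (z : 'M[R]_(4, 8 + m)) i j : R :=
  if (i < 4)%N then ent z i (8 + j) else
  ent z 0 (8 + j) * ent z 0 i + ent z 1 (8 + j) * ent z 1 i +
  ent z 2 (8 + j) * ent z 2 i + ent z 3 (8 + j) * ent z 3 i.

Lemma lsubmx_ent z r (i : 'I_8) : lsubmx z r i = ent z r i.
Proof.
rewrite mxE /ent inord_val; congr (z _ _); apply/val_inj.
by rewrite /= inordK // (leq_trans (ltn_ord i)) // leq_addr.
Qed.

Lemma rsubmx_ent z r (j : 'I_m) : rsubmx z r j = ent z r (8 + j).
Proof.
rewrite mxE /ent inord_val; congr (z _ _); apply/val_inj.
by rewrite /= inordK // ltn_add2l.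
Qed.

Section Relabel.
Variables (s s' : 'I_8 -> 'I_8) (t t' : 'I_m -> 'I_m).
Hypotheses (sK : cancel s s') (s'K : cancel s' s) (tK : cancel t t') (t'K : cancel t' t).

(** The permutations [s] and [t] sort the labels of a given polytope into the
    standard order, in which the first four vertices form the frame. *)
Definition relV (M : 'M[R]_(4, 8 + m)) : 'M[R]_(4, 8) := \matrix_(r, i) lsubmx M r (s i).
Definition relA (M : 'M[R]_(4, 8 + m)) : 'M[R]_(4, m) := \matrix_(r, j) rsubmx M r (t j).

Definition Phi (M : 'M[R]_(4, 8 + m)) : 'M[R]_(4, 8 + m) :=
  row_mx (to_frame (relV M)) ((frame (relV M))^T *m relA M).

Definition Psi (z : 'M[R]_(4, 8 + m)) : 'M[R]_(4, 8 + m) :=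
  row_mx (\matrix_(r, i) from_frame (lsubmx z) r (s' i))
    (\matrix_(r, j) ((invmx (frame (lsubmx z)))^T *m rsubmx z) r (t' j)).

Definition U1 : set 'M[R]_(4, 8 + m) := [set M | \det (frame (relV M)) != 0].
Definition U1' : set 'M[R]_(4, 8 + m) := [set z | \det (frame (lsubmx z)) != 0].

Lemma relV_Psi z : relV (Psi z) = from_frame (lsubmx z).
Proof. by apply/matrixP => r i; rewrite mxE /Psi row_mxKl mxE sK. Qed.

Lemma relA_Psi z : relA (Psi z) = (invmx (frame (lsubmx z)))^T *m rsubmx z.
Proof. by apply/matrixP => r i; rewrite mxE /Psi row_mxKr mxE tK. Qed.

Lemma Phi_U1 M : U1 M -> U1' (Phi M).
Proof. by rewrite /U1 /U1' /= /Phi row_mxKl frame_to. Qed.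

Lemma Psi_U1 z : U1' z -> U1 (Psi z).
Proof. by rewrite /U1 /U1' /= relV_Psi frame_from. Qed.

Lemma PhiK M : U1 M -> Psi (Phi M) = M.
Proof.
move=> dM; have uM : frame (relV M) \in unitmx by rewrite unitmxE unitfE.
rewrite /Psi /Phi row_mxKl row_mxKr to_frameK // frame_to mulmxA -trmx_mul.
rewrite mulmxV // trmx1 mul1mx -[RHS]hsubmxK; congr row_mx.
  by apply/matrixP => r i; rewrite !mxE s'K.
by apply/matrixP => r i; rewrite !mxE t'K.
Qed.

Lemma PsiK z : U1' z -> Phi (Psi z) = z.
Proof.
move=> dz; have uz : frame (lsubmx z) \in unitmx by rewrite unitmxE unitfE.
rewrite /Phi relV_Psi relA_Psi from_frameK // frame_from mulmxA -trmx_mul.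
by rewrite mulVmx // trmx1 mul1mx hsubmxK.
Qed.

Lemma dot_Phi M (i : 'I_8) (j : 'I_m) : U1 M ->
  dot (col (t j) (rsubmx M)) (col (s i) (lsubmx M)) = dotv (Phi M) i j.
Proof.
move=> dM; have uM : frame (relV M) \in unitmx by rewrite unitmxE unitfE.
have -> : dot (col (t j) (rsubmx M)) (col (s i) (lsubmx M)) = ((relA M)^T *m relV M) j i.
  by rewrite /dot !mxE; apply: eq_bigr => r _; rewrite !mxE.
have rA r : ((frame (relV M))^T *m relA M) r j = ent (Phi M) r (8 + j).
  by rewrite -rsubmx_ent /Phi row_mxKr.
have rV r : to_frame (relV M) r i = ent (Phi M) r i.
  by rewrite -lsubmx_ent /Phi row_mxKl.
rewrite /dotv; case: ifPn => i4.
  rewrite (_ : ent (Phi M) i (8 + j) = ent (Phi M) (Ordinal i4) (8 + j)) // -rA.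
  have iE : inord (Ordinal i4) = i by apply/val_inj; rewrite /= inordK.
  rewrite [LHS]mxE [RHS]mxE; apply: eq_bigr => r _.
  by rewrite !mxE iE mulrC.
have -> : (relA M)^T *m relV M =
    ((frame (relV M))^T *m relA M)^T *m (invmx (frame (relV M)) *m relV M).
  by rewrite trmx_mul trmxK mulmxA mulmxK.
rewrite mxE (eq_bigr (fun r : 'I_4 => ent (Phi M) r (8 + j) * ent (Phi M) r i)).
  by rewrite !big_ord_recr big_ord0 /= add0r.
move=> r _; rewrite [X in X * _]mxE rA -rV; congr (_ * _).
by rewrite [RHS]mxE (negbTE i4).
Qed.

Lemma rat_frame O' (F : 'M[R]_(4, 8 + m) -> 'M[R]_(4, 8)) :
  ratm O' F -> ratm O' (fun y => frame (F y)).
Proof. by move=> rF r k; apply: ratf_eq (rF r (inord k)) => y _; rewrite mxE. Qed.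

Lemma rat_Phi : ratm U1 Phi.
Proof.
have rV : ratm U1 relV.
  by move=> r i; apply: ratf_eq (ratf_coord U1 r (lshift m (s i))) => y _; rewrite !mxE.
have rA : ratm U1 relA.
  by move=> r i; apply: ratf_eq (ratf_coord U1 r (rshift 8 (t i))) => y _; rewrite !mxE.
have rF : ratm U1 (fun y => frame (relV y)) by exact: rat_frame.
apply: ratm_row; last by apply: ratm_mul => //; exact: ratm_tr.
move=> r i; have [i4|i4] := boolP (i < 4)%N.
  by apply: ratf_eq (rV r i) => y _; rewrite [in RHS]mxE i4.
have rI : ratm U1 (fun y => invmx (frame (relV y)) *m relV y).
  by apply: ratm_mul => //; apply: ratm_inv.
by apply: ratf_eq (rI r i) => y _; rewrite [in RHS]mxE (negbTE i4).
Qed.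

Lemma rat_Psi : ratm U1' Psi.
Proof.
have rV : ratm U1' lsubmx.
  by move=> r i; apply: ratf_eq (ratf_coord U1' r (lshift m i)) => y _; rewrite !mxE.
have rA : ratm U1' rsubmx.
  by move=> r i; apply: ratf_eq (ratf_coord U1' r (rshift 8 i)) => y _; rewrite !mxE.
have rF : ratm U1' (fun y => frame (lsubmx y)) by exact: rat_frame.
have rN : ratm U1' (fun y => from_frame (lsubmx y)).
  move=> r i; have [i4|i4] := boolP (i < 4)%N.
    by apply: ratf_eq (rV r i) => y _; rewrite [in RHS]mxE i4.
  have rI : ratm U1' (fun y => frame (lsubmx y) *m lsubmx y) by exact: ratm_mul.
  by apply: ratf_eq (rI r i) => y _; rewrite [in RHS]mxE (negbTE i4).
have rB : ratm U1' (fun y => (invmx (frame (lsubmx y)))^T *m rsubmx y).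
  by apply: ratm_mul => //; apply: ratm_tr; exact: ratm_inv.
apply: ratm_row => r j.
  by apply: ratf_eq (rN r (s' j)) => y _; rewrite [in RHS]mxE.
by apply: ratf_eq (rB r (t' j)) => y _; rewrite [in RHS]mxE.
Qed.

Lemma open_U1 : open U1.
Proof.
have -> : U1 = setT `&` [set M | \det (frame (relV M)) != 0].
  by rewrite setTI.
apply: open_neq0; first exact: openT.
apply: ratf_det; apply: rat_frame => r i.
by apply: ratf_eq (ratf_coord _ r (lshift m (s i))) => y _; rewrite !mxE.
Qed.

Lemma open_U1' : open U1'.
Proof.
have -> : U1' = setT `&` [set z | \det (frame (lsubmx z)) != 0].
  by rewrite setTI.
apply: open_neq0; first exact: openT.
apply: ratf_det; apply: rat_frame => r i.
by apply: ratf_eq (ratf_coord _ r (lshift m i)) => y _; rewrite !mxE.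
Qed.

End Relabel.
End Frame.

(** The solution set of the incidence equations, written in the coordinates
    relative to the first four vertices, is a graph over the coordinates in
    [F] once [s] solves these equations for the other coordinates. *)
Lemma realization_manifold (R : realType) m (P : labeled_polytope R 4 8 m)
    (I0 : nat -> nat -> bool) (s : 'I_8 -> 'I_8) (t : 'I_m -> 'I_m)
    (F : {set 'I_4 * 'I_(8 + m)}) (O : set 'M[R]_(4, 8 + m))
    (sol : 'M[R]_(4, 8 + m) -> 'M[R]_(4, 8 + m)) :
  (0 < m)%N -> good_pattern 4 (pattern_of P) -> realization_space P !=set0 ->
  bijective s -> bijective t ->
  (forall i j, pattern_of P (s i) (t j) = I0 i j) ->
  (forall M, realization_space P M -> \det (frame (relV s M)) != 0) ->
  open O -> O `<=` U1' -> ratm O sol ->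
  (forall z z' : 'M[R]_(4, 8 + m), (forall i j, (i, j) \in F -> z i j = z' i j) ->
     sol z = sol z' /\ (O z -> O z')) ->
  (forall (z : 'M[R]_(4, 8 + m)) i j, (i, j) \in F -> sol z i j = z i j) ->
  (forall z, U1' z ->
     (forall i j, (i < 8)%N -> (j < m)%N -> I0 i j = (dotv z i j == 1)) ->
     O z /\ sol z = z) ->
  (forall z, O z -> sol z = z ->
     forall i j, (i < 8)%N -> (j < m)%N -> I0 i j -> dotv z i j = 1) ->
  smooth_manifold_of_dim (realization_space P) #|F|.
Proof.
move=> m0 good ne [s' sK s'K] [t' tK t'K] sI dG oO OU rsol solF solF' fwd bwd.
split=> // x Rx; have nx := realization_near good m0 Rx.
have [VAx incx] := realization_pattern Rx.
have slackx := near_slack VAx.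
pose W : set 'M[R]_(4, 8 + m) := [set M |
  (realization_space P M <->
     (forall i j, pattern_of P i j -> inc (lsubmx M) (rsubmx M) i j)) /\
  (forall i j, ~~ pattern_of P i j ->
     dot (col j (rsubmx M)) (col i (lsubmx M)) < 1)].
have nW : nbhs x W.
  apply: filterS (filterI nx slackx) => M [h1 h2]; split=> // i j.
  by rewrite -incx; exact: h2.
have := nW; rewrite nbhsE => -[U0 [oU0 U0x] U0W].
have SP y : U0 y -> U1 s y -> (realization_space P y <->
    O (Phi s t y) /\ sol (Phi s t y) = Phi s t y).
  move=> U0y U1y; have [RSy slack] := U0W y U0y; split.
    move=> Ry; apply: fwd; first exact: Phi_U1.
    move=> i j i8 jm.
    rewrite -[i]/(val (Ordinal i8)) -[j]/(val (Ordinal jm)) -sI -dot_Phi //.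
    by have [_ <-] := realization_pattern Ry.
  move=> [Oy soly]; apply/RSy => i j ij.
  rewrite /inc -[i]s'K -[j]t'K dot_Phi //; apply/eqP; apply: bwd => //.
  by rewrite -sI s'K t'K.
apply: (@graph_chart R 4 (8 + m) _ x F U0 (U1 s) (@U1' R m) O (Phi s t) (Psi s' t') sol) => //.
- exact: open_U1.
- exact: open_U1'.
- exact: dG.
- exact: rat_Phi.
- exact: rat_Psi.
- exact: Phi_U1.
- exact: Psi_U1 sK.
- exact: PhiK.
- exact: PsiK.
Qed.

(** * Solving the incidence equations *)

(** Facets as lists of vertices. Vertices 0, 1, 2 and 4, 5, 6 are the two
    triangles of the prism, with [k] over [4 + k], the apex of the pyramid is 3
    and the new point is 7. Facets 0 to 2 and 3 to 5 are the side facets through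
    the apex and the new point, which miss the prism edge [k]; facets 6 and 7
    are the facets over the upper triangle. The remaining ones, around the lower
    triangle, make the difference between the three types. *)
Definition prism_facets : seq (seq nat) :=
  [:: [:: 1; 2; 5; 6; 3]; [:: 0; 2; 4; 6; 3]; [:: 0; 1; 4; 5; 3];
      [:: 1; 2; 5; 6; 7]; [:: 0; 2; 4; 6; 7]; [:: 0; 1; 4; 5; 7];
      [:: 0; 1; 2; 3]; [:: 0; 1; 2; 7]]%N.
Definition facets1 := prism_facets ++ [:: [:: 4; 5; 6; 3; 7]]%N.
Definition facets2 := prism_facets ++ [:: [:: 4; 5; 6; 3]; [:: 4; 5; 6; 7]]%N.
Definition facets3 := prism_facets ++ [:: [:: 5; 6; 3; 7]; [:: 4; 6; 3; 7]; [:: 4; 5; 3; 7]]%N.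

Definition pat (tab : seq (seq nat)) i j : bool := i \in nth [::] tab j.

Lemma pat_prism fs i j : (j < 8)%N -> pat (prism_facets ++ fs) i j = pat prism_facets i j.
Proof. by move=> j8; rewrite /pat nth_cat j8. Qed.

(** Coordinates are relative to the vertices 0, 1, 2 and 3, and a facet is given
    by the functional that equals 1 on it. Thus facet 6 is the sum of the
    coordinates, and side facet [k] through the apex differs from it only in
    coefficient [k], by [X_k]. Let [w_i] be the lower vertices and
    [sg_i = 1 - sum w_i] their slack on facet 6. The incidences with these side
    facets say that [X_k w_i(k) = sg_i] for [k != i]. Side facet [k] through the
    new point differs from facet 6 by [Z_k] and [U_k] in coefficients [k] and 3,
    hence [Z_k w_i(k) + U_k w_i(3) = sg_i], that is,
    [w_i(3) / sg_i = (1 - Z_k / X_k) / U_k] for [k != i].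
    These six equations say that three numbers depending on [i] and three
    numbers depending on [k] are all equal, to [kap] below. They form a hexagon,
    so one of them follows from the other five: this is the reason for the
    additional dimension.
    The parameters [x] are [X_0], [X_1], [X_2], the entries [w_0(1)], [w_1(2)],
    [w_2(0)] and [w_0(3)], and the new point. The definitions below solve the
    equations for everything else. *)
Section Solver.
Context {R : realFieldType} (x : nat -> R).

Definition pX k : R := x k - 1.
Definition psg i : R :=
  match i with 0 => pX 1 * x 3%N | 1 => pX 2 * x 4%N | _ => pX 0 * x 5%N end.
Definition pkap : R := x 6%N / psg 0.
Definition pwd i : R :=
  1 - psg i * (1 + pkap + (pX 0)^-1 + (pX 1)^-1 + (pX 2)^-1 - (pX i)^-1).
Definition pw i r : R :=
  if r == i then pwd i else if r == 3%N then pkap * psg i else psg i / pX r.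
(** [D_i] is the slack of lower vertex [i] on side facet [i], up to sign. *)
Definition pD i : R := pX i * pwd i - psg i.
Definition pg i : R := psg i / pD i.
Definition pgs : R := pg 0 + pg 1 + pg 2.
Definition pB i : R := pX i * pg i / (1 + pgs).

Section NewPoint.
Variable q : nat -> R.
Definition psq : R := 1 - q 0%N - q 1%N - q 2%N - q 3%N.
Definition pUden k : R := q 3%N - pkap * pX k * q k.
Definition pU k : R := (psq - pX k * q k) / pUden k.
Definition pZ k : R := pX k * (1 - pkap * pU k).
Definition pS : R := pB 0 * q 0%N + pB 1 * q 1%N + pB 2 * q 2%N.
Definition pEden : R := q 3%N - pkap * pS.
Definition pE : R := (psq - pS) / pEden.
Definition peden k : R := pX 0 * pg 0 * q 0%N + pX 1 * pg 1 * q 1%N +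
  pX 2 * pg 2 * q 2%N - pX k * pg k * q k - pX k * q k * (1 + pgs - pg k).
Definition peta k : R := (psq - pX k * q k) / peden k.

Definition fside k r : R :=
  if r == k then 1 + pZ k else if r == 3%N then 1 + pU k else 1.

Definition fcol j r : R :=
  match j with
  | 0 | 1 | 2 => if r == j then x j else 1
  | 3 => fside 0 r | 4 => fside 1 r | 5 => fside 2 r
  | 6 => 1
  | _ => if r == 3%N then 1 + psq / q 3%N else 1
  end.
Definition fbot_p r : R := if r == 3%N then 1 else 1 + pB r.
Definition fbot_q r : R := if r == 3%N then 1 + pE else 1 + (1 - pkap * pE) * pB r.
Definition fbot_k k r : R := if r == 3%N then 1 else
  if r == k then 1 + pX k * (1 - peta k * (1 + pgs - pg k)) else
  1 + pX r * peta k * pg r.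
End NewPoint.

Lemma sum_pw i : (i < 3)%N ->
  pw i 0 + pw i 1 + pw i 2 + pw i 3 = 1 - psg i.
Proof.
by case: i => [|[|[|//]]] _; rewrite /pw /= /pwd /=; ring.
Qed.

(** The equation for a facet through lower vertex [i]; [B] and [E] are the
    deviations of its coefficients from those of facet 6. Since the other two
    entries [w_i(r)] are [sg_i / X_r], the sum of all [B_r / X_r] can be
    separated, after which the equation is explicit in [B_i]. *)
Lemma bottom_vertex (B : nat -> R) E i : (i < 3)%N ->
  pX 0 != 0 -> pX 1 != 0 -> pX 2 != 0 -> pD i != 0 ->
  B 0%N * pw i 0 + B 1%N * pw i 1 + B 2%N * pw i 2 + E * pw i 3 = psg i <->
  B i = pX i * pg i * (1 - (B 0%N / pX 0 + B 1%N / pX 1 + B 2%N / pX 2) - pkap * E).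
Proof.
move=> i3 X0 X1 X2 D0.
have Xi : pX i != 0 by case: i i3 {D0} => [|[|[|]]].
set be := B 0%N / _ + _ + _.
have -> : B 0%N * pw i 0 + B 1%N * pw i 1 + B 2%N * pw i 2 + E * pw i 3 =
    B i / pX i * pD i + psg i * (be + pkap * E).
  rewrite /pD /be; move: Xi; clear D0.
  by case: i i3 => [|[|[|//]]] _ Xi; rewrite /pw /=; move: (pwd _) => wd; field; rewrite ?X0 ?X1 ?X2.
split=> [E1|->]; last first.
  by rewrite /pg; field; rewrite Xi D0.
have E2 : B i / pX i * pD i = psg i * (1 - be - pkap * E).
  by apply/eqP; rewrite -subr_eq0 -[X in X - _](addrK (psg i * (be + pkap * E))) E1; apply/eqP; ring.
rewrite /pg -[LHS](divfK Xi) -[B i / pX i](mulfK D0) E2; field.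
exact: D0.
Qed.

End Solver.

Arguments pX {R} x k : simpl never.
Arguments psg {R} x i : simpl never.
Arguments pwd {R} x i : simpl never.
Arguments pkap {R} x : simpl never.
Arguments pD {R} x i : simpl never.
Arguments pg {R} x i : simpl never.

Section Values.
Context {R : realFieldType} (a w : nat -> nat -> R) (q : nat -> R).

Definition value j (v : nat -> R) : R :=
  a j 0%N * v 0%N + a j 1%N * v 1%N + a j 2%N * v 2%N + a j 3%N * v 3%N.

(** Here the vertices 0 to 3 are the unit vectors. *)
Definition dv i j : R :=
  match i with
  | 0 | 1 | 2 | 3 => a j i
  | 4 => value j (w 0%N)
  | 5 => value j (w 1%N)
  | 6 => value j (w 2%N)
  | _ => value j q
  end.

Definition pars k : R :=
  match k with
  | 0 => a 0%N 0%N | 1 => a 1%N 1%N | 2 => a 2%N 2%N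
  | 3 => w 0%N 1%N | 4 => w 1%N 2%N | 5 => w 2%N 0%N | 6 => w 0%N 3%N
  | 7 => q 0%N | 8 => q 1%N | 9 => q 2%N | _ => q 3%N
  end.

Local Notation x := pars.

Record solved : Prop := Solved {
  sX : forall k, (k < 3)%N -> pX x k != 0;
  sx3 : x 3%N != 0;
  sD : forall k, (k < 3)%N -> pD x k != 0;
  sq3 : q 3%N != 0;
  sU : forall k, (k < 3)%N -> pUden x q k != 0;
  sw : forall i r, (i < 3)%N -> (r < 4)%N -> w i r = pw x i r;
  sa : forall j r, (j < 8)%N -> (r < 4)%N -> a j r = fcol x q j r
}.

Section Forward.
Hypothesis pat_dv : forall i j, (i < 8)%N -> (j < 8)%N -> pat prism_facets i j = (dv i j == 1).

Let Ht i j : (i < 8)%N -> (j < 8)%N -> pat prism_facets i j -> dv i j = 1.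
Proof. by move=> i8 j8; rewrite pat_dv // => /eqP. Qed.

Let Hf i j : (i < 8)%N -> (j < 8)%N -> ~~ pat prism_facets i j -> dv i j != 1.
Proof. by move=> i8 j8; rewrite pat_dv. Qed.

Ltac clra := clear - a w q pat_dv Ht Hf; intros; lra.

(** The equalities are obtained from the incidences, and the denominators do
    not vanish because of the non-incidences. *)
Lemma prism_solved : solved.
Proof.
have a01 : a 0%N 1%N = 1 := @Ht 1 0 isT isT isT.
have a02 : a 0%N 2%N = 1 := @Ht 2 0 isT isT isT.
have a03 : a 0%N 3%N = 1 := @Ht 3 0 isT isT isT.
have a10 : a 1%N 0%N = 1 := @Ht 0 1 isT isT isT.
have a12 : a 1%N 2%N = 1 := @Ht 2 1 isT isT isT.
have a13 : a 1%N 3%N = 1 := @Ht 3 1 isT isT isT.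
have a20 : a 2%N 0%N = 1 := @Ht 0 2 isT isT isT.
have a21 : a 2%N 1%N = 1 := @Ht 1 2 isT isT isT.
have a23 : a 2%N 3%N = 1 := @Ht 3 2 isT isT isT.
have a31 : a 3%N 1%N = 1 := @Ht 1 3 isT isT isT.
have a32 : a 3%N 2%N = 1 := @Ht 2 3 isT isT isT.
have a40 : a 4%N 0%N = 1 := @Ht 0 4 isT isT isT.
have a42 : a 4%N 2%N = 1 := @Ht 2 4 isT isT isT.
have a50 : a 5%N 0%N = 1 := @Ht 0 5 isT isT isT.
have a51 : a 5%N 1%N = 1 := @Ht 1 5 isT isT isT.
have a60 : a 6%N 0%N = 1 := @Ht 0 6 isT isT isT.
have a61 : a 6%N 1%N = 1 := @Ht 1 6 isT isT isT.
have a62 : a 6%N 2%N = 1 := @Ht 2 6 isT isT isT.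
have a63 : a 6%N 3%N = 1 := @Ht 3 6 isT isT isT.
have a70 : a 7%N 0%N = 1 := @Ht 0 7 isT isT isT.
have a71 : a 7%N 1%N = 1 := @Ht 1 7 isT isT isT.
have a72 : a 7%N 2%N = 1 := @Ht 2 7 isT isT isT.
pose sc i : R := 1 - w i 0%N - w i 1%N - w i 2%N - w i 3%N.
(* [e_ik]: lower vertex [i] on side facet [k] through the apex *)
have e01 : pX x 1 * w 0%N 1%N = sc 0%N.
  by have := @Ht 4 1 isT isT isT; rewrite /dv /value /= a10 a12 a13 /pX /sc /=; clra.
have e02 : pX x 2 * w 0%N 2%N = sc 0%N.
  by have := @Ht 4 2 isT isT isT; rewrite /dv /value /= a20 a21 a23 /pX /sc /=; clra.
have e10 : pX x 0 * w 1%N 0%N = sc 1%N.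
  by have := @Ht 5 0 isT isT isT; rewrite /dv /value /= a01 a02 a03 /pX /sc /=; clra.
have e12 : pX x 2 * w 1%N 2%N = sc 1%N.
  by have := @Ht 5 2 isT isT isT; rewrite /dv /value /= a20 a21 a23 /pX /sc /=; clra.
have e20 : pX x 0 * w 2%N 0%N = sc 2%N.
  by have := @Ht 6 0 isT isT isT; rewrite /dv /value /= a01 a02 a03 /pX /sc /=; clra.
have e21 : pX x 1 * w 2%N 1%N = sc 2%N.
  by have := @Ht 6 1 isT isT isT; rewrite /dv /value /= a10 a12 a13 /pX /sc /=; clra.
have psg0 : psg x 0 = sc 0%N by [].
have psg1 : psg x 1 = sc 1%N by [].
have psg2 : psg x 2 = sc 2%N by [].
have X0 : pX x 0 != 0 by rewrite subr_eq0; exact: (@Hf 0 0 isT isT isT).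
have X1 : pX x 1 != 0 by rewrite subr_eq0; exact: (@Hf 1 1 isT isT isT).
have X2 : pX x 2 != 0 by rewrite subr_eq0; exact: (@Hf 2 2 isT isT isT).
have sc0 : sc 0%N != 0.
  by have := @Hf 4 6 isT isT isT; rewrite /dv /value /= a60 a61 a62 a63 !mul1r; apply: contraNneq; rewrite /sc; clra.
have sc1 : sc 1%N != 0.
  by have := @Hf 5 6 isT isT isT; rewrite /dv /value /= a60 a61 a62 a63 !mul1r; apply: contraNneq; rewrite /sc; clra.
have sc2 : sc 2%N != 0.
  by have := @Hf 6 6 isT isT isT; rewrite /dv /value /= a60 a61 a62 a63 !mul1r; apply: contraNneq; rewrite /sc; clra.
have sqq : psq q != 0.
  by have := @Hf 7 6 isT isT isT; rewrite /dv /value /= a60 a61 a62 a63 !mul1r; apply: contraNneq; rewrite /psq; clra.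
(* [f_ik]: lower vertex [i] on side facet [k] through the new point *)
pose U k : R := match k with 0 => a 3%N 3%N | 1 => a 4%N 3%N | _ => a 5%N 3%N end - 1.
pose Z k : R := match k with 0 => a 3%N 0%N | 1 => a 4%N 1%N | _ => a 5%N 2%N end - 1.
have f01 : Z 1%N * w 0%N 1%N + U 1%N * w 0%N 3%N = sc 0%N.
  by have := @Ht 4 4 isT isT isT; rewrite /dv /value /= a40 a42 /Z /U /sc; clra.
have f02 : Z 2%N * w 0%N 2%N + U 2%N * w 0%N 3%N = sc 0%N.
  by have := @Ht 4 5 isT isT isT; rewrite /dv /value /= a50 a51 /Z /U /sc; clra.
have f10 : Z 0%N * w 1%N 0%N + U 0%N * w 1%N 3%N = sc 1%N.
  by have := @Ht 5 3 isT isT isT; rewrite /dv /value /= a31 a32 /Z /U /sc; clra.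
have f12 : Z 2%N * w 1%N 2%N + U 2%N * w 1%N 3%N = sc 1%N.
  by have := @Ht 5 5 isT isT isT; rewrite /dv /value /= a50 a51 /Z /U /sc; clra.
have f20 : Z 0%N * w 2%N 0%N + U 0%N * w 2%N 3%N = sc 2%N.
  by have := @Ht 6 3 isT isT isT; rewrite /dv /value /= a31 a32 /Z /U /sc; clra.
have f21 : Z 1%N * w 2%N 1%N + U 1%N * w 2%N 3%N = sc 2%N.
  by have := @Ht 6 4 isT isT isT; rewrite /dv /value /= a40 a42 /Z /U /sc; clra.
have U0 : U 0%N != 0 by rewrite subr_eq0; exact: (@Hf 3 3 isT isT isT).
have U1 : U 1%N != 0 by rewrite subr_eq0; exact: (@Hf 3 4 isT isT isT).
have U2 : U 2%N != 0 by rewrite subr_eq0; exact: (@Hf 3 5 isT isT isT).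
(* the ratio of the last coordinate to the slack is the same for all lower
   vertices, because any two of them share a side facet *)
have ratio k s t : pX x k != 0 -> U k != 0 -> s != 0 ->
    Z k * (s / pX x k) + U k * t = s -> t / s = (1 - Z k / pX x k) / U k.
  move=> Xk Uk s0 E; apply: (mulIf Uk); rewrite divfK //.
  apply: (mulIf s0); rewrite mulrAC divfK // -[RHS](addrK (Z k * (s / pX x k))).
  by rewrite [t * _]mulrC -[U k * t](addrK (Z k * (s / pX x k))) [U k * t + _]addrC E; field.
have w01 : w 0%N 1%N = sc 0%N / pX x 1 by rewrite -e01 mulrC mulKf.
have w02 : w 0%N 2%N = sc 0%N / pX x 2 by rewrite -e02 mulrC mulKf.
have w10 : w 1%N 0%N = sc 1%N / pX x 0 by rewrite -e10 mulrC mulKf.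
have w12 : w 1%N 2%N = sc 1%N / pX x 2 by rewrite -e12 mulrC mulKf.
have w20 : w 2%N 0%N = sc 2%N / pX x 0 by rewrite -e20 mulrC mulKf.
have w21 : w 2%N 1%N = sc 2%N / pX x 1 by rewrite -e21 mulrC mulKf.
have kapE : pkap x = w 0%N 3%N / sc 0%N by rewrite /pkap psg0.
have k01 : pkap x = (1 - Z 1%N / pX x 1) / U 1%N by rewrite kapE; apply: ratio; rewrite -?w01.
have k02 : pkap x = (1 - Z 2%N / pX x 2) / U 2%N by rewrite kapE; apply: ratio; rewrite -?w02.
have k12 : w 1%N 3%N / sc 1%N = pkap x by rewrite k02; apply: ratio; rewrite -?w12.
have k21 : w 2%N 3%N / sc 2%N = pkap x by rewrite k01; apply: ratio; rewrite -?w21.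
have k20 : pkap x = (1 - Z 0%N / pX x 0) / U 0%N by rewrite -k21; apply: ratio; rewrite -?w20.
have w03 : w 0%N 3%N = pkap x * sc 0%N by rewrite kapE divfK.
have w13 : w 1%N 3%N = pkap x * sc 1%N by rewrite -k12 divfK.
have w23 : w 2%N 3%N = pkap x * sc 2%N by rewrite -k21 divfK.
have Z0 : Z 0%N = pX x 0 * (1 - pkap x * U 0%N) by rewrite k20; field; rewrite X0 U0.
have Z1 : Z 1%N = pX x 1 * (1 - pkap x * U 1%N) by rewrite k01; field; rewrite X1 U1.
have Z2 : Z 2%N = pX x 2 * (1 - pkap x * U 2%N) by rewrite k02; field; rewrite X2 U2.
have wd0 : w 0%N 0%N = pwd x 0.
  have : sc 0%N = 1 - w 0%N 0%N - w 0%N 1%N - w 0%N 2%N - w 0%N 3%N by [].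
  by rewrite w01 w02 w03 /pwd psg0; clra.
have wd1 : w 1%N 1%N = pwd x 1.
  have : sc 1%N = 1 - w 1%N 0%N - w 1%N 1%N - w 1%N 2%N - w 1%N 3%N by [].
  by rewrite w10 w12 w13 /pwd psg1; clra.
have wd2 : w 2%N 2%N = pwd x 2.
  have : sc 2%N = 1 - w 2%N 0%N - w 2%N 1%N - w 2%N 2%N - w 2%N 3%N by [].
  by rewrite w20 w21 w23 /pwd psg2; clra.
have D0 : pD x 0 != 0.
  have := @Hf 4 0 isT isT isT; rewrite /dv /value /= a01 a02 a03; apply: contraNneq.
  by rewrite /pD psg0 -wd0 /pX /sc /=; clra.
have D1 : pD x 1 != 0.
  have := @Hf 5 1 isT isT isT; rewrite /dv /value /= a10 a12 a13; apply: contraNneq.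
  by rewrite /pD psg1 -wd1 /pX /sc /=; clra.
have D2 : pD x 2 != 0.
  have := @Hf 6 2 isT isT isT; rewrite /dv /value /= a20 a21 a23; apply: contraNneq.
  by rewrite /pD psg2 -wd2 /pX /sc /=; clra.
(* The side facets through the new point yield [U_k]; its denominator is
   nonzero because the new point is off the side facets through the apex. *)
have q7 : (a 7%N 3%N - 1) * q 3%N = psq q.
  by have := @Ht 7 7 isT isT isT; rewrite /dv /value /= a70 a71 a72 /psq; clra.
have q30 : q 3%N != 0 by apply: contraNneq sqq => q30; rewrite -q7 q30 mulr0.
have g0 : Z 0%N * q 0%N + U 0%N * q 3%N = psq q.
  by have := @Ht 7 3 isT isT isT; rewrite /dv /value /= a31 a32 /Z /U /psq; clra.
have g1 : Z 1%N * q 1%N + U 1%N * q 3%N = psq q.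
  by have := @Ht 7 4 isT isT isT; rewrite /dv /value /= a40 a42 /Z /U /psq; clra.
have g2 : Z 2%N * q 2%N + U 2%N * q 3%N = psq q.
  by have := @Ht 7 5 isT isT isT; rewrite /dv /value /= a50 a51 /Z /U /psq; clra.
have h0 : psq q - pX x 0 * q 0%N != 0.
  have := @Hf 7 0 isT isT isT; rewrite /dv /value /= a01 a02 a03; apply: contraNneq.
  by rewrite /psq /pX /=; clra.
have h1 : psq q - pX x 1 * q 1%N != 0.
  have := @Hf 7 1 isT isT isT; rewrite /dv /value /= a10 a12 a13; apply: contraNneq.
  by rewrite /psq /pX /=; clra.
have h2 : psq q - pX x 2 * q 2%N != 0.
  have := @Hf 7 2 isT isT isT; rewrite /dv /value /= a20 a21 a23; apply: contraNneq.
  by rewrite /psq /pX /=; clra.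
have Uq0 : U 0%N * pUden x q 0 = psq q - pX x 0 * q 0%N by move: g0; rewrite Z0 /pUden; clra.
have Uq1 : U 1%N * pUden x q 1 = psq q - pX x 1 * q 1%N by move: g1; rewrite Z1 /pUden; clra.
have Uq2 : U 2%N * pUden x q 2 = psq q - pX x 2 * q 2%N by move: g2; rewrite Z2 /pUden; clra.
have d0 : pUden x q 0 != 0 by apply: contraNneq h0 => d0; rewrite -Uq0 d0 mulr0.
have d1 : pUden x q 1 != 0 by apply: contraNneq h1 => d1; rewrite -Uq1 d1 mulr0.
have d2 : pUden x q 2 != 0 by apply: contraNneq h2 => d2; rewrite -Uq2 d2 mulr0.
have pU0 : pU x q 0 = U 0%N by rewrite /pU -Uq0 mulfK.
have pU1 : pU x q 1 = U 1%N by rewrite /pU -Uq1 mulfK.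
have pU2 : pU x q 2 = U 2%N by rewrite /pU -Uq2 mulfK.
split.
- by case=> [|[|[|]]].
- by apply: contraNneq sc0 => x30; rewrite -e01 -[w _ _]/(x 3%N) x30 mulr0.
- by case=> [|[|[|]]].
- by [].
- by case=> [|[|[|]]].
- by case=> [|[|[|//]]] [|[|[|[|//]]]] _ _; rewrite /pw /= ?psg0 ?psg1 ?psg2.
- case=> [|[|[|[|[|[|[|[|//]]]]]]]] [|[|[|[|//]]]] _ _; rewrite /fcol /fside //=;
    rewrite ?pU0 ?pU1 ?pU2 /pZ ?pU0 ?pU1 ?pU2 -?Z0 -?Z1 -?Z2 /U /Z ?subrKC //.
  by rewrite -q7 mulfK // subrKC.
Qed.

End Forward.

Section Backward.
Hypothesis S : solved.

Lemma solved_prism i j : (i < 8)%N -> (j < 8)%N -> pat prism_facets i j -> dv i j = 1.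
Proof.
have X0 := @sX S 0 isT; have X1 := @sX S 1 isT; have X2 := @sX S 2 isT.
have s0 : psg x 0 != 0 by rewrite mulf_neq0 // sx3.
have q30 := sq3 S.
have Q k : (k < 3)%N -> pZ x q k * q k + pU x q k * q 3%N = psq q.
  move=> k3; have dk := sU S k3; rewrite /pZ.
  suff E : pU x q k * pUden x q k = psq q - pX x k * q k by rewrite -[RHS](subrK (pX x k * q k)) -E /pUden; ring.
  by rewrite divfK.
move=> i8 j8.
have side v c k z u : (k < 3)%N -> v 0%N + v 1%N + v 2%N + v 3%N = 1 - c ->
    z * v k + u * v 3%N = c ->
    (if 0%N == k then 1 + z else 1) * v 0%N + (if 1%N == k then 1 + z else 1) * v 1%N +
    (if 2%N == k then 1 + z else 1) * v 2%N + (1 + u) * v 3%N = 1 :> R.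
  by case: k => [|[|[|//]]] _ /=; lra.
have sumq : q 0%N + q 1%N + q 2%N + q 3%N = 1 - psq q by rewrite /psq; ring.
have T i' j' : (i' < 3)%N -> (j' < 6)%N -> pat prism_facets (4 + i') j' ->
    fcol x q j' 0 * pw x i' 0 + fcol x q j' 1 * pw x i' 1 +
    fcol x q j' 2 * pw x i' 2 + fcol x q j' 3 * pw x i' 3 = 1.
  move=> i3 j6 ij; have sw := sum_pw x i3.
  have [j3|j3] := ltnP j' 3.
    have := side (pw x i') (psg x i') j' (pX x j') 0 j3 sw.
    move: i3 j3 ij {j6 sw}.
    case: i' => [|[|[|//]]] _; case: j' => [|[|[|//]]] _ // _;
      rewrite /fcol /pX /= !addr0 !subrKC; apply; rewrite /pw /= mul0r addr0 mulrC divfK //.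
  have k3 : (j' - 3 < 3)%N by rewrite ltn_subLR.
  have := side (pw x i') (psg x i') (j' - 3)%N (pZ x q (j' - 3)) (pU x q (j' - 3)) k3 sw.
  move: i3 j3 j6 ij {sw k3}.
  case: i' => [|[|[|//]]] _; case: j' => [|[|[|[|[|[|//]]]]]] // _ _ // _;
    rewrite /fcol /fside /=;
    apply; rewrite /pw /pZ /=; field; rewrite ?X0 ?X1 ?X2 //.
have := S; case=> _ _ _ _ _ sw' sa'.
move=> ij; case: i i8 ij => [|[|[|[|[|[|[|[|i]]]]]]]] i8 ij //; rewrite /dv.
- by rewrite sa' //; move: j8 ij; case: j => [|[|[|[|[|[|[|[|]]]]]]]].
- by rewrite sa' //; move: j8 ij; case: j => [|[|[|[|[|[|[|[|]]]]]]]].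
- by rewrite sa' //; move: j8 ij; case: j => [|[|[|[|[|[|[|[|]]]]]]]].
- by rewrite sa' //; move: j8 ij; case: j => [|[|[|[|[|[|[|[|]]]]]]]].
- rewrite /value !sa' // !sw' //; apply: T => //.
  by move: j8 ij; case: j => [|[|[|[|[|[|[|[|]]]]]]]].
- rewrite /value !sa' // !sw' //; apply: T => //.
  by move: j8 ij; case: j => [|[|[|[|[|[|[|[|]]]]]]]].
- rewrite /value !sa' // !sw' //; apply: T => //.
  by move: j8 ij; case: j => [|[|[|[|[|[|[|[|]]]]]]]].
rewrite /value !sa' //; move: j8 ij; case: j => [|[|[|[|[|[|[|[|//]]]]]]]] // _ _.
- by have := side q (psq q) 0%N _ _ isT sumq (Q 0%N isT).
- by have := side q (psq q) 1%N _ _ isT sumq (Q 1%N isT).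
- by have := side q (psq q) 2%N _ _ isT sumq (Q 2%N isT).
- by rewrite /fcol /= mulrDl mul1r divfK // -[RHS](subrK (psq q)) -sumq; ring.
Qed.

End Backward.

End Values.

Section Bottoms.
Context {R : realFieldType} (x q : nat -> R).
Hypothesis nX : forall k, (k < 3)%N -> pX x k != 0.
Hypothesis nD : forall k, (k < 3)%N -> pD x k != 0.
Let X0 := nX (isT : 0 < 3)%N.
Let X1 := nX (isT : 1 < 3)%N.
Let X2 := nX (isT : 2 < 3)%N.

Definition val4 (b v : nat -> R) : R :=
  b 0%N * v 0%N + b 1%N * v 1%N + b 2%N * v 2%N + b 3%N * v 3%N.

Let be (b : nat -> R) : R :=
  (b 0%N - 1) / pX x 0 + (b 1%N - 1) / pX x 1 + (b 2%N - 1) / pX x 2.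

(** A lower vertex fixes one coefficient of a facet in terms of the total [be]
    of all three; summing up, the total is determined as well. *)
Let bottomP b i : (i < 3)%N -> val4 b (pw x i) = 1 <->
  b i - 1 = pX x i * pg x i * (1 - be b - pkap x * (b 3%N - 1)).
Proof.
move=> i3; have Di := nD i3.
rewrite -(bottom_vertex (fun r => b r - 1) (b 3%N - 1) i3 X0 X1 X2 Di).
have := sum_pw x i3; rewrite /val4 => S; split=> E.
  have -> : psg x i = 1 - (pw x i 0 + pw x i 1 + pw x i 2 + pw x i 3) by rewrite S; ring.
  by rewrite -[1 in RHS]E; ring.
have -> : 1 = psg x i + (pw x i 0 + pw x i 1 + pw x i 2 + pw x i 3) by rewrite S; ring.
by rewrite -E; ring.
Qed.

Let bottom_total b : (forall i, (i < 3)%N -> val4 b (pw x i) = 1) ->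
  (1 + pgs x) * (1 - be b - pkap x * (b 3%N - 1)) = 1 - pkap x * (b 3%N - 1).
Proof.
move=> H; set t := 1 - be b - _.
have E0 := (bottomP b (i := 0) isT).1 (H 0%N isT).
have E1 := (bottomP b (i := 1) isT).1 (H 1%N isT).
have E2 := (bottomP b (i := 2) isT).1 (H 2%N isT).
have beE : be b = pgs x * t.
  by rewrite {1}/be E0 E1 E2 -/t /pgs; field; rewrite X0 X1 X2.
by rewrite mulrDl mul1r -beE /t; ring.
Qed.

(** The facet through the lower triangle and the apex. *)
Lemma bot_p_forward b : b 3%N = 1 ->
  (forall i, (i < 3)%N -> val4 b (pw x i) = 1) ->
  1 + pgs x != 0 /\ forall r, (r < 4)%N -> b r = fbot_p x r.
Proof.
move=> b3 H; have := bottom_total H; rewrite b3 subrr mulr0 !subr0 => T.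
have g0 : 1 + pgs x != 0.
  by apply/eqP => g0; move: T; rewrite g0 mul0r => /eqP; rewrite eq_sym oner_eq0.
split=> // r r4; rewrite /fbot_p; case: eqP => [->//|/eqP r3].
have r3' : (r < 3)%N by rewrite ltn_neqAle r3.
have := (bottomP b r3').1 (H r r3'); rewrite b3 subrr mulr0 subr0 => E.
have tE : 1 - be b = (1 + pgs x)^-1.
  by apply: (mulfI g0); rewrite T mulfV.
by rewrite -[LHS](subrK 1) E tE /pB addrC.
Qed.

Hypothesis g0 : 1 + pgs x != 0.

Let be_pB c b : (forall r, (r < 3)%N -> b r - 1 = c * pB x r) ->
  be b = c * (pgs x / (1 + pgs x)).
Proof.
move=> H; rewrite /be !H // /pB /pgs; field.
by rewrite -/(pgs x) g0 X0 X1 X2.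
Qed.

Lemma bot_p_backward i : (i < 3)%N -> val4 (fbot_p x) (pw x i) = 1.
Proof.
move=> i3; apply/bottomP => //; rewrite subrr mulr0 subr0 (@be_pB 1).
  rewrite mul1r /fbot_p; have -> : (i == 3)%N = false by move: i3; case: i => [|[|[|]]].
  by rewrite addrAC subrr add0r /pB; field.
by move=> r r3; rewrite /fbot_p ltn_eqF // addrAC subrr add0r mul1r.
Qed.

Lemma val_bot_p : val4 (fbot_p x) q = 1 - psq q + pS x q.
Proof. by rewrite /val4 /fbot_p /= /psq /pS; ring. Qed.

(** The facet through the lower triangle and the new point. Its last coefficient
    is determined since the new point is off the facet through the apex. *)
Lemma bot_q_forward b :
  (forall i, (i < 3)%N -> val4 b (pw x i) = 1) -> val4 b q = 1 ->
  val4 (fbot_p x) q != 1 ->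
  pEden x q != 0 /\ forall r, (r < 4)%N -> b r = fbot_q x q r.
Proof.
move=> H Hq; rewrite val_bot_p => ne; have T := bottom_total H.
pose E := b 3%N - 1.
have BE r : (r < 3)%N -> b r - 1 = (1 - pkap x * E) * pB x r.
  move=> r3; rewrite ((bottomP b r3).1 (H r r3)) -/E.
  have -> : 1 - be b - pkap x * E = (1 - pkap x * E) / (1 + pgs x).
    by apply: (mulfI g0); rewrite T -/E mulrCA mulfV // mulr1.
  by rewrite /pB; field.
have EE : E * pEden x q = psq q - pS x q.
  have : (b 0%N - 1) * q 0%N + (b 1%N - 1) * q 1%N + (b 2%N - 1) * q 2%N + E * q 3%N = psq q.
    by rewrite /psq -[1 in RHS]Hq /val4 /E; ring.
  by rewrite !BE // => <-; rewrite /pEden /pS; ring.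
have Ed : pEden x q != 0.
  apply: contra ne => /eqP Ed; move: EE; rewrite Ed mulr0 => /eqP.
  by rewrite eq_sym subr_eq0 => /eqP ->; apply/eqP; ring.
have EpE : pE x q = E by rewrite /pE -EE mulfK.
split=> // r r4; rewrite /fbot_q EpE; case: eqP => [->|/eqP r3].
  by rewrite /E subrKC.
by rewrite -BE ?subrKC // ltn_neqAle r3.
Qed.

Lemma bot_q_backward : pEden x q != 0 ->
  (forall i, (i < 3)%N -> val4 (fbot_q x q) (pw x i) = 1) /\ val4 (fbot_q x q) q = 1.
Proof.
move=> Ed; split=> [i i3|].
  apply/bottomP => //; rewrite (@be_pB (1 - pkap x * pE x q)).
    have i3' : (i == 3)%N = false by rewrite ltn_eqF.
    rewrite /fbot_q /= i3' [_ + _ - 1]addrAC subrr add0r [1 + pE x q - 1]addrAC subrr add0r.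
    by rewrite /pB; move: (pE x q) => E; field.
  by move=> r r3; rewrite /fbot_q ltn_eqF // addrAC subrr add0r.
have : pE x q * pEden x q = psq q - pS x q by rewrite divfK.
rewrite /pEden => E.
have -> : 1 = q 0%N + q 1%N + q 2%N + q 3%N + psq q by rewrite /psq; ring.
by rewrite -[psq q](subrK (pS x q)) -E /pS /val4 /fbot_q /=; ring.
Qed.

End Bottoms.

(** A facet through the apex, the new point and the lower edge that misses lower
    vertex [k]: the two lower vertices leave one unknown [t], which the new
    point determines. *)
Section BottomK.
Context {R : realFieldType} (x q : nat -> R).
Hypothesis nX : forall k, (k < 3)%N -> pX x k != 0.
Hypothesis nD : forall k, (k < 3)%N -> pD x k != 0.
Let X0 := nX (isT : 0 < 3)%N.
Let X1 := nX (isT : 1 < 3)%N.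
Let X2 := nX (isT : 2 < 3)%N.

Lemma bot_k_forward k b : (k < 3)%N -> b 3%N = 1 ->
  (forall i, (i < 3)%N -> i != k -> val4 b (pw x i) = 1) -> val4 b q = 1 ->
  psq q - pX x k * q k != 0 ->
  peden x q k != 0 /\ forall r, (r < 4)%N -> b r = fbot_k x q k r.
Proof.
move=> k3 b3 H Hq ne.
pose t : R := 1 - ((b 0%N - 1) / pX x 0 + (b 1%N - 1) / pX x 1 + (b 2%N - 1) / pX x 2).
have Bi i : (i < 3)%N -> i != k -> b i - 1 = pX x i * pg x i * t.
  move=> i3 ik; have Di := nD i3.
  have := (bottom_vertex (fun r => b r - 1) 0 i3 X0 X1 X2 Di).1.
  rewrite mulr0 subr0 -/t; apply; rewrite mul0r addr0.
  have -> : psg x i = 1 - (pw x i 0 + pw x i 1 + pw x i 2 + pw x i 3).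
    by rewrite sum_pw //; ring.
  by rewrite -[1 in RHS](H i i3 ik) /val4 b3; ring.
have Bk : b k - 1 = pX x k * (1 - t * (1 + pgs x - pg x k)).
  move: Bi; rewrite /pgs; move: k3 {ne}; case: k H => [|[|[|//]]] _ _ Bi.
  - have /eqP := erefl t; rewrite {2}/t (Bi 1%N) // (Bi 2%N) //.
    rewrite -subr_eq0 => /eqP E; apply/eqP; rewrite -subr_eq0 -(mulr0 (pX x 0)) -E.
    by apply/eqP; field; rewrite X0 X1 X2.
  - have /eqP := erefl t; rewrite {2}/t (Bi 0%N) // (Bi 2%N) //.
    rewrite -subr_eq0 => /eqP E; apply/eqP; rewrite -subr_eq0 -(mulr0 (pX x 1)) -E.
    by apply/eqP; field; rewrite X0 X1 X2.
  - have /eqP := erefl t; rewrite {2}/t (Bi 0%N) // (Bi 1%N) //.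
    rewrite -subr_eq0 => /eqP E; apply/eqP; rewrite -subr_eq0 -(mulr0 (pX x 2)) -E.
    by apply/eqP; field; rewrite X0 X1 X2.
have tE : t * peden x q k = psq q - pX x k * q k.
  have : (b 0%N - 1) * q 0%N + (b 1%N - 1) * q 1%N + (b 2%N - 1) * q 2%N = psq q.
    by rewrite /psq -[1 in RHS]Hq /val4 b3; ring.
  move: Bi Bk; rewrite /peden; move: k3 {ne}; case: k H => [|[|[|//]]] _ _ Bi Bk <-.
  - by rewrite Bk (Bi 1%N) // (Bi 2%N) //; ring.
  - by rewrite Bk (Bi 0%N) // (Bi 2%N) //; ring.
  - by rewrite Bk (Bi 0%N) // (Bi 1%N) //; ring.
have ed : peden x q k != 0 by apply: contraNneq ne => ed; rewrite -tE ed mulr0.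
have etE : peta x q k = t by rewrite /peta -tE mulfK.
split=> // r r4; rewrite /fbot_k etE; case: eqP => [->//|/eqP r3].
case: eqP => [->|/eqP rk]; first by rewrite -Bk subrKC.
have -> : pX x r * t * pg x r = b r - 1.
  by rewrite Bi // 1?mulrAC // ltn_neqAle r3.
by rewrite subrKC.
Qed.

Lemma bot_k_backward k : (k < 3)%N -> peden x q k != 0 ->
  (forall i, (i < 3)%N -> i != k -> val4 (fbot_k x q k) (pw x i) = 1) /\
  val4 (fbot_k x q k) q = 1.
Proof.
move=> k3 ed; split=> [i i3 ik|].
  have Di := nD i3.
  have := (bottom_vertex (fun r => fbot_k x q k r - 1) 0 i3 X0 X1 X2 Di).2.
  rewrite mul0r addr0 mulr0 subr0 => H.
  have E : (fbot_k x q k 0 - 1) * pw x i 0 + (fbot_k x q k 1 - 1) * pw x i 1 +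
      (fbot_k x q k 2 - 1) * pw x i 2 = psg x i.
    apply: H; rewrite {1}/fbot_k (negbTE ik) ltn_eqF // addrAC subrr add0r.
    rewrite -mulrA [peta _ _ _ * _]mulrC mulrA; congr (_ * _).
    rewrite /fbot_k /pgs; move: (peta x q k) => eta; move: k3 {ed i3 ik Di}.
    by case: k => [|[|[|//]]] _ /=; field; rewrite X0 X1 X2.
  have -> : 1 = psg x i + (pw x i 0 + pw x i 1 + pw x i 2 + pw x i 3).
    by rewrite sum_pw //; ring.
  by rewrite -E /val4 {4}/fbot_k /=; ring.
have E : peta x q k * peden x q k = psq q - pX x k * q k by rewrite divfK.
have -> : 1 = q 0%N + q 1%N + q 2%N + q 3%N + psq q by rewrite /psq; ring.
rewrite -[psq q](subrK (pX x k * q k)) -E /val4 /fbot_k /peden.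
by move: (peta x q k) => eta; move: k3 {ed E}; case: k => [|[|[|//]]] _ /=; ring.
Qed.

End BottomK.

(** * Regularity of the solved coordinates *)

(** Parameters 7 to 10 are the new point. *)
Definition qx (R : Type) (x : nat -> R) r : R :=
  match r with 0 => x 7%N | 1 => x 8%N | 2 => x 9%N | _ => x 10%N end.

(** The solutions are rational in the parameters wherever the denominators that
    occur are nonzero. *)
Section RatEntries.
Context {R : realType} {p q : nat} (O : set 'M[R]_(p, q)).
Variable X : 'M[R]_(p, q) -> nat -> R.
Hypothesis rX : forall k, (k < 7)%N -> ratf O (fun z => X z k).

Definition nz (f : (nat -> R) -> R) : Prop := forall z, O z -> f (X z) != 0.

Lemma r_pX k : (k < 3)%N -> ratf O (fun z => pX (X z) k).
Proof.
move=> k3; apply: ratfB; last exact: ratf_cst.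
by apply: rX; rewrite (leq_trans k3).
Qed.

Lemma r_psg i : ratf O (fun z => psg (X z) i).
Proof.
by case: i => [|[|i]]; apply: ratfM; try exact: r_pX; exact: rX.
Qed.

Hypothesis nX : forall k, (k < 3)%N -> nz (fun x => pX x k).
Hypothesis nx3 : nz (fun x => x 3%N).

Lemma r_pXV k : (k < 3)%N -> ratf O (fun z => (pX (X z) k)^-1).
Proof. by move=> k3; apply: ratfV; [exact: nX|exact: r_pX]. Qed.

Lemma r_pkap : ratf O (fun z => pkap (X z)).
Proof.
apply: ratf_div; [|exact: rX|exact: r_psg].
by move=> z Oz; apply: mulf_neq0; [exact: nX|exact: nx3].
Qed.

Lemma r_pwd i : (i < 3)%N -> ratf O (fun z => pwd (X z) i).
Proof.
move=> i3; apply: ratfB; first exact: ratf_cst.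
apply: ratfM; first exact: r_psg.
apply: ratfB; last exact: r_pXV.
apply: ratfD; last exact: r_pXV.
apply: ratfD; last exact: r_pXV.
apply: ratfD; last exact: r_pXV.
by apply: ratfD; [exact: ratf_cst|exact: r_pkap].
Qed.

Lemma r_pw i r : (i < 3)%N -> (r < 4)%N -> ratf O (fun z => pw (X z) i r).
Proof.
move=> i3 r4; rewrite /pw; case: (r == i) => /=; first exact: r_pwd.
case: (boolP (r == 3%N)) => r3; first by apply: ratfM; [exact: r_pkap|exact: r_psg].
by apply: ratfM; [exact: r_psg|apply: r_pXV; rewrite ltn_neqAle r3].
Qed.

Lemma r_pD i : (i < 3)%N -> ratf O (fun z => pD (X z) i).
Proof.
move=> i3; apply: ratfB; last exact: r_psg.
by apply: ratfM; [exact: r_pX|exact: r_pwd].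
Qed.

Hypothesis nD : forall k, (k < 3)%N -> nz (fun x => pD x k).

Lemma r_pg i : (i < 3)%N -> ratf O (fun z => pg (X z) i).
Proof. by move=> i3; apply: ratf_div; [exact: nD|exact: r_psg|exact: r_pD]. Qed.

Lemma r_pgs : ratf O (fun z => pgs (X z)).
Proof. by apply: ratfD; [apply: ratfD|]; exact: r_pg. Qed.

Lemma r_pgs1 : ratf O (fun z => 1 + pgs (X z)).
Proof. by apply: ratfD; [exact: ratf_cst|exact: r_pgs]. Qed.

Lemma r_pB i : (i < 3)%N -> nz (fun x => 1 + pgs x) -> ratf O (fun z => pB (X z) i).
Proof.
move=> i3 ng; apply: ratf_div; [exact: ng| |exact: r_pgs1].
by apply: ratfM; [exact: r_pX|exact: r_pg].
Qed.

Hypothesis rq : forall r, ratf O (fun z => qx (X z) r).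

Lemma r_psq : ratf O (fun z => psq (qx (X z))).
Proof.
by do 4?[apply: ratfB; last exact: rq]; exact: ratf_cst.
Qed.

Lemma r_pUden k : (k < 3)%N -> ratf O (fun z => pUden (X z) (qx (X z)) k).
Proof.
move=> k3; apply: ratfB; first exact: rq.
by apply: ratfM (rq k); apply: ratfM; [exact: r_pkap|exact: r_pX].
Qed.

Lemma r_res k : (k < 3)%N -> ratf O (fun z => psq (qx (X z)) - pX (X z) k * qx (X z) k).
Proof. by move=> k3; apply: ratfB; [exact: r_psq|apply: ratfM; [exact: r_pX|exact: rq]]. Qed.

Lemma r_pU k : (k < 3)%N -> nz (fun x => pUden x (qx x) k) ->
  ratf O (fun z => pU (X z) (qx (X z)) k).
Proof. by move=> k3 nU; apply: ratf_div; [exact: nU|exact: r_res|exact: r_pUden]. Qed.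

Lemma r_fside k r : (k < 3)%N -> nz (fun x => pUden x (qx x) k) ->
  ratf O (fun z => fside (X z) (qx (X z)) k r).
Proof.
move=> k3 nU; rewrite /fside; case: (r == k) => /=; last case: (r == 3%N) => /=; last exact: ratf_cst.
  apply: ratfD; first exact: ratf_cst.
  apply: ratfM; first exact: r_pX.
  apply: ratfB; first exact: ratf_cst.
  by apply: ratfM; [exact: r_pkap|exact: r_pU].
by apply: ratfD; [exact: ratf_cst|exact: r_pU].
Qed.

Lemma r_fcol j r : (forall k, (k < 3)%N -> nz (fun x => pUden x (qx x) k)) ->
  nz (fun x => qx x 3) -> ratf O (fun z => fcol (X z) (qx (X z)) j r).
Proof.
move=> nU nq; case: j => [|[|[|[|[|[|[|j]]]]]]].
- by rewrite /fcol; case: (r == 0%N) => /=; [exact: rX|exact: ratf_cst].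
- by rewrite /fcol; case: (r == 1%N) => /=; [exact: rX|exact: ratf_cst].
- by rewrite /fcol; case: (r == 2%N) => /=; [exact: rX|exact: ratf_cst].
- exact: r_fside (nU 0%N isT).
- exact: r_fside (nU 1%N isT).
- exact: r_fside (nU 2%N isT).
- exact: ratf_cst.
rewrite /fcol; case: (r == 3%N) => /=; last exact: ratf_cst.
apply: ratfD; first exact: ratf_cst.
by apply: ratf_div; [exact: nq|exact: r_psq|exact: (rq 3%N)].
Qed.

Lemma r_fbot_p r : (r < 4)%N -> nz (fun x => 1 + pgs x) ->
  ratf O (fun z => fbot_p (X z) r).
Proof.
move=> r4 ng; rewrite /fbot_p; case: (boolP (r == 3%N)) => r3; first exact: ratf_cst.
apply: ratfD; first exact: ratf_cst.
by apply: r_pB => //; rewrite ltn_neqAle r3.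
Qed.

Lemma r_pS : nz (fun x => 1 + pgs x) -> ratf O (fun z => pS (X z) (qx (X z))).
Proof.
by move=> ng; apply: ratfD; [apply: ratfD|];
  (apply: ratfM; [exact: r_pB|exact: rq]).
Qed.

Lemma r_pEden : nz (fun x => 1 + pgs x) -> ratf O (fun z => pEden (X z) (qx (X z))).
Proof.
move=> ng; apply: ratfB; first exact: rq.
by apply: ratfM; [exact: r_pkap|exact: r_pS].
Qed.

Lemma r_fbot_q r : (r < 4)%N -> nz (fun x => 1 + pgs x) ->
  nz (fun x => pEden x (qx x)) -> ratf O (fun z => fbot_q (X z) (qx (X z)) r).
Proof.
move=> r4 ng nE.
have rE : ratf O (fun z => pE (X z) (qx (X z))).
  apply: ratf_div; [exact: nE| |exact: r_pEden].
  by apply: ratfB; [exact: r_psq|exact: r_pS].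
rewrite /fbot_q; case: (boolP (r == 3%N)) => r3; first by apply: ratfD; [exact: ratf_cst|].
apply: ratfD; first exact: ratf_cst.
apply: ratfM; last by apply: r_pB => //; rewrite ltn_neqAle r3.
apply: ratfB; first exact: ratf_cst.
by apply: ratfM => //; exact: r_pkap.
Qed.

Lemma r_peden k : (k < 3)%N -> ratf O (fun z => peden (X z) (qx (X z)) k).
Proof.
move=> k3.
have t i : (i < 3)%N -> ratf O (fun z => pX (X z) i * pg (X z) i * qx (X z) i).
  by move=> i3; apply: ratfM (rq i); apply: ratfM; [exact: r_pX|exact: r_pg].
apply: ratfB; first by apply: ratfB; [apply: ratfD; [apply: ratfD|]|]; exact: t.
apply: ratfM; first by apply: ratfM (rq k); exact: r_pX.
by apply: ratfB; [exact: r_pgs1|exact: r_pg].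
Qed.

Lemma r_fbot_k k r : (k < 3)%N -> (r < 4)%N ->
  nz (fun x => peden x (qx x) k) -> ratf O (fun z => fbot_k (X z) (qx (X z)) k r).
Proof.
move=> k3 r4 ne.
have re : ratf O (fun z => peta (X z) (qx (X z)) k).
  by apply: ratf_div; [exact: ne|exact: r_res|exact: r_peden].
rewrite /fbot_k; case: (boolP (r == 3%N)) => r3; first exact: ratf_cst.
have r3' : (r < 3)%N by rewrite ltn_neqAle r3.
case: (r == k) => /=; apply: ratfD; try exact: ratf_cst.
  apply: ratfM; first exact: r_pX.
  apply: ratfB; first exact: ratf_cst.
  by apply: ratfM => //; apply: ratfB; [exact: r_pgs1|exact: r_pg].
by apply: ratfM; [apply: ratfM; [exact: r_pX|]|exact: r_pg].
Qed.

End RatEntries.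

(** * The slice charts of the three realization spaces *)

Section Slice.
Context {R : realType} {m : nat} (qfree : bool).
Variable bot : (nat -> R) -> nat -> nat -> R.
Variable dens : seq ((nat -> R) -> R).
Local Notation mat := 'M[R]_(4, 8 + m).
Implicit Types z : mat.

Definition az z j r : R := ent z r (8 + j).
Definition wz z i r : R := ent z r (4 + i).
Definition qz z r : R := ent z r 7.
Definition par z : nat -> R := pars (az z) (wz z) (qz z).

(** When the apex, the new point and the lower triangle lie on one facet, the
    last coordinate of the new point depends on the other parameters; [trunc]
    makes this dependence manifest. *)
Definition trunc (x : nat -> R) k : R := if (k < 10)%N then x k else 0.
Definition q3of (y : nat -> R) : R :=
  1 - y 7%N - y 8%N - y 9%N - (pB y 0 * y 7%N + pB y 1 * y 8%N + pB y 2 * y 9%N).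
Definition fill (x : nat -> R) (k : nat) : R :=
  if (k < 10)%N || qfree then x k else q3of (trunc x).

Definition tab (x : nat -> R) (r c : nat) : R :=
  match c with
  | 0 | 1 | 2 | 3 => 0
  | 4 => pw x 0 r | 5 => pw x 1 r | 6 => pw x 2 r
  | 7 => qx x r
  | j.+4.+4 => if (j < 8)%N then fcol x (qx x) j r else bot x j r
  end.

(** The frame and the parameters of the solution, at the positions where they
    are read off; for [k < 3], entry [k] of facet [k] stands for [X_k]. *)
Definition freepos (r c : nat) : bool :=
  [|| (c < 4)%N, (r, c) \in [:: (0, 8); (1, 9); (2, 10); (1, 4); (2, 5);
    (0, 6); (3, 4); (0, 7); (1, 7); (2, 7)]%N | qfree && ((r, c) == (3, 7)%N)].

Definition sol z : mat :=
  \matrix_(r, c) if freepos r c then z r c else tab (fill (par z)) r c.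

Definition dom (ds : seq ((nat -> R) -> R)) : set mat :=
  [set z | U1' z /\ all (fun d => d (fill (par z)) != 0) ds].

Definition freeset : {set 'I_4 * 'I_(8 + m)} :=
  [set rc : 'I_4 * 'I_(8 + m) | freepos rc.1 rc.2]%SET.

Lemma ent_val z (r : 'I_4) (c : 'I_(8 + m)) : ent z r c = z r c.
Proof. by rewrite /ent !inord_val. Qed.

Lemma ent_agree z z' r c :
  (forall i j, (i, j) \in freeset -> z i j = z' i j) ->
  (r < 4)%N -> (c < 8 + m)%N -> freepos r c -> ent z r c = ent z' r c.
Proof. by move=> zz' r4 cm rc; apply: zz'; rewrite inE /= !inordK. Qed.

Lemma par_ge10 z k : (10 <= k)%N -> par z k = ent z 3 7.
Proof. by case: k => [|[|[|[|[|[|[|[|[|[|k]]]]]]]]]]. Qed.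

Lemma qx_par z r : (r < 4)%N -> qx (par z) r = qz z r.
Proof. by case: r => [|[|[|[|]]]]. Qed.

Lemma dotv_dv z i j : (i < 8)%N -> dotv z i j = dv (az z) (wz z) (qz z) i j.
Proof. by case: i => [|[|[|[|[|[|[|[|]]]]]]]]. Qed.

(** The incidence equations in solved form. *)
Record zsolved z : Prop := ZSolved {
  zs_prism : solved (az z) (wz z) (qz z);
  zs_dens : all (fun d => d (par z) != 0) dens;
  zs_fill : fill (par z) = par z;
  zs_bot : forall j r, (8 <= j)%N -> (j < m)%N -> (r < 4)%N -> az z j r = bot (par z) j r
}.

Hypothesis m8 : (8 <= m)%N.

Let lt_m c : (c < 16)%N -> (c < 8 + m)%N.
Proof. by move=> c16; rewrite (leq_trans c16) // -[16%N]/(8 + 8)%N leq_add2l. Qed.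

Lemma fill_agree z z' : 
  (forall i j, (i, j) \in freeset -> z i j = z' i j) -> fill (par z) = fill (par z').
Proof.
move=> zz'.
have E k : (k < 10)%N -> par z k = par z' k.
  by case: k => [|[|[|[|[|[|[|[|[|[|]]]]]]]]]] // _; apply: ent_agree => //; exact: lt_m.
have T : trunc (par z) = trunc (par z').
  by apply/funext => k; rewrite /trunc; case: ifP => // /E.
apply/funext => k; rewrite /fill T; case: ltnP => [/E //|k10] /=.
case: ifP => // qf; rewrite !par_ge10 //.
by apply: ent_agree => //; rewrite /freepos qf orbT.
Qed.

Lemma zsolved_tab z r c : zsolved z -> (r < 4)%N -> (4 <= c)%N -> (c < 8 + m)%N ->
  ent z r c = tab (par z) r c.
Proof.
move=> [[_ _ _ _ _ sw sa] _ _ sb] r4.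
have colE j : fcol (par z) (qx (par z)) j r = fcol (par z) (qz z) j r by [].
case: c => [|[|[|[|[|[|[|[|j]]]]]]]] // _ cm.
- exact: (sw 0%N).
- exact: (sw 1%N).
- exact: (sw 2%N).
- by rewrite /tab qx_par.
rewrite /tab; case: ltnP => [j8|j8]; first exact: sa.
by apply: sb => //; move: cm; rewrite -[j.+4.+4]/(8 + j)%N ltn_add2l.
Qed.

Lemma zsolved_sol z : U1' z -> zsolved z -> dom dens z /\ sol z = z.
Proof.
move=> Uz zs; split; first by split=> //; rewrite zs_fill //; exact: zs_dens.
apply/matrixP => r c; rewrite mxE zs_fill //; case: ifPn => // nf.
rewrite -zsolved_tab ?ent_val //.
by move: nf; rewrite negb_or -leqNgt => /andP[].
Qed.

Hypothesis dens_base : forall x, all (fun d => d x != 0) dens ->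
  [/\ forall k, (k < 3)%N -> pX x k != 0, x 3%N != 0, forall k, (k < 3)%N -> pD x k != 0,
      qx x 3 != 0 & forall k, (k < 3)%N -> pUden x (qx x) k != 0].

(** The parameters are themselves among the entries that the solution
    prescribes, e.g. [w_0(1) = sg_0 / X_1] with [sg_0 = X_1 w_0(1)], so a fixed
    point of [sol] agrees with the solution everywhere. *)
Lemma sol_zsolved z : dom dens z -> sol z = z -> zsolved z.
Proof.
move=> [_ dz] solz; set x := fill (par z) in dz.
have [nX nx3 nD nq nU] := dens_base dz.
have X0 := nX 0%N isT; have X1 := nX 1%N isT; have X2 := nX 2%N isT.
have sg0 : psg x 0 != 0 by rewrite mulf_neq0.
have xE k : (k < 10)%N -> x k = par z k by rewrite /x /fill => ->.
have nonfree r c : (r < 4)%N -> (c < 8 + m)%N -> ~~ freepos r c -> ent z r c = tab x r c.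
  by move=> r4 cm nf; rewrite /ent -{1}solz mxE !inordK // (negbTE nf).
have x10 : (10 <= 10)%N -> ent z 3 7 = x 10%N.
  move=> _; case qf : qfree.
    by rewrite /x /fill qf orbT par_ge10.
  by rewrite nonfree // /freepos qf.
have tabE r c : (r < 4)%N -> (4 <= c)%N -> (c < 8 + m)%N -> ent z r c = tab x r c.
  move=> r4 c4 cm; have [fp|nf] := boolP (freepos r c); last exact: nonfree.
  move: fp; rewrite /freepos ltnNge c4 /= => /orP[|/andP[qf /eqP[-> ->]]]; last first.
    by rewrite x10.
  rewrite !inE !xpair_eqE => H.
  move: H; repeat (case/orP); move=> /andP[/eqP -> /eqP ->].
  - by rewrite [RHS](xE 0%N).
  - by rewrite [RHS](xE 1%N).
  - by rewrite [RHS](xE 2%N).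
  - by rewrite -[LHS]/(par z 3%N) -xE //= /pw /= /psg mulrC mulKf.
  - by rewrite -[LHS]/(par z 4%N) -xE //= /pw /= /psg mulrC mulKf.
  - by rewrite -[LHS]/(par z 5%N) -xE //= /pw /= /psg mulrC mulKf.
  - by rewrite -[LHS]/(par z 6%N) -xE //= /pw /= /pkap divfK.
  - by rewrite [RHS](xE 7%N).
  - by rewrite [RHS](xE 8%N).
  - by rewrite [RHS](xE 9%N).
have fE : x = par z.
  apply/funext => k; have [/xE //|k10] := ltnP k 10.
  have k10' : (k < 10)%N = false by rewrite ltnNge k10.
  rewrite par_ge10 // x10 // /x /fill k10' /=.
  by case: ifP => // _; rewrite !par_ge10.
have sE : fill (par z) = par z by [].
rewrite fE in dz nX nx3 nD nq nU tabE.
split=> //.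
  split=> //.
  - by move=> k k3; have := nU k k3; case: k k3 => [|[|[|//]]].
  - move=> i r i3 r4; case: i i3 => [|[|[|//]]] _.
    + by rewrite /wz tabE //; exact: lt_m.
    + by rewrite /wz tabE //; exact: lt_m.
    + by rewrite /wz tabE //; exact: lt_m.
  - by move=> j r j8 r4; rewrite /az tabE ?ltn_add2l ?(leq_trans j8) // /tab /= j8.
move=> j r j8 jm r4; rewrite /az tabE ?ltn_add2l // /tab /=.
by rewrite ltnNge j8.
Qed.

(** ** Openness of the domain *)

Lemma nz_dom ds i : (i < size ds)%N ->
  nz (dom ds) (fun z => fill (par z)) (nth (fun=> 0) ds i).
Proof. by move=> ids z [_ /(all_nthP (fun=> 0)) H]; exact: H. Qed.

Lemma r_par (O : set mat) k : ratf O (fun z => par z k).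
Proof.
by case: k => [|[|[|[|[|[|[|[|[|[|k]]]]]]]]]]; exact: ratf_coord.
Qed.

Lemma r_fill (O : set mat) k : (k < 10)%N -> ratf O (fun z => fill (par z) k).
Proof.
by case: k => [|[|[|[|[|[|[|[|[|[|]]]]]]]]]] // _; exact: ratf_coord.
Qed.

Lemma open_dom_rcons ds d : open (dom ds) ->
  ratf (dom ds) (fun z => d (fill (par z))) -> open (dom (rcons ds d)).
Proof.
move=> oO rd; have -> : dom (rcons ds d) = dom ds `&` [set z | d (fill (par z)) != 0].
  apply/seteqP; split=> z; rewrite /dom /= all_rcons.
    by move=> [Uz /andP[]].
  by move=> [[Uz ->] ->].
exact: open_neq0.
Qed.

Lemma open_dom0 : open (dom [::]).
Proof.
have -> : dom [::] = @U1' R m by apply/seteqP; split=> z //= [].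
exact: open_U1'.
Qed.

End Slice.

(** * The three incidence patterns *)

Section Check.
Variables (fac : seq (seq nat)) (n m : nat) (flags : seq (seq nat * seq nat)).

(** A flag is listed as its vertices and its facets; each vertex has to be the
    first one of some listed flag and each facet the last one. *)
Definition flag_ok (f : seq nat * seq nat) : bool :=
  all (fun k => all (fun l => pat fac (nth 0 f.1 l) (nth 0 f.2 k)) (iota 0 k.+1) &&
    ~~ pat fac (nth 0 f.1 k.+1) (nth 0 f.2 k))%N (iota 0 4) &&
  all (fun i => i <= n)%N f.1 && all (fun j => j <= m)%N f.2.

Definition good_check : bool :=
  [&& all (fun i => has (fun j => ~~ pat fac i j) (iota 0 m.+1)) (iota 0 n.+1),
      all (fun i => all (fun i' => all (fun j => pat fac i j == pat fac i' j) (iota 0 m.+1)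
        ==> (i == i')) (iota 0 n.+1)) (iota 0 n.+1),
      all (fun j => all (fun j' => all (fun i => pat fac i j == pat fac i j') (iota 0 n.+1)
        ==> (j == j')) (iota 0 m.+1)) (iota 0 m.+1),
      all flag_ok flags,
      all (fun i => has (fun f => nth 0 f.1 0 == i) flags) (iota 0 n.+1) &
      all (fun j => has (fun f => nth 0 f.2 3 == j) flags) (iota 0 m.+1)]%N.

Lemma flag_ok_pat f : flag_ok f ->
  pat_flag 4 (fun (i : 'I_n.+1) (j : 'I_m.+1) => pat fac i j)
    (fun l => inord (nth 0%N f.1 l)) (fun k => inord (nth 0%N f.2 k)).
Proof.
move=> /andP[/andP[/allP ok /allP f1] /allP f2].
have lt1 l : (@inord n (nth 0%N f.1 l) = nth 0%N f.1 l :> nat).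
  rewrite inordK // ltnS; have [lf|lf] := ltnP l (size f.1).
    by apply: f1; exact: mem_nth.
  by rewrite nth_default.
have lt2 k : (@inord m (nth 0%N f.2 k) = nth 0%N f.2 k :> nat).
  rewrite inordK // ltnS; have [kf|kf] := ltnP k (size f.2).
    by apply: f2; exact: mem_nth.
  by rewrite nth_default.
move=> k k4; have /ok/andP[/allP H1 H2] : k \in iota 0 4 by rewrite mem_iota.
rewrite !lt1 !lt2; split=> // l lk; rewrite !lt1.
by apply: H1; rewrite mem_iota /= ltnS.
Qed.

Lemma good_of_check : good_check ->
  good_pattern 4 (fun (i : 'I_n.+1) (j : 'I_m.+1) => pat fac i j).
Proof.
move=> /and5P[/allP c1 /allP c2 /allP c3 /allP c4 /andP[/allP c5 /allP c6]].
have io k (i : 'I_k) : (i : nat) \in iota 0 k by rewrite mem_iota /=.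
split.
- move=> i; have /hasP[j] := c1 i (io _ i); rewrite mem_iota => /= jm pj.
  by exists (Ordinal jm).
- move=> i i' H; apply/val_inj/eqP.
  have /allP/(_ i' (io _ i'))/implyP := c2 i (io _ i); apply.
  by apply/allP => j; rewrite mem_iota => /= jm; rewrite (H (Ordinal jm)).
- move=> j j' H; apply/val_inj/eqP.
  have /allP/(_ j' (io _ j'))/implyP := c3 j (io _ j); apply.
  by apply/allP => i; rewrite mem_iota => /= i8; rewrite (H (Ordinal i8)).
- move=> i; have /hasP[f ff /eqP fi] := c5 i (io _ i).
  exists (fun l => inord (nth 0%N f.1 l)), (fun k => inord (nth 0%N f.2 k)).
  by split; [exact/flag_ok_pat/c4|rewrite fi inord_val].
- move=> j; have /hasP[f ff /eqP fj] := c6 j (io _ j).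
  exists (fun l => inord (nth 0%N f.1 l)), (fun k => inord (nth 0%N f.2 k)).
  by split; [exact/flag_ok_pat/c4|rewrite fj inord_val].
Qed.

End Check.

(** The differences of facets 0, 1, 2 and 7 with facet 6 form, up to scaling,
    a dual basis to the first four vertices. *)
Lemma frame_unit (R : realType) m fac (V : 'M[R]_(4, 8)) (A : 'M[R]_(4, m.+1)) :
  (7 <= m)%N ->
  (forall i j, (j < 8)%N -> pat fac i j = pat prism_facets i j) ->
  (forall (i : 'I_8) (j : 'I_m.+1), (dot (col j A) (col i V) == 1) = pat fac i j) ->
  \det (frame V) != 0.
Proof.
move=> m7 facE dotE'.
pose jk (k : 'I_4) : nat := nth 0%N [:: 0; 1; 2; 7]%N k.
have jk8 k : (jk k < 8)%N by case: k => [[|[|[|[|]]]]].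
pose B : 'M[R]_4 := \matrix_(r, k) (A r (inord (jk k)) - A r (inord 6)).
have BV k l : (B^T *m frame V) k l =
    dot (col (inord (jk k)) A) (col (inord l) V) - dot (col (inord 6) A) (col (inord l) V).
  rewrite !dotE mxE -sumrB; apply: eq_bigr => r _; rewrite !mxE.
  by rewrite mulrBl.
have dP (l : 'I_4) j : (j < 8)%N ->
    (dot (col (inord j) A) (col (inord l) V) == 1) = pat prism_facets l j.
  move=> j8; have jm : (j < m.+1)%N by rewrite (leq_trans j8).
  rewrite dotE' !inordK ?facE // (leq_trans (ltn_ord l)) //.
have d6 (l : 'I_4) : dot (col (inord 6) A) (col (inord l) V) = 1.
  by apply/eqP; rewrite dP //; case: l => [[|[|[|[|]]]]].
suff : \det (B^T *m frame V) != 0 by rewrite det_mulmx mulf_eq0 negb_or => /andP[].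
rewrite det_trig; last first.
  apply/is_trig_mxP => k l kl; rewrite BV d6; apply/eqP; rewrite subr_eq0 dP //.
  by move: k l kl => [[|[|[|[|k]]]] kp] [[|[|[|[|l]]]] lp].
apply/prodf_neq0 => k _; rewrite BV d6 subr_eq0 dP //.
by case: k => [[|[|[|[|]]]]].
Qed.

(** A polytope of the given type yields realizations of every labeled polytope
    that is combinatorially equivalent to it; its realization space is then a
    manifold by the solution of the incidence equations. *)
Lemma manifold_of_solution (R : realType) (m : nat) fac flags (qfree : bool)
    (bot : (nat -> R) -> nat -> nat -> R) (dens : seq ((nat -> R) -> R)) :
  (7 <= m)%N -> good_check fac 7 m flags ->
  (forall i j, (j < 8)%N -> pat fac i j = pat prism_facets i j) ->
  (forall x, all (fun d => d x != 0) dens ->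
    [/\ forall k, (k < 3)%N -> pX x k != 0, x 3%N != 0, forall k, (k < 3)%N -> pD x k != 0,
      qx x 3 != 0 & forall k, (k < 3)%N -> pUden x (qx x) k != 0]) ->
  open (@dom R m.+1 qfree dens) -> ratm (@dom R m.+1 qfree dens) (@sol R m.+1 qfree bot) ->
  (forall z : 'M[R]_(4, 8 + m.+1),
     (forall i j, (i < 8)%N -> (j < m.+1)%N ->
        pat fac i j = (dv (az z) (wz z) (qz z) i j == 1)) -> zsolved qfree bot dens z) ->
  (forall z : 'M[R]_(4, 8 + m.+1), zsolved qfree bot dens z ->
     forall i j, (i < 8)%N -> (8 <= j < m.+1)%N -> pat fac i j ->
       dv (az z) (wz z) (qz z) i j = 1) ->
  forall n m1 (P : labeled_polytope R 4 n m1) (V : 'M[R]_(4, 8)) (A : 'M[R]_(4, m.+1)),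
  conv V = polyhedron A -> (forall i j, inc V A i j = pat fac i j) ->
  comb_equiv (conv V) (body P) ->
  smooth_manifold_of_dim (realization_space P) #|@freeset m.+1 qfree| /\
  NG P = (4 * (8 + m.+1))%N%:Z -
    (#|[set ij : 'I_8 * 'I_m.+1 | pat fac ij.1 ij.2]%SET|)%:Z.
Proof.
move=> m7 gc facE dbase oO rsol fwd bwd n m1 P V A VA incE [f isof].
have good := good_of_check gc.
have goodVA : good_pattern 4 (inc V A).
  suff -> : inc V A = (fun (i : 'I_8) (j : 'I_m.+1) => pat fac i j) by [].
  by apply/funext => i; apply/funext => j; exact: incE.
have [s [t [sb tb stE ne]]] := transfer VA goodVA (ltn0Sn m) isof.
have n8 : n = 8%N by have := bij_eq_card sb; rewrite !card_ord.
have mE : m1 = m.+1 by have := bij_eq_card tb; rewrite !card_ord.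
subst n m1.
have [s' sK s'K] := sb; have [t' tK t'K] := tb.
have patE i j : pattern_of P (s' i) (t' j) = pat fac i j by rewrite stE s'K t'K incE.
have goodP : good_pattern 4 (pattern_of P).
  have -> : pattern_of P = (fun i j => pat fac (s i) (t j)).
    by apply/funext => i; apply/funext => j; rewrite stE incE.
  exact: good_relabel sb tb good.
split; last first.
  rewrite /NG; congr (_ - (_ : nat)%:Z).
  have g_inj : injective (fun ij : 'I_8 * 'I_m.+1 => (s' ij.1, t' ij.2)).
    by move=> [i j] [i' j'] [/(can_inj s'K) -> /(can_inj t'K) ->].
  rewrite /incidences -[in RHS](card_imset _ g_inj); apply: eq_card => -[i j].
  apply/idP/imsetP => [/set_mem /= ij|[[i' j']]].
    exists (s i, t j); rewrite /= ?sK ?tK // inE /= -patE sK tK.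
    exact: ij.
  by rewrite inE /= => ij [-> ->]; apply/mem_set; have := patE i' j'; rewrite ij.
have m8 : (8 <= m.+1)%N by [].
apply: (@realization_manifold R m.+1 P (pat fac) s' t' (@freeset m.+1 qfree)
  (@dom R m.+1 qfree dens) (@sol R m.+1 qfree bot)) => //.
- by exists s.
- by exists t.
- move=> M /realization_pattern[_ incM].
  apply: (@frame_unit R m fac _ (relA t' M)) => // i j.
  rewrite -patE -incM /inc; congr (dot _ _ == 1).
    by apply/matrixP => r c; rewrite !mxE.
  by apply/matrixP => r c; rewrite !mxE.
- by move=> z [].
- move=> z z' zz'; have E := fill_agree m8 zz'; split.
    apply/matrixP => r c; rewrite !mxE E; case: ifPn => // fp.
    by apply: zz'; rewrite inE.
  move=> [Uz dz]; split; last by rewrite -E.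
  move: Uz; rewrite /U1' /=.
  suff -> : frame (lsubmx z) = frame (lsubmx z') by [].
  apply/matrixP => r k; rewrite !mxE; apply: zz'; rewrite inE /= /freepos.
  by rewrite inordK ?ltn_ord // (leq_trans (ltn_ord k)).
- by move=> z i j; rewrite inE /= mxE => ->.
- move=> z Uz H; apply: zsolved_sol => //; apply: fwd => i j i8 jm.
  by rewrite H // dotv_dv.
- move=> z Oz solz i j i8 jm ij; rewrite dotv_dv //.
  have zs := sol_zsolved m8 dbase Oz solz.
  have [j8|j8] := ltnP j 8; last by apply: bwd => //; rewrite j8.
  by apply: (solved_prism (zs_prism zs)) => //; rewrite -facE.
Qed.

Definition flags1 : seq (seq nat * seq nat) :=
  [:: ([:: 2; 6; 3; 1; 0], [:: 6; 3; 1; 0]); ([:: 6; 2; 3; 0; 1], [:: 8; 3; 0; 1]);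
      ([:: 1; 5; 3; 0; 2], [:: 6; 3; 0; 2]); ([:: 5; 1; 2; 7; 0], [:: 8; 2; 0; 3]);
      ([:: 0; 4; 2; 7; 1], [:: 6; 2; 1; 4]); ([:: 4; 0; 1; 7; 2], [:: 8; 1; 2; 5]);
      ([:: 3; 2; 1; 0; 4], [:: 2; 1; 0; 6]); ([:: 7; 2; 1; 0; 3], [:: 5; 4; 3; 7]);
      ([:: 3; 6; 5; 4; 0], [:: 2; 1; 0; 8])]%N.
Definition flags2 : seq (seq nat * seq nat) := rcons flags1 ([:: 6; 5; 7; 4; 0], [:: 1; 0; 3; 9])%N.
Definition flags3 : seq (seq nat * seq nat) :=
  [:: ([:: 2; 6; 3; 1; 0], [:: 6; 3; 1; 0]); ([:: 6; 2; 3; 0; 1], [:: 8; 3; 0; 1]);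
      ([:: 1; 5; 3; 0; 2], [:: 6; 3; 0; 2]); ([:: 5; 1; 2; 7; 0], [:: 8; 2; 0; 3]);
      ([:: 0; 4; 2; 7; 1], [:: 6; 2; 1; 4]); ([:: 4; 0; 1; 7; 2], [:: 9; 1; 2; 5]);
      ([:: 3; 2; 1; 0; 4], [:: 2; 1; 0; 6]); ([:: 7; 2; 1; 0; 3], [:: 5; 4; 3; 7]);
      ([:: 3; 6; 5; 7; 0], [:: 2; 1; 0; 8]); ([:: 3; 6; 4; 7; 0], [:: 2; 0; 1; 9]);
      ([:: 3; 5; 4; 7; 0], [:: 1; 0; 2; 10])]%N.

Lemma good_check1 : good_check facets1 7 8 flags1. Proof. by vm_compute. Qed.
Lemma good_check2 : good_check facets2 7 9 flags2. Proof. by vm_compute. Qed.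
Lemma good_check3 : good_check facets3 7 10 flags3. Proof. by vm_compute. Qed.

Section Denominators.
Context {R : realType}.
Implicit Type x : nat -> R.

(** The domain of the solution is given by a list of denominators, each rational
    where the previous ones do not vanish; this is why it is open. *)
Definition dens_prism : seq ((nat -> R) -> R) :=
  [:: (fun x => pX x 0); (fun x => pX x 1); (fun x => pX x 2); (fun x => x 3%N);
      (fun x => pD x 0); (fun x => pD x 1); (fun x => pD x 2)].
Definition dens_q : seq ((nat -> R) -> R) :=
  [:: (fun x => qx x 3); (fun x => pUden x (qx x) 0); (fun x => pUden x (qx x) 1);
      (fun x => pUden x (qx x) 2)].
Definition dens1 : seq ((nat -> R) -> R) := dens_prism ++ (fun x => 1 + pgs x) :: dens_q.
Definition dens2 : seq ((nat -> R) -> R) := rcons dens1 (fun x => pEden x (qx x)).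
Definition dens3 : seq ((nat -> R) -> R) := dens_prism ++ dens_q ++
  [:: (fun x => peden x (qx x) 0); (fun x => peden x (qx x) 1); (fun x => peden x (qx x) 2)].

Definition bot1 x (j r : nat) : R := fbot_p x r.
Definition bot2 x (j r : nat) : R := if j == 8%N then fbot_p x r else fbot_q x (qx x) r.
Definition bot3 x (j r : nat) : R := fbot_k x (qx x) (j - 8)%N r.

Lemma dens_base x : all (fun d => d x != 0) dens_prism -> all (fun d => d x != 0) dens_q ->
  [/\ forall k, (k < 3)%N -> pX x k != 0, x 3%N != 0, forall k, (k < 3)%N -> pD x k != 0,
      qx x 3 != 0 & forall k, (k < 3)%N -> pUden x (qx x) k != 0].
Proof.
rewrite /dens_prism /dens_q [all]lock /= -lock.
move=> /and5P[X0 X1 X2 x3 /and4P[D0 D1 D2 _]] /and5P[q3 U0 U1 U2 _].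
by split=> //; case=> [|[|[|]]].
Qed.

End Denominators.

Section OpenDomains.
Context {R : realType} {m : nat} (qfree : bool).
Local Notation dom := (@dom R m qfree).
Local Notation X := (fun z : 'M[R]_(4, 8 + m) => fill qfree (par z)).
Local Notation nzd ds := (fun i H => @nz_dom R m qfree ds i H).

Lemma ratf_fill7 (O : set 'M[R]_(4, 8 + m)) k : (k < 7)%N -> ratf O (fun z => X z k).
Proof. by move=> k7; apply: r_fill; rewrite (leq_trans k7). Qed.

Lemma nz_sub ds ds' f : nz (dom ds) X f -> nz (dom (ds ++ ds')) X f.
Proof. by move=> H z [Uz]; rewrite all_cat => /andP[d1 _]; apply: H. Qed.

Lemma nz_pX ds k : (k < 3)%N -> nz (dom (dens_prism ++ ds)) X (fun x => pX x k).
Proof.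
by case: k => [|[|[|//]]] _; apply: nz_sub;
  [exact: (nzd dens_prism 0 isT)|exact: (nzd dens_prism 1 isT)|exact: (nzd dens_prism 2 isT)].
Qed.

Lemma nz_x3 ds : nz (dom (dens_prism ++ ds)) X (fun x => x 3%N).
Proof. by apply: nz_sub; exact: (nzd dens_prism 3 isT). Qed.

Lemma nz_pD ds k : (k < 3)%N -> nz (dom (dens_prism ++ ds)) X (fun x => pD x k).
Proof.
by case: k => [|[|[|//]]] _; apply: nz_sub;
  [exact: (nzd dens_prism 4 isT)|exact: (nzd dens_prism 5 isT)|exact: (nzd dens_prism 6 isT)].
Qed.

Lemma open_dens_prism : open (dom dens_prism).
Proof.
have o0 := @open_dom0 R m qfree.
have o1 : open (dom (take 1 dens_prism)) by apply: (open_dom_rcons o0); apply: r_pX => // *; exact: ratf_fill7.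
have o2 : open (dom (take 2 dens_prism)) by apply: (open_dom_rcons o1); apply: r_pX => // *; exact: ratf_fill7.
have o3 : open (dom (take 3 dens_prism)) by apply: (open_dom_rcons o2); apply: r_pX => // *; exact: ratf_fill7.
have o4 : open (dom (take 4 dens_prism)) by apply: (open_dom_rcons o3); exact: ratf_fill7.
have n4 k ds : (k < 3)%N -> nz (dom (take 4 dens_prism ++ ds)) X (fun x => pX x k).
  by case: k => [|[|[|//]]] _; apply: nz_sub;
    [exact: (nzd (take 4 dens_prism) 0 isT)|exact: (nzd (take 4 dens_prism) 1 isT)
    |exact: (nzd (take 4 dens_prism) 2 isT)].
have n43 ds : nz (dom (take 4 dens_prism ++ ds)) X (fun x => x 3%N).
  by apply: nz_sub; exact: (nzd (take 4 dens_prism) 3 isT).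
have rD k ds : (k < 3)%N -> ratf (dom (take 4 dens_prism ++ ds)) (fun z => pD (X z) k).
  by move=> k3; apply: r_pD => // *; first [exact: ratf_fill7|exact: n4|exact: n43].
have o5 : open (dom (take 5 dens_prism)).
  by apply: (open_dom_rcons o4); exact: (rD 0%N [::]).
have o6 : open (dom (take 6 dens_prism)).
  by apply: (open_dom_rcons o5); exact: (rD 1%N [:: (fun x => pD x 0)]).
by apply: (open_dom_rcons o6); exact: (rD 2%N [:: (fun x => pD x 0); (fun x => pD x 1)]).
Qed.

Lemma open_dens_gs : open (dom (dens_prism ++ [:: (fun x => 1 + pgs x)])).
Proof.
apply: (open_dom_rcons open_dens_prism).
rewrite -[dens_prism]cats0.
by apply: r_pgs1 => *; first [exact: ratf_fill7|exact: nz_pX|exact: nz_x3|exact: nz_pD].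
Qed.

(** The last coordinate of the new point may itself be a fraction, the
    denominators of which are collected in [pre]. *)
Section NewPoint.
Variable pre : seq ((nat -> R) -> R).
Hypothesis rq_pre : forall ds r, ratf (dom ((dens_prism ++ pre) ++ ds)) (fun z => qx (X z) r).
Hypothesis open_pre : open (dom (dens_prism ++ pre)).

Let rU k ds : (k < 3)%N ->
  ratf (dom (dens_prism ++ pre ++ ds)) (fun z => pUden (X z) (qx (X z)) k).
Proof.
move=> k3; apply: r_pUden => // *; first [exact: ratf_fill7|exact: nz_pX|exact: nz_x3|idtac].
by rewrite catA; exact: rq_pre.
Qed.

Lemma open_dens_q : open (dom (dens_prism ++ pre ++ dens_q)).
Proof.
have step k : open (dom ((dens_prism ++ pre) ++ take k dens_q)) -> (k < 4)%N ->
    open (dom ((dens_prism ++ pre) ++ take k.+1 dens_q)).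
  move=> ok k4; rewrite (take_nth (fun=> 0)) // -rcons_cat.
  apply: (open_dom_rcons ok); case: k k4 {ok} => [|[|[|[|//]]]] _.
  - exact: (rq_pre _ 3%N).
  - by rewrite -catA; exact: (rU (k := 0)).
  - by rewrite -catA; exact: (rU (k := 1)).
  - by rewrite -catA; exact: (rU (k := 2)).
rewrite catA; have o0 : open (dom ((dens_prism ++ pre) ++ take 0 dens_q)) by rewrite take0 cats0.
exact: step 3%N (step 2%N (step 1%N (step 0%N o0 isT) isT) isT) isT.
Qed.

Variable post : seq ((nat -> R) -> R).
Local Notation ds := (dens_prism ++ pre ++ dens_q ++ post).
Variable bot : (nat -> R) -> nat -> nat -> R.
Hypothesis r_bot : forall j r, (8 <= j)%N -> (j < m)%N -> (r < 4)%N ->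
  ratf (dom ds) (fun z => bot (X z) j r).

Lemma ratm_sol : ratm (dom ds) (@sol R m qfree bot).
Proof.
have rqx r : ratf (dom ds) (fun z => qx (X z) r) by rewrite catA; exact: rq_pre.
have nq : nz (dom ds) X (fun x => qx x 3).
  by move=> z [_]; rewrite !all_cat => /and3P[_ _ /andP[/and5P[]]].
have nU k : (k < 3)%N -> nz (dom ds) X (fun x => pUden x (qx x) k).
  by move=> k3 z [_]; rewrite !all_cat => /and3P[_ _ /andP[/and5P[_ U0 U1 U2 _] _]];
    case: k k3 => [|[|[|//]]].
move=> r c; have [fp|nf] := boolP (freepos qfree r c).
  by apply: ratf_eq (ratf_coord _ r c) => z _; rewrite mxE fp.
apply: (@ratf_eq _ _ _ _ (fun z => tab bot (X z) r c)) => [z _|].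
  by rewrite mxE (negbTE nf).
have rw i : (i < 3)%N -> ratf (dom ds) (fun z => pw (X z) i r).
  by move=> i3; apply: r_pw => // *; first [exact: ratf_fill7|exact: nz_pX|exact: nz_x3].
case: c nf => c cm /= nf; rewrite /tab.
case: c cm nf => [|[|[|[|[|[|[|[|j]]]]]]]] cm nf; try exact: rw; try exact: ratf_cst.
  exact: rqx.
case: ltnP => j8.
  by apply: r_fcol => // *; first [exact: ratf_fill7|exact: nz_pX|exact: nz_x3].
by apply: r_bot => //; move: cm; rewrite -[j.+4.+4]/(8 + j)%N ltn_add2l.
Qed.

End NewPoint.

End OpenDomains.

Lemma val4_eq (R : realFieldType) (b v v' : nat -> R) :
  (forall r, (r < 4)%N -> v r = v' r) -> val4 b v = val4 b v'.
Proof. by move=> E; rewrite /val4 !E. Qed.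

Lemma val4_eql (R : realFieldType) (b b' v : nat -> R) :
  (forall r, (r < 4)%N -> b r = b' r) -> val4 b v = val4 b' v.
Proof. by move=> E; rewrite /val4 !E. Qed.

Section Instances.
Context {R : realType}.
Implicit Type x : nat -> R.

Lemma ratf_qx_free m (O : set 'M[R]_(4, 8 + m)) r :
  ratf O (fun z => qx (fill true (par z)) r).
Proof.
have rf k : ratf O (fun z => fill true (par z) k).
  by apply: ratf_eq (r_par O k) => z _; rewrite /fill orbT.
by case: r => [|[|[|r]]]; exact: rf.
Qed.

Lemma ratf_qx_dep m ds r :
  ratf (@dom R m false ((dens_prism ++ [:: (fun x => 1 + pgs x)]) ++ ds))
    (fun z => qx (fill false (par z)) r).
Proof.
set O := dom _ _; pose T (z : 'M[R]_(4, 8 + m)) := trunc (par z).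
have rT k : ratf O (fun z => T z k).
  rewrite /T /trunc; case: (k < 10)%N; [exact: r_par|exact: ratf_cst].
have nO f : nz O (fun z => fill false (par z)) f -> nz O (fun z => fill false (par z)) f by [].
have nT i : (i < 8)%N -> nz O (fun z => fill false (par z))
    (nth (fun=> 0) (dens_prism ++ [:: (fun x => 1 + pgs x)]) i).
  by move=> i8; apply: nz_sub; exact: nz_dom.
have nX k : (k < 3)%N -> nz O T (fun x => pX x k).
  by case: k => [|[|[|//]]] _; [exact: (nT 0%N isT)|exact: (nT 1%N isT)|exact: (nT 2%N isT)].
have nx3 : nz O T (fun x => x 3%N) by exact: (nT 3%N isT).
have nD k : (k < 3)%N -> nz O T (fun x => pD x k).
  by case: k => [|[|[|//]]] _; [exact: (nT 4%N isT)|exact: (nT 5%N isT)|exact: (nT 6%N isT)].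
have ng : nz O T (fun x => 1 + pgs x) by exact: (nT 7%N isT).
have rB i : (i < 3)%N -> ratf O (fun z => pB (T z) i) by move=> i3; exact: r_pB.
case: r => [|[|[|r]]]; [exact: (rT 7%N)|exact: (rT 8%N)|exact: (rT 9%N)|].
change (ratf O (fun z => q3of (T z))); apply: ratfB.
  by do 3?[apply: ratfB; last exact: rT]; exact: ratf_cst.
by apply: ratfD; [apply: ratfD|]; (apply: ratfM; [exact: rB|exact: rT]).
Qed.

Section Common.
Variables (m : nat) (fac : seq (seq nat)) (z : 'M[R]_(4, 8 + m.+1)).
Hypothesis m7 : (7 <= m)%N.
Hypothesis facE : forall i j, (j < 8)%N -> pat fac i j = pat prism_facets i j.
Hypothesis H : forall i j, (i < 8)%N -> (j < m.+1)%N ->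
  pat fac i j = (dv (az z) (wz z) (qz z) i j == 1).

Lemma prism_of_pat : solved (az z) (wz z) (qz z).
Proof.
by apply: prism_solved => i j i8 j8; rewrite -facE // H // (leq_trans j8).
Qed.

Lemma on_pat i j : (i < 8)%N -> (j < m.+1)%N -> pat fac i j ->
  dv (az z) (wz z) (qz z) i j = 1.
Proof. by move=> i8 jm; rewrite H // => /eqP. Qed.

Lemma off_pat i j : (i < 8)%N -> (j < m.+1)%N -> ~~ pat fac i j ->
  dv (az z) (wz z) (qz z) i j != 1.
Proof. by move=> i8 jm; rewrite H. Qed.

Lemma low_pat i j : (i < 3)%N -> (j < m.+1)%N -> pat fac (4 + i) j ->
  val4 (az z j) (pw (par z) i) = 1.
Proof.
move=> i3 jm ij; have S := prism_of_pat.
rewrite -(on_pat _ jm ij); last by case: i i3 {ij} => [|[|[|]]].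
have sw := sw S; case: i i3 {ij} => [|[|[|//]]] _.
- by apply: val4_eq => r r4; rewrite -(sw 0%N).
- by apply: val4_eq => r r4; rewrite -(sw 1%N).
- by apply: val4_eq => r r4; rewrite -(sw 2%N).
Qed.

Lemma res_pat k : (k < 3)%N -> ~~ pat fac 7 k ->
  psq (qz z) - pX (par z) k * qz z k != 0.
Proof.
move=> k3 nk; have S := prism_of_pat; have sa := sa S.
have := off_pat (i := 7) isT (leq_trans k3 (leq_trans (isT : 3 <= 8)%N (m7 : 8 <= m.+1)%N)) nk.
apply: contraNneq; rewrite /dv /value !sa ?(leq_trans k3) // /fcol /psq /pX.
rewrite /par; case: k k3 {nk} => [|[|[|//]]] _ /= E;
  rewrite -subr_eq0 -oppr_eq0 -E; apply/eqP; ring.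
Qed.

End Common.

Lemma dens_prism_solved m (z : 'M[R]_(4, 8 + m)) : solved (az z) (wz z) (qz z) ->
  all (fun d => d (par z) != 0) dens_prism.
Proof.
case=> sX sx3 sD _ _ _ _.
by rewrite /dens_prism; do 7?[apply/andP; split=> //]; first [exact: sX|exact: sx3|exact: sD].
Qed.

Lemma dens_q_solved m (z : 'M[R]_(4, 8 + m)) : solved (az z) (wz z) (qz z) ->
  all (fun d => d (par z) != 0) dens_q.
Proof.
case=> _ _ _ sq sU _ _.
by do 4?[apply/andP; split=> //]; first [exact: sq|exact: (sU 0%N)|exact: (sU 1%N)|exact: (sU 2%N)].
Qed.

Lemma fill_free (x : nat -> R) : fill true x = x.
Proof. by apply/funext => k; rewrite /fill orbT. Qed.

Section Backward.
Variables (m : nat) (z : 'M[R]_(4, 8 + m)) (j : nat).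
Hypothesis S : solved (az z) (wz z) (qz z).

Lemma bwd_low b i : (i < 3)%N -> (forall r, (r < 4)%N -> az z j r = b r) ->
  val4 b (pw (par z) i) = 1 -> dv (az z) (wz z) (qz z) (4 + i) j = 1.
Proof.
move=> i3 bE E; rewrite -E -(val4_eql _ bE); have sw := sw S.
case: i i3 {E} => [|[|[|//]]] _.
- by apply: val4_eq => r r4; rewrite -(sw 0%N).
- by apply: val4_eq => r r4; rewrite -(sw 1%N).
- by apply: val4_eq => r r4; rewrite -(sw 2%N).
Qed.

Lemma bwd_q b : (forall r, (r < 4)%N -> az z j r = b r) ->
  val4 b (qz z) = 1 -> dv (az z) (wz z) (qz z) 7 j = 1.
Proof. by move=> bE E; rewrite -E -(val4_eql _ bE). Qed.

End Backward.

(** ** The polytope with nine facets *)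

Lemma incidences_solved1 (z : 'M[R]_(4, 8 + 9)) :
  (forall i j, (i < 8)%N -> (j < 9)%N ->
     pat facets1 i j = (dv (az z) (wz z) (qz z) i j == 1)) -> zsolved false bot1 dens1 z.
Proof.
move=> H; have facE i j : (j < 8)%N -> pat facets1 i j = pat prism_facets i j := @pat_prism _ i j.
have S := prism_of_pat (m := 8) isT facE H; have [sX sx3 sD _ _ _ _] := S.
have [||g0 bE] := @bot_p_forward R (par z) sX sD (az z 8).
- exact: (on_pat (m := 8) H (i := 3) (j := 8)).
- by case=> [|[|[|//]]] _; exact: (low_pat (m := 8) isT facE H).
have q3E : qz z 3 = q3of (trunc (par z)).
  have : val4 (fbot_p (par z)) (qz z) = 1.
    rewrite -(val4_eql _ bE).
    exact: (on_pat (m := 8) H (i := 7) (j := 8)).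
  rewrite val_bot_p => E.
  have : psq (qz z) = pS (par z) (qz z) by move: E; lra.
  rewrite /psq -[q3of _]/(1 - qz z 0 - qz z 1 - qz z 2 - pS (par z) (qz z)) => <-.
  ring.
split=> //.
- rewrite /dens1 all_cat dens_prism_solved //.
  by apply/andP; split=> //; apply/andP; split=> //; exact: dens_q_solved.
- apply/funext => k; rewrite /fill orbF; case: ltnP => // k10.
  by rewrite par_ge10.
- by move=> j r j8; rewrite ltnS => j8'; rewrite (_ : j = 8%N); [exact: bE|apply/eqP; rewrite eqn_leq j8'].
Qed.

Lemma solved_incidences1 (z : 'M[R]_(4, 8 + 9)) : zsolved false bot1 dens1 z ->
  forall i j, (i < 8)%N -> (8 <= j < 9)%N -> pat facets1 i j ->
  dv (az z) (wz z) (qz z) i j = 1.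
Proof.
move=> [S dz fz bz] i j i8 /andP[j8 j9].
have {j8 j9} -> : j = 8%N by apply/eqP; rewrite eqn_leq j8 -ltnS j9.
have [sX sx3 sD _ _ _ _] := S.
have g0 : 1 + pgs (par z) != 0.
  by move: dz; rewrite /dens1 all_cat => /andP[_ /andP[]].
have bE r : (r < 4)%N -> az z 8 r = fbot_p (par z) r by exact: (bz 8%N).
have low i' : (i' < 3)%N -> dv (az z) (wz z) (qz z) (4 + i') 8 = 1.
  move=> i3; apply: (bwd_low S i3 bE).
  exact: (bot_p_backward sX sD).
case: i i8 => [|[|[|[|[|[|[|[|//]]]]]]]] // _ _.
- exact: (bE 3%N).
- exact: (low 0%N).
- exact: (low 1%N).
- exact: (low 2%N).
apply: (bwd_q bE); rewrite val_bot_p.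
have : qz z 3 = q3of (trunc (par z)) by rewrite -[qz z 3]/(par z 10%N) -{1}fz.
rewrite -[q3of _]/(1 - qz z 0 - qz z 1 - qz z 2 - pS (par z) (qz z)) /psq => ->.
ring.
Qed.

(** ** The polytope with ten facets *)

Lemma incidences_solved2 (z : 'M[R]_(4, 8 + 10)) :
  (forall i j, (i < 8)%N -> (j < 10)%N ->
     pat facets2 i j = (dv (az z) (wz z) (qz z) i j == 1)) -> zsolved true bot2 dens2 z.
Proof.
move=> H; have facE i j : (j < 8)%N -> pat facets2 i j = pat prism_facets i j := @pat_prism _ i j.
have S := prism_of_pat (m := 9) isT facE H; have [sX sx3 sD _ _ _ _] := S.
have [||g0 bE] := @bot_p_forward R (par z) sX sD (az z 8).
- exact: (on_pat (m := 9) H (i := 3) (j := 8)).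
- by case=> [|[|[|//]]] _; exact: (low_pat (m := 9) isT facE H).
have [|||e0 cE] := @bot_q_forward R (par z) (qz z) sX sD g0 (az z 9).
- by case=> [|[|[|//]]] _; exact: (low_pat (m := 9) isT facE H).
- exact: (on_pat (m := 9) H (i := 7) (j := 9)).
- rewrite -(val4_eql _ bE); exact: (off_pat (m := 9) H (i := 7) (j := 8)).
split=> //.
- rewrite /dens2 all_rcons; apply/andP; split; first exact: e0.
  rewrite /dens1 all_cat dens_prism_solved //.
  by apply/andP; split=> //; apply/andP; split=> //; exact: dens_q_solved.
- exact: fill_free.
- move=> j r j8 j10 r4; rewrite /bot2; case: eqP => [->|/eqP jne]; first exact: bE.
  have -> : j = 9%N.
    by apply/eqP; rewrite eqn_leq -ltnS j10 ltn_neqAle eq_sym jne.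
  exact: cE.
Qed.

Lemma solved_incidences2 (z : 'M[R]_(4, 8 + 10)) : zsolved true bot2 dens2 z ->
  forall i j, (i < 8)%N -> (8 <= j < 10)%N -> pat facets2 i j ->
  dv (az z) (wz z) (qz z) i j = 1.
Proof.
move=> [S dz fz bz] i j i8 /andP[j8 j10].
have [sX sx3 sD _ _ _ _] := S.
move: dz; rewrite /dens2 all_rcons => /andP[e0 dz].
have g0 : 1 + pgs (par z) != 0.
  by move: dz; rewrite /dens1 all_cat => /andP[_ /andP[]].
have bE r : (r < 4)%N -> az z 8 r = fbot_p (par z) r by exact: (bz 8%N).
have cE r : (r < 4)%N -> az z 9 r = fbot_q (par z) (qz z) r by exact: (bz 9%N).
have [lowq onq] := @bot_q_backward R (par z) (qz z) sX sD g0 e0.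
have low i' : (i' < 3)%N -> dv (az z) (wz z) (qz z) (4 + i') 8 = 1.
  move=> i3; apply: (bwd_low S i3 bE).
  exact: (bot_p_backward sX sD).
have low' i' : (i' < 3)%N -> dv (az z) (wz z) (qz z) (4 + i') 9 = 1.
  by move=> i3; apply: (bwd_low S i3 cE); exact: lowq.
have : (j == 8%N) || (j == 9%N).
  by case: (j) j8 j10 => [|[|[|[|[|[|[|[|[|[|]]]]]]]]]].
case/orP => /eqP -> {j j8 j10}.
  case: i i8 => [|[|[|[|[|[|[|[|//]]]]]]]] // _ _.
  - exact: (bE 3%N).
  - exact: (low 0%N).
  - exact: (low 1%N).
  - exact: (low 2%N).
case: i i8 => [|[|[|[|[|[|[|[|//]]]]]]]] // _ _.
- exact: (low' 0%N).
- exact: (low' 1%N).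
- exact: (low' 2%N).
- exact: (bwd_q cE).
Qed.

(** ** The polytope with eleven facets *)

Lemma incidences_solved3 (z : 'M[R]_(4, 8 + 11)) :
  (forall i j, (i < 8)%N -> (j < 11)%N ->
     pat facets3 i j = (dv (az z) (wz z) (qz z) i j == 1)) -> zsolved true bot3 dens3 z.
Proof.
move=> H; have facE i j : (j < 8)%N -> pat facets3 i j = pat prism_facets i j := @pat_prism _ i j.
have S := prism_of_pat (m := 10) isT facE H; have [sX sx3 sD _ _ _ _] := S.
have K k : (k < 3)%N -> peden (par z) (qz z) k != 0 /\
    forall r, (r < 4)%N -> az z (8 + k) r = fbot_k (par z) (qz z) k r.
  move=> k3; have km : (8 + k < 11)%N by rewrite -[11%N]/(8 + 3)%N ltn_add2l.
  apply: (@bot_k_forward R (par z) (qz z) sX sD) => //.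
  - apply: (on_pat (m := 10) H (i := 3)) => //.
    by case: k k3 {km} => [|[|[|]]].
  - move=> i i3 ik; apply: (low_pat (m := 10) isT facE H) => //.
    by case: k k3 {km} ik => [|[|[|//]]] _; case: i i3 => [|[|[|]]].
  - apply: (on_pat (m := 10) H (i := 7)) => //.
    by case: k k3 {km} => [|[|[|]]].
  - apply: (res_pat (m := 10) isT facE H) => //.
    by case: k k3 {km} => [|[|[|]]].
split=> //.
- rewrite /dens3 !all_cat dens_prism_solved // dens_q_solved //.
  apply/and5P; split=> //; [exact: (K 0%N isT).1|exact: (K 1%N isT).1|].
  by apply/andP; split=> //; exact: (K 2%N isT).1.
- exact: fill_free.
- move=> j r j8 j11 r4; rewrite /bot3 -{1}(subnKC j8).
  have k3 : (j - 8 < 3)%N by rewrite ltn_subLR.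
  rewrite (K _ k3).2 //; by move: k3; case: (j - 8)%N => [|[|[|]]].
Qed.

Lemma solved_incidences3 (z : 'M[R]_(4, 8 + 11)) : zsolved true bot3 dens3 z ->
  forall i j, (i < 8)%N -> (8 <= j < 11)%N -> pat facets3 i j ->
  dv (az z) (wz z) (qz z) i j = 1.
Proof.
move=> [S dz fz bz] i j i8 /andP[j8 j11].
have [sX sx3 sD _ _ _ _] := S.
have e0 k : (k < 3)%N -> peden (par z) (qz z) k != 0.
  move: dz; rewrite /dens3 !all_cat => /and3P[_ _ /and4P[E0 E1 E2 _]].
  by case: k => [|[|[|//]]] _; [exact: E0|exact: E1|exact: E2].
pose k := (j - 8)%N; have k3 : (k < 3)%N by rewrite ltn_subLR.
have jE : j = (8 + k)%N by rewrite subnKC.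
have [low onq] := @bot_k_backward R (par z) (qz z) sX sD k k3 (e0 k k3).
have cE r : (r < 4)%N -> az z (8 + k) r = fbot_k (par z) (qz z) k r.
  move=> r4; rewrite bz -?jE // /bot3 -/k.
  by move: (k3); case: (k) => [|[|[|]]].
have low' i' : (i' < 3)%N -> i' != k -> dv (az z) (wz z) (qz z) (4 + i') (8 + k) = 1.
  by move=> i3 ik; apply: (bwd_low S i3 cE); exact: low.
rewrite jE; move: k3 cE low' onq; clearbody k; clear low jE j8 j11 => k3 cE low' onq ij.
have := bwd_q cE onq; have := cE 3%N isT.
case: i i8 ij => [|[|[|[|[|[|[|[|//]]]]]]]] _ ij c3 cq.
- by move: ij; case: k k3 {cE low' onq c3 cq} => [|[|[|]]].
- by move: ij; case: k k3 {cE low' onq c3 cq} => [|[|[|]]].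
- by move: ij; case: k k3 {cE low' onq c3 cq} => [|[|[|]]].
- by rewrite [LHS]c3.
- apply: (low' 0%N) => //; move: ij; by case: k k3 {cE low' onq c3 cq} => [|[|[|]]].
- apply: (low' 1%N) => //; move: ij; by case: k k3 {cE low' onq c3 cq} => [|[|[|]]].
- apply: (low' 2%N) => //; move: ij; by case: k k3 {cE low' onq c3 cq} => [|[|[|]]].
- exact: cq.
Qed.

End Instances.

Lemma card_ord_pairs k l (p : nat -> nat -> bool) :
  #|[set rc : 'I_k * 'I_l | p rc.1 rc.2]%SET| =
  (\sum_(r <- iota 0 k) \sum_(c <- iota 0 l) p r c)%N.
Proof.
pose p' (rc : 'I_k * 'I_l) := p rc.1 rc.2.
rewrite -sum1_card (eq_bigl p') => [|rc]; last by rewrite inE.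
rewrite -[k in iota 0 k]subn0 -/(index_iota 0 k) big_mkord.
under [RHS]eq_bigr do rewrite -[l in iota 0 l]subn0 -/(index_iota 0 l) big_mkord.
rewrite pair_big /= big_mkcond; apply: eq_bigr => rc _.
by rewrite /p'; case: (p _ _).
Qed.

Lemma card_freeset1 : #|@freeset 9 false| = 26%N.
Proof. by rewrite card_ord_pairs unlock. Qed.
Lemma card_freeset2 : #|@freeset 10 true| = 27%N.
Proof. by rewrite card_ord_pairs unlock. Qed.
Lemma card_freeset3 : #|@freeset 11 true| = 27%N.
Proof. by rewrite card_ord_pairs unlock. Qed.

Section Results.
Context {R : realType}.

Local Ltac solve_nz := first [exact: nz_x3|move=> *; first [exact: ratf_fill7|exact: nz_pX|exact: nz_pD|exact: ratf_qx_free]].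

Lemma open_dens1 qfree :
  (forall ds r, ratf (@dom R 9 qfree ((dens_prism ++ [:: (fun x => 1 + pgs x)]) ++ ds))
    (fun z => qx (fill qfree (par z)) r)) -> open (@dom R 9 qfree dens1).
Proof. by move=> rq; exact: (open_dens_q rq (@open_dens_gs R 9 qfree)). Qed.

Lemma ratm_sol1 : ratm (@dom R 9 false dens1) (@sol R 9 false bot1).
Proof.
apply: (@ratm_sol R 9 false [:: (fun x => 1 + pgs x)] (@ratf_qx_dep R 9) [::]) => j r _ _ r4.
apply: r_fbot_p => //; try solve_nz.
by move=> z [_]; rewrite !all_cat => /and4P[_ /andP[]].
Qed.

Let rq_free m pre ds r : ratf (@dom R m true ((dens_prism ++ pre) ++ ds))
    (fun z => qx (fill true (par z)) r).
Proof. exact: ratf_qx_free. Qed.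

Let nz_gs m qfree ds : nz (@dom R m qfree (dens_prism ++ [:: (fun x => 1 + pgs x)] ++ ds))
  (fun z => fill qfree (par z)) (fun x => 1 + pgs x).
Proof. by move=> z [_]; rewrite !all_cat => /and3P[_ /andP[]]. Qed.

Lemma open_dens2 : open (@dom R 10 true dens2).
Proof.
have o1 : open (@dom R 10 true dens1).
  exact: (open_dens_q (@rq_free 10 [:: (fun x => 1 + pgs x)]) (@open_dens_gs R 10 true)).
apply: (open_dom_rcons o1); apply: (r_pEden (O := dom true (dens_prism ++ [:: (fun x => 1 + pgs x)] ++ dens_q)));
  try solve_nz.
exact: nz_gs.
Qed.

Lemma ratm_sol2 : ratm (@dom R 10 true dens2) (@sol R 10 true bot2).
Proof.
apply: (@ratm_sol R 10 true [:: (fun x => 1 + pgs x)] (@rq_free 10 _)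
  [:: (fun x => pEden x (qx x))]) => j r _ _ r4.
rewrite /bot2; case: (j == 8%N).
  by apply: r_fbot_p => //; try solve_nz; exact: nz_gs.
apply: r_fbot_q => //; first [solve_nz|exact: nz_gs|idtac].
by move=> z [_]; rewrite !all_cat => /and4P[_ _ _ /andP[]].
Qed.

Lemma open_dens3 : open (@dom R 11 true dens3).
Proof.
have op : open (@dom R 11 true (dens_prism ++ [::])) by rewrite cats0; exact: open_dens_prism.
have o0 : open (@dom R 11 true (dens_prism ++ dens_q)).
  exact: (open_dens_q (@rq_free 11 [::]) op).
have re k ds : (k < 3)%N -> ratf (@dom R 11 true (dens_prism ++ ds))
    (fun z => peden (fill true (par z)) (qx (fill true (par z))) k).
  by move=> k3; apply: r_peden => //; solve_nz.
have o1 : open (@dom R 11 true (rcons (dens_prism ++ dens_q) (fun x => peden x (qx x) 0))).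
  by apply: (open_dom_rcons o0); exact: re.
have o2 := @open_dom_rcons R 11 true _ (fun x => peden x (qx x) 1) o1
  (re 1%N (rcons dens_q (fun x => peden x (qx x) 0)) isT).
exact: (@open_dom_rcons R 11 true _ (fun x => peden x (qx x) 2) o2 (re 2%N (rcons (rcons dens_q (fun x => peden x (qx x) 0))
   (fun x => peden x (qx x) 1)) isT)).
Qed.

Lemma ratm_sol3 : ratm (@dom R 11 true dens3) (@sol R 11 true bot3).
Proof.
apply: (@ratm_sol R 11 true [::] (@rq_free 11 _)
  [:: (fun x => peden x (qx x) 0); (fun x => peden x (qx x) 1); (fun x => peden x (qx x) 2)])
  => j r j8 j11 r4.
have k3 : (j - 8 < 3)%N by rewrite ltn_subLR.
apply: r_fbot_k => //; try solve_nz.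
move=> z [_]; rewrite !all_cat => /and4P[_ _ _ /and4P[e0 e1 e2 _]].
by case: (j - 8)%N k3 => [|[|[|//]]].
Qed.

Lemma manifold_nine_facets n m (P : labeled_polytope R 4 n m) (V : 'M[R]_(4, 8)) (A : 'M[R]_(4, 9)) :
  conv V = polyhedron A -> (forall i j, inc V A i j = pat facets1 i j) ->
  comb_equiv (conv V) (body P) ->
  smooth_manifold_of_dim (realization_space P) 26 /\ NG P = 25.
Proof.
move=> VA incE ce.
have facE i j : (j < 8)%N -> pat facets1 i j = pat prism_facets i j := @pat_prism _ i j.
have [|] := @manifold_of_solution R 8 facets1 flags1 false bot1 dens1 isT good_check1 facE
  _ (open_dens1 (@ratf_qx_dep R 9)) ratm_sol1 (@incidences_solved1 R) (@solved_incidences1 R) n m P V A VA incE ce.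
  move=> x; rewrite /dens1 all_cat => /andP[dp /andP[_ dq]]; exact: dens_base.
rewrite card_freeset1 => sm ->; split=> //.
by rewrite card_ord_pairs unlock.
Qed.

Lemma manifold_ten_facets n m (P : labeled_polytope R 4 n m) (V : 'M[R]_(4, 8)) (A : 'M[R]_(4, 10)) :
  conv V = polyhedron A -> (forall i j, inc V A i j = pat facets2 i j) ->
  comb_equiv (conv V) (body P) ->
  smooth_manifold_of_dim (realization_space P) 27 /\ NG P = 26.
Proof.
move=> VA incE ce.
have facE i j : (j < 8)%N -> pat facets2 i j = pat prism_facets i j := @pat_prism _ i j.
have [|] := @manifold_of_solution R 9 facets2 flags2 true bot2 dens2 isT good_check2 facE
  _ open_dens2 ratm_sol2 (@incidences_solved2 R) (@solved_incidences2 R) n m P V A VA incE ce.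
  move=> x; rewrite /dens2 all_rcons /dens1 all_cat => /and3P[_ dp /andP[_ dq]]; exact: dens_base.
rewrite card_freeset2 => sm ->; split=> //.
by rewrite card_ord_pairs unlock.
Qed.

Lemma manifold_eleven_facets n m (P : labeled_polytope R 4 n m) (V : 'M[R]_(4, 8)) (A : 'M[R]_(4, 11)) :
  conv V = polyhedron A -> (forall i j, inc V A i j = pat facets3 i j) ->
  comb_equiv (conv V) (body P) ->
  smooth_manifold_of_dim (realization_space P) 27 /\ NG P = 26.
Proof.
move=> VA incE ce.
have facE i j : (j < 8)%N -> pat facets3 i j = pat prism_facets i j := @pat_prism _ i j.
have [|] := @manifold_of_solution R 10 facets3 flags3 true bot3 dens3 isT good_check3 facE
  _ open_dens3 ratm_sol3 (@incidences_solved3 R) (@solved_incidences3 R) n m P V A VA incE ce.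
  move=> x; rewrite /dens3 !all_cat => /and3P[dp dq _]; exact: dens_base.
rewrite card_freeset3 => sm ->; split=> //.
by rewrite card_ord_pairs unlock.
Qed.

End Results.

(** * Affine changes of coordinates *)

Section AffinePreimage.
Context {R : realType} {d : nat}.
Implicit Types (c : 'cV[R]_d) (N : 'M[R]_d) (S X F : set 'cV[R]_d).

(** Preimages under an affine map: for invertible [N] this is the image under
    the inverse map, for which faces and hulls transform without choices. *)
Definition pre c N S : set 'cV[R]_d := [set z | S (c + N *m z)].

Lemma preK c N S : N \in unitmx -> pre (- (invmx N *m c)) (invmx N) (pre c N S) = S.
Proof.
move=> uN; apply/seteqP; split=> x; rewrite /pre /= mulmxDr mulmxN mulKVmx // mulKVmx //;
  by rewrite addNKr.
Qed.

Lemma preK' c N S : N \in unitmx -> pre c N (pre (- (invmx N *m c)) (invmx N) S) = S.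
Proof.
move=> uN; apply/seteqP; split=> x; rewrite /pre /= mulmxDr mulKmx // addKr //.
Qed.

Lemma pre_sub c N S X : S `<=` X -> pre c N S `<=` pre c N X.
Proof. by move=> SX z; apply: SX. Qed.

Lemma pre_defines_face c N X F a b : defines_face X F a b ->
  defines_face (pre c N X) (pre c N F) (N^T *m a) (b - dot a c).
Proof.
move=> [Xb ->].
have E z : ((N^T *m a)^T *m z) 0 0 = dot a (c + N *m z) - dot a c.
  by rewrite trmx_mul trmxK -mulmxA -/(dot a _) dotDr addrC addKr.
split=> [z Xz|]; first by rewrite E lerB //; exact: Xb.
apply/seteqP; split=> z /=; rewrite E => -[Xz zb]; split=> //.
  by rewrite -/(dot _ _) in zb; rewrite zb.
by apply: (addIr (- dot a c)).
Qed.

Lemma pre_face c N X F : is_face X F -> is_face (pre c N X) (pre c N F).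
Proof. by move=> [a [b /pre_defines_face H]]; exists (N^T *m a), (b - dot a c). Qed.

Lemma pre_convex c N S : @convex_set R 'cV[R]_d S -> @convex_set R 'cV[R]_d (pre c N S).
Proof.
move=> /convex_setP cS; apply/convex_setP => t x y t0 t1 Sx Sy; rewrite /pre /=.
have -> : c + N *m (t *: x + (1 - t) *: y) = t *: (c + N *m x) + (1 - t) *: (c + N *m y).
  rewrite mulmxDr -!scalemxAr !scalerDr addrACA -scalerDl subrKC.
  by rewrite scale1r.
exact: cS.
Qed.

Lemma pre_conv_hull c N S : N \in unitmx -> pre c N (conv_hull S) = conv_hull (pre c N S).
Proof.
move=> uN; apply/seteqP; split; last first.
  apply: conv_hull_sub; first exact/pre_convex/conv_hull_convex.
  by apply: pre_sub; exact: sub_conv_hull.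
rewrite -[X in _ `<=` X](preK' c _ uN); apply: pre_sub.
apply: conv_hull_sub; first exact/pre_convex/conv_hull_convex.
rewrite -[X in X `<=` _](preK c S uN); apply: pre_sub; exact: sub_conv_hull.
Qed.

Lemma pre_aff_hull_sub c N S : N \in unitmx ->
  aff_hull (pre c N S) `<=` pre c N (aff_hull S).
Proof.
move=> uN _ [k [V [w [VS w1 ->]]]].
exists k, (\matrix_(r, i) (c r 0 + (N *m V) r i)), w; split=> //.
  move=> i; have := VS i; rewrite /pre /=; congr (S _).
  apply/matrixP => r j; rewrite !mxE !ord1; congr (_ + _).
  by apply: eq_bigr => l _; rewrite !mxE.
rewrite mulmxA; apply/matrixP => r j; rewrite !ord1 mxE [RHS]mxE.
rewrite -[c r 0]mulr1 -w1 mulr_sumr [X in _ + X]mxE -big_split /=.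
by apply: eq_bigr => i _; rewrite mxE mulrDl.
Qed.

Lemma pre_aff_hull c N S : N \in unitmx -> aff_hull (pre c N S) = pre c N (aff_hull S).
Proof.
move=> uN; apply/seteqP; split; first exact: pre_aff_hull_sub.
rewrite -[X in _ `<=` X](preK' c _ uN); apply: pre_sub.
rewrite -{1}[S](preK c S uN); apply: pre_aff_hull_sub.
by rewrite unitmx_inv.
Qed.

Lemma pre_has_dim c N S k : N \in unitmx -> has_dim S k -> has_dim (pre c N S) k.
Proof.
move=> uN [p [B [rB SE]]]; exists (invmx N *m (p - c)), (invmx N *m B); split.
  by rewrite -[RHS]rB eqmxMfull // row_full_unit unitmx_inv.
rewrite pre_aff_hull // SE; apply/seteqP; split=> z /=.
  move=> [t _ E]; exists t => //; rewrite -mulmxA -mulmxDr addrAC E addrC addKr.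
  by rewrite mulKmx.
move=> [t _ <-]; exists t => //.
by rewrite -mulmxA -mulmxDr mulKVmx // addrAC subrKC.
Qed.

Lemma pre_facet c N X F : N \in unitmx -> is_facet X F -> is_facet (pre c N X) (pre c N F).
Proof.
move=> uN [fF [k [dX dF]]]; split; first exact: pre_face.
by exists k; split; exact: pre_has_dim.
Qed.

Lemma pre_simplex c N k S : N \in unitmx -> is_simplex k S -> is_simplex k (pre c N S).
Proof.
move=> uN [[V ->] dS]; split; last exact: pre_has_dim.
exists (\matrix_(r, i) (invmx N *m (col i V - c)) r 0).
rewrite /Defs.conv pre_conv_hull //; congr conv_hull; apply/seteqP; split=> z.
  move=> [i _ E]; exists i => //; apply/matrixP => r j; rewrite !ord1 !mxE -[RHS]/(z r 0).
  have -> : z = invmx N *m (col i V - c) by rewrite E addrC addKr mulKmx.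
  by rewrite mxE.
move=> [i _ <-]; exists i => //.
suff -> : col i (\matrix_(r, i) (invmx N *m (col i V - c)) r 0) = invmx N *m (col i V - c).
  by rewrite mulKVmx // subrKC.
by apply/matrixP => r j; rewrite !ord1 !mxE.
Qed.

Lemma pre_comb_equiv c N X : N \in unitmx -> comb_equiv X (pre c N X).
Proof.
move=> uN; exists (pre c N); split.
  split.
  - by move=> F; exact: pre_face.
  - move=> F G _ _ E; by rewrite -(preK c F uN) E preK.
  - move=> G fG; exists (pre (- (invmx N *m c)) (invmx N) G); last exact: preK'.
    by have := pre_face (- (invmx N *m c)) (invmx N) fG; rewrite preK.
move=> F G _ _; split=> [FG|]; last exact: pre_sub.
by rewrite -(preK c F uN) -(preK c G uN); exact: pre_sub.
Qed.

End AffinePreimage.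

Lemma comb_equiv_trans (R : realType) d1 d2 d3 (P : set 'cV[R]_d1) (Q : set 'cV[R]_d2)
  (T : set 'cV[R]_d3) : comb_equiv P Q -> comb_equiv Q T -> comb_equiv P T.
Proof.
by move=> [f isof] [g isog]; exists (g \o f); exact: face_lattice_iso_comp isof isog.
Qed.

(** * Facet functionals and simplex facets *)

Section FacetFunctionals.
Context {R : realType} {d n m : nat} (V : 'M[R]_(d.+1, n)) (A : 'M[R]_(d.+1, m)).
Hypothesis VA : conv V = polyhedron A.
Hypothesis good : good_pattern d.+1 (inc V A).

(** A functional that defines a facet is constant on its affine hull, a
    hyperplane that misses the origin, so it is a multiple of the column of [A];
    the factor is positive because the origin satisfies the inequality strictly. *)
Lemma facet_functional j a b : defines_face (conv V) (Fc V A [set j]%SET) a b ->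
  a = b *: col j A /\ 0 < b.
Proof.
move=> [ab FE].
have [vs [js [F jd]]] := gp_flag_facet good j.
have F0 k l : (k < d.+1)%N -> (l <= k)%N -> dot (col (js k) A) (col (vs l) V) = 1.
  by move=> kd lk; have [F1 _] := F k kd; apply/eqP/F1.
have F1 k : (k < d.+1)%N -> dot (col (js k) A) (col (vs k.+1) V) != 1.
  by move=> kd; have [_] := F k kd.
have hull : aff_hull (Fc V A [set j]%SET) = [set y | dot (col j A) y = 1].
  rewrite -jd; apply: (flag_facet_hull F0 F1) => [l ld|y [_ /(_ (js d))]].
    by apply/Fc_col => k; rewrite inE => /eqP ->; apply/eqP/F0.
  by rewrite inE /= eqxx => ->.
have aF x1 : dot (col j A) x1 = 1 -> dot a x1 = b.
  move=> jy; apply: (@aff_hull_const _ _ (Fc V A [set j]%SET)); last by rewrite hull.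
  by move=> x; rewrite FE => -[].
have x0j : dot (col j A) (col (vs 0%N) V) = 1 by rewrite -jd F0.
set x0 := col (vs 0%N) V in x0j.
have aE x : dot a x = b * dot (col j A) x.
  have := aF (x0 + x - dot (col j A) x *: x0).
  rewrite !dotBr !dotDr !dotZr x0j mulr1 addrK (aF _ x0j) => /(_ erefl).
  by move=> E; rewrite -[LHS](addKr b) -[b + _](subrK (dot (col j A) x * b)) E; ring.
have aA : a = b *: col j A.
  apply/matrixP => r c; rewrite ord1.
  have := aE (delta_mx r 0); rewrite /dot -!colE.
  by rewrite ![(col _ _) 0 0]mxE !mxE => ->.
split=> //.
have V0 : conv V 0 by rewrite VA polyhedronE => k; rewrite dot0r ler01.
have := ab 0 V0; rewrite -/(dot _ _) dot0r le_eqVlt => /orP[/eqP b0|//].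
have : Fc V A [set j]%SET 0.
  by rewrite FE; split=> //; rewrite -/(dot _ _) dot0r.
by move=> [_ /(_ j)]; rewrite inE eqxx dot0r => /(_ isT)/eqP; rewrite eq_sym oner_eq0.
Qed.

(** Some point has a nonzero weight in a representation of the vertex, and then
    it lies on the face as well. *)
Lemma vertex_of_conv d' k (W : 'M[R]_(d', k)) v : is_face (conv W) [set v] ->
  exists l, v = col l W.
Proof.
move=> [a [b [ab FE]]].
have [Wv av] : conv W v /\ dot a v = b by have : [set v] v by []; rewrite FE.
have [w [w0 w1 vE]] := (convP _ _).1 Wv.
have [l wl] : exists l, w l 0 != 0.
  apply: contrapT => /forallNP H; have : \sum_i w i 0 = 0.
    by apply: big1 => i _; apply/eqP/negPn/negP/H.
  by rewrite w1 => /eqP; rewrite oner_eq0.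
exists l; have : [set v] (col l W); last by [].
rewrite FE; split; first exact: conv_col.
move: av; rewrite vE dot_mulmx -[b]mul1r -{1}w1 mulr_suml => /eqP.
rewrite eq_sym -subr_eq0 -sumrB; under eq_bigr do rewrite -mulrBr.
have ge0 i : 0 <= w i 0 * (b - dot a (col i W)).
  by rewrite mulr_ge0 // subr_ge0; apply: ab; exact: conv_col.
rewrite psumr_eq0 => [/allP/(_ l (mem_index_enum _))|i _]; last exact: ge0.
by rewrite /= mulf_eq0 (negbTE wl) /= subr_eq0 eq_sym mul1r => /eqP.
Qed.

(** The vertices of the polytope on a face are vertices of the face, and a
    simplex spanned by [k.+1] points has at most as many. *)
Lemma simplex_facet_card j k : is_simplex k (Fc V A [set j]%SET) ->
  (#|[set i | inc V A i j]%SET| <= d.+1)%N.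
Proof.
move=> [[W FW] dF].
have kd := has_dim_uniq dF (pattern_facet_dim good j); subst k.
have /choice[l lP] : forall i, exists l : 'I_d.+1, inc V A i j -> col i V = col l W.
  move=> i; have [ij|nij] := pselect (inc V A i j); last by exists ord0.
  have [|l lE] := @vertex_of_conv _ _ W (col i V); last by exists l.
  rewrite -FW; have [a [b [ab FE]]] := pattern_vertex VA good i.
  exists a, b; split=> [x [Vx _]|]; first exact: ab.
  apply/seteqP; split=> [_ ->|x [[Vx _] xb]]; last by rewrite FE.
  have : [set col i V] (col i V) by []; rewrite {1}FE => -[Vi ai]; split=> //.
  by apply/Fc_col => k; rewrite inE => /eqP ->.
rewrite -[X in (_ <= X)%N]card_ord; apply: (@leq_card_in _ _ l) => i i'; rewrite !inE.
move=> /lP ij /lP i'j ll; have [_ inj _] := pattern_vert_bij VA good.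
by apply: inj; rewrite ?inE //= ij i'j ll.
Qed.

End FacetFunctionals.

(** * Explicit polytopes *)

Section Explicit.
Context {R : realType}.
Implicit Types (h v : seq R) (hs vs : seq (seq R)) (u : nat -> R) (z : 'cV[R]_4).

(** Points are given by four coordinates and affine functionals by lists [h] of
    coefficients, the constant one first. Vertex and facet matrices are taken
    relative to a fixed point [centre], so that a functional that is positive
    there can be scaled to the form [1 - a x]. *)
Definition haff h u : R := h`_0 + h`_1 * u 0%N + h`_2 * u 1%N + h`_3 * u 2%N + h`_4 * u 3%N.

Definition centre (r : nat) : R := [:: 1/4; 1/4; 1/4; 3/8]`_r.
Definition acoord z (r : nat) : R := centre r + z (inord r) 0.

Definition vmx n vs : 'M[R]_(4, n) := \matrix_(r, i) ((nth [::] vs i)`_r - centre r).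
Definition amx m hs : 'M[R]_(4, m) :=
  \matrix_(r, j) (- (nth [::] hs j)`_r.+1 / haff (nth [::] hs j) centre).

Lemma eq_haff h u u' : (forall r, (r < 4)%N -> u r = u' r) -> haff h u = haff h u'.
Proof. by move=> uu'; rewrite /haff !uu'. Qed.

Lemma col4_eq z z' : (forall r, (r < 4)%N -> z (inord r) 0 = z' (inord r) 0) -> z = z'.
Proof. by move=> H; apply/matrixP => r c; rewrite ord1; have := H r (ltn_ord r); rewrite inord_val. Qed.

Lemma sum4 (f : 'I_4 -> R) :
  \sum_r f r = f (inord 0) + f (inord 1) + f (inord 2) + f (inord 3).
Proof.
rewrite !big_ord_recr big_ord0 /= add0r.
by congr (_ + _ + _ + _); congr (f _); apply/val_inj; rewrite /= inordK.
Qed.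

Lemma acoord_col n vs (i : 'I_n) r : (r < 4)%N -> acoord (col i (vmx n vs)) r = (nth [::] vs i)`_r.
Proof. by move=> r4; rewrite /acoord !mxE inordK // subrKC. Qed.

Lemma dot_amx m hs (j : 'I_m) z : haff (nth [::] hs j) centre != 0 ->
  dot (col j (amx m hs)) z =
  1 - haff (nth [::] hs j) (acoord z) / haff (nth [::] hs j) centre.
Proof.
move=> h0; rewrite dotE sum4 !mxE !inordK //.
set h := nth _ _ _ in h0 *.
rewrite -[in RHS](divff h0) -mulrBl ![_ / haff h centre * _]mulrAC -!mulrDl; congr (_ / _).
by rewrite /haff /acoord; ring.
Qed.

Section Duality.
Variables (n m : nat) (vs hs : seq (seq R)).
Hypothesis hs0 : forall j, (j < m)%N -> 0 < haff (nth [::] hs j) centre.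

Lemma dot_amx_eq1 (j : 'I_m) z :
  (dot (col j (amx m hs)) z == 1) = (haff (nth [::] hs j) (acoord z) == 0).
Proof.
have h0 := hs0 (ltn_ord j).
rewrite dot_amx; last by rewrite gt_eqF.
by rewrite -subr_eq0 addrAC subrr add0r oppr_eq0 mulf_eq0 invr_eq0 (gt_eqF h0) orbF.
Qed.

Lemma dot_amx_lt1 (j : 'I_m) z :
  (dot (col j (amx m hs)) z < 1) = (0 < haff (nth [::] hs j) (acoord z)).
Proof.
have h0 := hs0 (ltn_ord j).
rewrite dot_amx; last by rewrite gt_eqF.
by rewrite ltrBlDr -ltrBlDl subrr pmulr_lgt0 ?invr_gt0.
Qed.

Lemma dot_amx_le1 (j : 'I_m) z :
  (dot (col j (amx m hs)) z <= 1) = (0 <= haff (nth [::] hs j) (acoord z)).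
Proof. by rewrite !le_eqVlt dot_amx_eq1 dot_amx_lt1 [in RHS]eq_sym. Qed.

Lemma polyhedron_amx z :
  polyhedron (amx m hs) z <-> forall j, (j < m)%N -> 0 <= haff (nth [::] hs j) (acoord z).
Proof.
rewrite polyhedronE; split=> H j; last by rewrite dot_amx_le1; exact: H.
by move=> jm; have := H (Ordinal jm); rewrite dot_amx_le1.
Qed.

Lemma inc_amx (i : 'I_n) (j : 'I_m) :
  inc (vmx n vs) (amx m hs) i j = (haff (nth [::] hs j) (fun r => (nth [::] vs i)`_r) == 0).
Proof.
rewrite /inc dot_amx_eq1; congr (_ == 0); apply: eq_haff => r r4; exact: acoord_col.
Qed.

Lemma inc_pat fac :
  (forall i j, (i < n)%N -> (j < m)%N ->
    let val := haff (nth [::] hs j) (fun r => (nth [::] vs i)`_r) in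
    if pat fac i j then val = 0 else 0 < val) ->
  forall (i : 'I_n) (j : 'I_m), inc (vmx n vs) (amx m hs) i j = pat fac i j.
Proof.
move=> H i j; rewrite inc_amx; have := H i j (ltn_ord i) (ltn_ord j) => /=.
by case: pat => [->|/gt_eqF //]; rewrite eqxx.
Qed.

(** One inclusion is checked on the vertices; for the other one, weights have to
    be given for a point on which all functionals are nonnegative. *)
Lemma conv_amx :
  (forall i j, (i < n)%N -> (j < m)%N ->
    0 <= haff (nth [::] hs j) (fun r => (nth [::] vs i)`_r)) ->
  (forall u, (forall j, (j < m)%N -> 0 <= haff (nth [::] hs j) u) ->
    exists w : seq R, [/\ forall i, (i < n)%N -> 0 <= w`_i, \sum_(i < n) w`_i = 1 &
      forall r, (r < 4)%N -> u r = \sum_(i < n) w`_i * (nth [::] vs i)`_r]) ->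
  conv (vmx n vs) = polyhedron (amx m hs).
Proof.
move=> vh hw; apply/seteqP; split=> [|z /polyhedron_amx/hw[w [w0 w1 wE]]].
  apply: conv_hull_sub; first exact: polyhedron_convex.
  move=> _ [i _ <-]; apply/polyhedron_amx => j jm.
  by rewrite (eq_haff _ (acoord_col _ i)) vh.
apply/convP; exists (\col_i w`_i); split=> [i||]; first by rewrite mxE w0.
  by rewrite -[RHS]w1; apply: eq_bigr => i _; rewrite mxE.
apply: col4_eq => r r4; rewrite mxE.
have -> : z (inord r) 0 = \sum_(i < n) w`_i * (nth [::] vs i)`_r - centre r * (\sum_(i < n) w`_i).
  by rewrite w1 mulr1 -wE // /acoord addrC addKr.
rewrite mulr_sumr -sumrB; apply: eq_bigr => i _; rewrite !mxE inordK //; ring.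
Qed.

End Duality.

(** ** The pyramid and its new point *)

(** The pyramid in the coordinates where the apex is the origin and where the
    prism is the product of the standard triangle and the unit interval: a point is
    in it if the first three coordinates are nonnegative with sum at most 1 and
    the fourth one lies between 0 and this sum. *)
Definition facetsY : seq (seq nat) :=
  [:: [:: 1; 2; 5; 6; 3]; [:: 0; 2; 4; 6; 3]; [:: 0; 1; 4; 5; 3]; [:: 0; 1; 2; 3];
      [:: 4; 5; 6; 3]; [:: 0; 1; 2; 4; 5; 6]]%N.
Definition vertsY : seq (seq R) :=
  [:: [:: 1; 0; 0; 1]; [:: 0; 1; 0; 1]; [:: 0; 0; 1; 1]; [:: 0; 0; 0; 0];
      [:: 1; 0; 0; 0]; [:: 0; 1; 0; 0]; [:: 0; 0; 1; 0]].
Definition funsY : seq (seq R) :=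
  [:: [:: 0; 1; 0; 0; 0]; [:: 0; 0; 1; 0; 0]; [:: 0; 0; 0; 1; 0];
      [:: 0; 1; 1; 1; -1]; [:: 0; 0; 0; 0; 1]; [:: 1; -1; -1; -1; 0]].

Lemma ratio (S y : R) : 0 <= y -> y <= S -> exists e, [/\ 0 <= e, e <= 1 & y = e * S].
Proof.
move=> y0 yS; have [S0|S0] := eqVneq S 0.
  by exists 0; split; rewrite ?ler01 // mul0r; apply/eqP; rewrite eq_le y0 -S0 yS.
have Sp : 0 < S by rewrite lt_neqAle eq_sym S0 (le_trans y0).
by exists (y / S); rewrite divr_ge0 ?(ltW Sp) // ler_pdivrMr // mul1r divfK.
Qed.

Lemma funsY_centre j : (j < 6)%N -> 0 < haff (nth [::] funsY j) centre.
Proof.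
by case: j => [|[|[|[|[|[|//]]]]]] _; rewrite /haff /centre /=; lra.
Qed.

Local Ltac sumE := rewrite !big_ord_recr big_ord0 /=.

Lemma conv_Y : conv (vmx 7 vertsY) = polyhedron (amx 6 funsY).
Proof.
apply: (conv_amx funsY_centre).
  move=> [|[|[|[|[|[|[|//]]]]]]] [|[|[|[|[|[|//]]]]]] _ _; rewrite /haff /=; lra.
move=> u uF.
have f0 := uF 0%N isT; have f1 := uF 1%N isT; have f2 := uF 2%N isT.
have f3 := uF 3%N isT; have f4 := uF 4%N isT; have f5 := uF 5%N isT.
rewrite /haff /= in f0 f1 f2 f3 f4 f5.
have [||e [e0 e1 eE]] := @ratio (u 0%N + u 1%N + u 2%N) (u 3%N); try lra.
exists [:: u 0%N * e; u 1%N * e; u 2%N * e; 1 - u 0%N - u 1%N - u 2%N;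
  u 0%N * (1 - e); u 1%N * (1 - e); u 2%N * (1 - e)].
split.
- by move=> [|[|[|[|[|[|[|//]]]]]]] _ /=; try lra; apply: mulr_ge0; lra.
- by sumE; ring.
- by move=> [|[|[|[|//]]]] _; sumE; rewrite ?eE; ring.
Qed.

Lemma inc_Y i j : inc (vmx 7 vertsY) (amx 6 funsY) i j = pat facetsY i j.
Proof.
apply: (inc_pat funsY_centre); move=> {j i}.
move=> [|[|[|[|[|[|[|//]]]]]]] [|[|[|[|[|[|//]]]]]] _ _; rewrite /haff /pat /=; first [ring|lra].
Qed.

Section NewPoint.
Variables q0 q1 q2 q3 s D : R.

(** The hull of the pyramid and a new point [q]. A facet of it is a facet [h] of
    the pyramid with [h q >= 0] or spanned by [q] and the ridge where two facets
    [h] and [h'] of the pyramid with [h q > 0 > h' q] meet; in this case it is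
    given by the combination of [h] and [h'] that vanishes at [q]. In
    [funs_prism] the second functional [h'] is always the base, whose value at
    [q] is [- s], and [D] is the value of the upper simplex facet. The lower
    simplex facet has the value [q3], the sign of which is the type. *)
Definition vertsZ : seq (seq R) := rcons vertsY [:: q0; q1; q2; q3].
Definition funs_prism : seq (seq R) :=
  [:: [:: 0; 1; 0; 0; 0]; [:: 0; 0; 1; 0; 0]; [:: 0; 0; 0; 1; 0];
      [:: q0; s - q0; - q0; - q0; 0]; [:: q1; - q1; s - q1; - q1; 0];
      [:: q2; - q2; - q2; s - q2; 0];
      [:: 0; 1; 1; 1; -1]; [:: D; s - D; s - D; s - D; - s]].
Definition funs1 := funs_prism ++ [:: [:: 0; 0; 0; 0; 1]].
Definition funs2 := funs_prism ++ [:: [:: 0; 0; 0; 0; 1]; [:: q3; - q3; - q3; - q3; s]].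
Definition funs3 := funs_prism ++ [:: [:: 0; - q3; 0; 0; q0]; [:: 0; 0; - q3; 0; q1];
  [:: 0; 0; 0; - q3; q2]].

Hypotheses (sE : s = q0 + q1 + q2 - 1) (DE : D = q0 + q1 + q2 - q3).
Hypotheses (q0p : 0 < q0) (q1p : 0 < q1) (q2p : 0 < q2) (sp : 0 < s) (Dp : 0 < D).

(** If [u - tau q] lies in the pyramid scaled by [1 - tau], it is a combination
    of the apex and the prism with total weight [1 - tau]; the weight of each
    vertex of the triangle is split between its two copies in the ratio [e]. *)
Lemma cone_weights (u : nat -> R) tau :
  0 <= tau -> 0 <= u 0%N - tau * q0 -> 0 <= u 1%N - tau * q1 -> 0 <= u 2%N - tau * q2 ->
  0 <= u 3%N - tau * q3 -> u 3%N - tau * q3 <= u 0%N + u 1%N + u 2%N - tau * (q0 + q1 + q2) ->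
  0 <= 1 - (u 0%N + u 1%N + u 2%N) + tau * s ->
  exists w : seq R, [/\ forall i, (i < 8)%N -> 0 <= w`_i, \sum_(i < 8) w`_i = 1 &
      forall r, (r < 4)%N -> u r = \sum_(i < 8) w`_i * (nth [::] vertsZ i)`_r].
Proof.
move=> t0 y0 y1 y2 y3 yS p0.
have yS' : u 3%N - tau * q3 <=
    (u 0%N - tau * q0) + (u 1%N - tau * q1) + (u 2%N - tau * q2) by lra.
have [e [e0 e1 eE]] := ratio y3 yS'.
set x0 := u 0%N - tau * q0 in y0 eE *; set x1 := u 1%N - tau * q1 in y1 eE *.
set x2 := u 2%N - tau * q2 in y2 eE *.
have u0 : u 0%N = x0 + tau * q0 by rewrite subrK.
have u1 : u 1%N = x1 + tau * q1 by rewrite subrK.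
have u2 : u 2%N = x2 + tau * q2 by rewrite subrK.
have u3 : u 3%N = e * (x0 + x1 + x2) + tau * q3 by rewrite -eE subrK.
exists [:: x0 * e; x1 * e; x2 * e; 1 - (u 0%N + u 1%N + u 2%N) + tau * s;
  x0 * (1 - e); x1 * (1 - e); x2 * (1 - e); tau].
split.
- move=> [|[|[|[|[|[|[|[|//]]]]]]]] _ //=; apply: mulr_ge0 => //; lra.
- by sumE; rewrite u0 u1 u2 sE; ring.
- by move=> [|[|[|[|//]]]] _; sumE; rewrite ?u0 ?u1 ?u2 ?u3; ring.
Qed.

(** A point beyond the base is moved away from [q] until it lies on the base;
    for other points [tau] is 0. *)
Lemma prism_weights (u : nat -> R) :
  0 <= u 0%N -> 0 <= u 1%N -> 0 <= u 2%N ->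
  (forall j, (j < 8)%N -> 0 <= haff (nth [::] funs_prism j) u) ->
  exists tau, [/\ 0 <= tau, 0 <= u 0%N - tau * q0, 0 <= u 1%N - tau * q1, 0 <= u 2%N - tau * q2 &
   [/\ 
  u 3%N - tau * q3 <= u 0%N + u 1%N + u 2%N - tau * (q0 + q1 + q2),
  0 <= 1 - (u 0%N + u 1%N + u 2%N) + tau * s &
  tau = 0 \/ s * tau = u 0%N + u 1%N + u 2%N - 1]].
Proof.
move=> a0 a1 a2 uF.
have f3 := uF 3%N isT; have f4 := uF 4%N isT; have f5 := uF 5%N isT.
have f6 := uF 6%N isT; have f7 := uF 7%N isT; clear uF.
rewrite /haff /= in f3 f4 f5 f6 f7.
have [pi0|pi0] := leP (u 0%N + u 1%N + u 2%N) 1.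
  by exists 0; rewrite !mul0r; split; try lra; split; [lra|lra|left].
exists ((u 0%N + u 1%N + u 2%N - 1) / s); set tau := _ / s.
have st : s * tau = u 0%N + u 1%N + u 2%N - 1.
  by rewrite mulrC divfK // gt_eqF.
have ge0 x : 0 <= s * x -> 0 <= x by rewrite pmulr_rge0.
split.
- by rewrite divr_ge0 ?ltW // subr_gt0.
- by apply: ge0; rewrite mulrBr mulrA st; lra.
- by apply: ge0; rewrite mulrBr mulrA st; lra.
- by apply: ge0; rewrite mulrBr mulrA st; lra.
- split; [|by rewrite mulrC st; lra|by right].
  rewrite -subr_ge0; apply: ge0.
  have -> : s * (u 0%N + u 1%N + u 2%N - tau * (q0 + q1 + q2) - (u 3%N - tau * q3)) =
    s * (u 0%N + u 1%N + u 2%N - u 3%N) - (s * tau) * D by rewrite DE; ring.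
  rewrite st; lra.
Qed.

Lemma funs_prism_centre j : (j < 8)%N -> 0 < haff (nth [::] funs_prism j) centre.
Proof.
by case: j => [|[|[|[|[|[|[|[|//]]]]]]]] _; rewrite /haff /centre /=;
  move: q0p q1p q2p sp Dp => *; lra.
Qed.

Lemma funs_prism_verts i j : (i < 8)%N -> (j < 8)%N ->
  if pat prism_facets i j then haff (nth [::] funs_prism j) (fun r => (nth [::] vertsZ i)`_r) = 0
  else 0 < haff (nth [::] funs_prism j) (fun r => (nth [::] vertsZ i)`_r).
Proof.
by case: i => [|[|[|[|[|[|[|[|//]]]]]]]] _; case: j => [|[|[|[|[|[|[|[|//]]]]]]]] _;
  rewrite /haff /pat /=; first [ring|rewrite sE; ring|rewrite DE sE; ring|
    move: q0p q1p q2p sp Dp sE DE => *; lra].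
Qed.

Local Ltac bottom := rewrite /haff /centre /pat /=; first [ring|rewrite sE; ring|
    move: q0p q1p q2p sp Dp sE DE => *; lra].

Lemma funs_cat fs j : (j < 8)%N -> nth [::] (funs_prism ++ fs) j = nth [::] funs_prism j.
Proof. by move=> j8; rewrite nth_cat j8. Qed.

(** The weights found for the base fail only if the remaining point is below the
    lower simplex facet. Whether this happens depends on the type; where it does,
    a larger [tau] has to be supplied. *)
Lemma conv_Z m hs : (forall j, (j < m)%N -> 0 < haff (nth [::] hs j) centre) ->
  (forall i j, (i < 8)%N -> (j < m)%N ->
    0 <= haff (nth [::] hs j) (fun r => (nth [::] vertsZ i)`_r)) ->
  (8 <= m)%N -> (forall j, (j < 8)%N -> nth [::] hs j = nth [::] funs_prism j) ->
  (forall u tau, (forall j, (j < m)%N -> 0 <= haff (nth [::] hs j) u) -> 0 <= tau ->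
    tau = 0 \/ s * tau = u 0%N + u 1%N + u 2%N - 1 ->
    0 <= u 0%N - tau * q0 -> 0 <= u 1%N - tau * q1 -> 0 <= u 2%N - tau * q2 ->
    u 3%N - tau * q3 < 0 -> exists2 tau', tau <= tau' &
    [/\ 0 <= u 0%N - tau' * q0, 0 <= u 1%N - tau' * q1, 0 <= u 2%N - tau' * q2 &
        u 3%N = tau' * q3]) ->
  conv (vmx 8 vertsZ) = polyhedron (amx m hs).
Proof.
move=> h0 hv m8 hs8 low; apply: conv_amx => // u uF.
have f j : (j < 8)%N -> 0 <= haff (nth [::] funs_prism j) u.
  by move=> j8; rewrite -hs8 //; apply: uF; exact: leq_trans m8.
have := f 0%N isT; have := f 1%N isT; have := f 2%N isT.
rewrite /haff /= => f2 f1 f0.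
have [||||tau [t0 y0 y1 y2 [yS p0 tE]]] := @prism_weights u; try lra; first exact: f.
have [y3|y3] := leP 0 (u 3%N - tau * q3); first exact: (@cone_weights u tau).
have [tau' tt' [z0 z1 z2 z3]] := low u tau uF t0 tE y0 y1 y2 y3.
apply: (@cone_weights u tau') => //; first lra; first by rewrite z3 subrr.
- by rewrite z3 subrr; lra.
- apply: (le_trans p0); rewrite lerD2l mulrC [_ * s]mulrC ler_wpM2l //; exact: ltW.
Qed.

Lemma funs1_verts i j : q3 = 0 -> (i < 8)%N -> (j < 9)%N ->
  let val := haff (nth [::] funs1 j) (fun r => (nth [::] vertsZ i)`_r) in
  if pat facets1 i j then val = 0 else 0 < val.
Proof.
move=> q30 i8; rewrite ltnS leq_eqVlt => /orP[/eqP ->|j8] /=; last first.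
  by rewrite pat_prism // funs_cat //; exact: funs_prism_verts.
by move: i8; case: i => [|[|[|[|[|[|[|[|//]]]]]]]] _; rewrite /haff /pat /=; rewrite ?q30; first [ring|lra].
Qed.

Lemma funs2_verts i j : 0 < q3 -> (i < 8)%N -> (j < 10)%N ->
  let val := haff (nth [::] funs2 j) (fun r => (nth [::] vertsZ i)`_r) in
  if pat facets2 i j then val = 0 else 0 < val.
Proof.
move=> q30 i8 j10; have [j8|j8] := ltnP j 8.
  by rewrite /= pat_prism // funs_cat //; exact: funs_prism_verts.
case: j j8 j10 => [|[|[|[|[|[|[|[|[|[|//]]]]]]]]]] // _ _;
  move: i8; case: i => [|[|[|[|[|[|[|[|//]]]]]]]] _; bottom.
Qed.

Lemma funs3_verts i j : q3 < 0 -> (i < 8)%N -> (j < 11)%N ->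
  let val := haff (nth [::] funs3 j) (fun r => (nth [::] vertsZ i)`_r) in
  if pat facets3 i j then val = 0 else 0 < val.
Proof.
move=> q30 i8 j10; have [j8|j8] := ltnP j 8.
  by rewrite /= pat_prism // funs_cat //; exact: funs_prism_verts.
case: j j8 j10 => [|[|[|[|[|[|[|[|[|[|[|//]]]]]]]]]]] // _ _;
  move: i8; case: i => [|[|[|[|[|[|[|[|//]]]]]]]] _; bottom.
Qed.

Lemma funs_centre m hs : (forall j, (j < 8)%N -> nth [::] hs j = nth [::] funs_prism j) ->
  (forall j, (8 <= j)%N -> (j < m)%N -> 0 < haff (nth [::] hs j) centre) ->
  forall j, (j < m)%N -> 0 < haff (nth [::] hs j) centre.
Proof.
move=> hs8 hsm j jm; have [j8|j8] := ltnP j 8; last exact: hsm.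
by rewrite hs8 //; exact: funs_prism_centre.
Qed.

Lemma funs1_centre j : (j < 9)%N -> 0 < haff (nth [::] funs1 j) centre.
Proof.
apply: funs_centre => {j} [j|j j8]; first exact: funs_cat.
by move: j j8 => [|[|[|[|[|[|[|[|[|//]]]]]]]]] // _ _; bottom.
Qed.

Lemma funs2_centre j : 0 < q3 -> (j < 10)%N -> 0 < haff (nth [::] funs2 j) centre.
Proof.
move=> q30; apply: funs_centre => {j} [j|j j8]; first exact: funs_cat.
by move: j j8 => [|[|[|[|[|[|[|[|[|[|//]]]]]]]]]] // _ _; bottom.
Qed.

Lemma funs3_centre j : q3 < 0 -> (j < 11)%N -> 0 < haff (nth [::] funs3 j) centre.
Proof.
move=> q30; apply: funs_centre => {j} [j|j j8]; first exact: funs_cat.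
by move: j j8 => [|[|[|[|[|[|[|[|[|[|[|//]]]]]]]]]]] // _ _; bottom.
Qed.

Lemma conv_Z1 : q3 = 0 -> conv (vmx 8 vertsZ) = polyhedron (amx 9 funs1).
Proof.
move=> q30; apply: conv_Z => //; first exact: funs1_centre.
- by move=> i j i8 j9; have := funs1_verts q30 i8 j9 => /=; case: pat => [->|/ltW].
- exact: funs_cat.
move=> u tau uF _ _ _ _ _; have := uF 8%N isT; rewrite /haff /= q30; lra.
Qed.

Lemma conv_Z2 : 0 < q3 -> conv (vmx 8 vertsZ) = polyhedron (amx 10 funs2).
Proof.
move=> q30; apply: conv_Z => //; first by move=> j; exact: funs2_centre.
- by move=> i j i8 j9; have := funs2_verts q30 i8 j9 => /=; case: pat => [->|/ltW].
- exact: funs_cat.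
move=> u tau uF _ tE _ _ _.
have := uF 8%N isT; have := uF 9%N isT; rewrite /haff /= => f9 f8 y3; exfalso.
case: tE => [t0|tE]; first by move: y3; rewrite t0; lra.
have : s * (u 3%N - tau * q3) < 0 by rewrite pmulr_rlt0.
by rewrite mulrBr mulrA tE; lra.
Qed.

(** The new point is beyond the lower simplex facet as well, and a point below
    this facet is moved away from [q] until it lies on it. *)
Lemma conv_Z3 : q3 < 0 -> conv (vmx 8 vertsZ) = polyhedron (amx 11 funs3).
Proof.
move=> q30; apply: conv_Z => //; first by move=> j; exact: funs3_centre.
- by move=> i j i8 j9; have := funs3_verts q30 i8 j9 => /=; case: pat => [->|/ltW].
- exact: funs_cat.
move=> u tau uF _ _ _ _ _.
have := uF 8%N isT; have := uF 9%N isT; have := uF 10%N isT.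
rewrite /haff /= => f10 f9 f8 y3; exists (u 3%N / q3).
  rewrite -subr_ge0 -(nmulr_rle0 _ q30) mulrBr mulrCA divff ?lt_eqF // mulr1; lra.
have le0 x : q3 * x <= 0 -> 0 <= x by rewrite nmulr_rle0.
have uq : q3 * (u 3%N / q3) = u 3%N by rewrite mulrCA divff ?mulr1 ?lt_eqF.
by split; [apply: le0; rewrite mulrBr mulrA uq; lra|apply: le0; rewrite mulrBr mulrA uq; lra
 |apply: le0; rewrite mulrBr mulrA uq; lra|rewrite mulrC uq].
Qed.

End NewPoint.

End Explicit.

(** * The pyramid in standard position *)

Definition flagsY : seq (seq nat * seq nat) :=
  [:: ([:: 3; 2; 6; 1; 0], [:: 2; 3; 1; 0]); ([:: 2; 3; 6; 0; 1], [:: 5; 3; 0; 1]);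
      ([:: 1; 3; 5; 0; 2], [:: 5; 3; 0; 2]); ([:: 0; 3; 2; 1; 4], [:: 5; 2; 1; 3]);
      ([:: 6; 3; 5; 4; 0], [:: 5; 1; 0; 4]); ([:: 5; 1; 2; 0; 3], [:: 4; 2; 0; 5]);
      ([:: 4; 3; 0; 2; 1], [:: 5; 4; 2; 1])]%N.

Lemma good_checkY : good_check facetsY 6 5 flagsY. Proof. by vm_compute. Qed.

Section Pyramid.
Context {R : realType}.

Let VY : 'M[R]_(4, 7) := vmx 7 vertsY.
Let AY : 'M[R]_(4, 6) := amx 6 funsY.
Let FY (j : nat) : set 'cV[R]_4 := Fc VY AY [set inord j]%SET.
Let hY (j : nat) (z : 'cV[R]_4) : R := haff (nth [::] funsY j) (acoord z).

Lemma good_Y : good_pattern 4 (inc VY AY).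
Proof.
have -> : inc VY AY = (fun (i : 'I_7) (j : 'I_6) => pat facetsY i j).
  by apply/funext => i; apply/funext => j; rewrite inc_Y.
exact: good_of_check good_checkY.
Qed.

Lemma conv_YP z : conv VY z <-> forall j, (j < 6)%N -> 0 <= hY j z.
Proof. by rewrite conv_Y; exact: (polyhedron_amx (@funsY_centre R)). Qed.

Lemma FY_P j z : (j < 6)%N -> FY j z <-> conv VY z /\ hY j z = 0.
Proof.
move=> j6; have jE : inord j = Ordinal j6 by apply/val_inj; rewrite /= inordK.
rewrite /FY /Fc jE; split=> -[Vz].
  move=> /(_ (Ordinal j6)); rewrite inE eqxx => /(_ isT)/eqP.
  by rewrite (dot_amx_eq1 (@funsY_centre R)) => /eqP.
move=> hj; split=> // k; rewrite inE => /eqP ->; apply/eqP.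
by rewrite (dot_amx_eq1 (@funsY_centre R)); apply/eqP.
Qed.

Lemma FY_inj j k : (j < 6)%N -> (k < 6)%N -> FY j = FY k -> j = k.
Proof.
move=> j6 k6 E; have : inord j = inord k :> 'I_6.
  apply: (gp_facets good_Y) => i; apply/idP/idP => H.
    have : FY j (col i VY) by apply/Fc_col => l; rewrite inE => /eqP ->.
    by rewrite E => /Fc_col; apply; rewrite inE.
  have : FY k (col i VY) by apply/Fc_col => l; rewrite inE => /eqP ->.
  by rewrite -E => /Fc_col; apply; rewrite inE.
by move=> /(congr1 val); rewrite /= !inordK.
Qed.

(** The position of a point relative to a facet is the sign of the functional
    of the facet there. *)
Lemma facet_sign j z a b : (j < 6)%N -> defines_face (conv VY) (FY j) a b ->
  [/\ (dot a z < b) = (0 < hY j z), (dot a z == b) = (hY j z == 0) &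
      (b < dot a z) = (hY j z < 0)].
Proof.
move=> j6 /(facet_functional conv_Y good_Y)[-> b0].
have lt : (dot (b *: col (inord j) AY) z < b) = (0 < hY j z).
  by rewrite dotZl -[X in _ < X]mulr1 ltr_pM2l // (dot_amx_lt1 (@funsY_centre R)) inordK.
have eq : (dot (b *: col (inord j) AY) z == b) = (hY j z == 0).
  rewrite dotZl -[X in _ == X]mulr1 (inj_eq (mulfI (lt0r_neq0 b0))).
  by rewrite (dot_amx_eq1 (@funsY_centre R)) inordK.
by split=> //; rewrite !ltNge !le_eqVlt lt eq [in RHS]eq_sym.
Qed.

(** The pyramid has a symmetry that exchanges the triangles of the prism, and
    hence the two simplex facets. *)
Let flip : 'M[R]_4 := \matrix_(r, k)
  if r == 3%N :> nat then if k == 3%N :> nat then -1 else 1 else (r == k)%:R.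
Let flipj j := (if j == 3 then 4 else if j == 4 then 3 else j)%N.

Lemma acoord_flip z r : (r < 4)%N -> acoord (flip *m z) r =
  if r == 3%N then acoord z 0 + acoord z 1 + acoord z 2 - acoord z 3 else acoord z r.
Proof.
by case: r => [|[|[|[|//]]]] _; rewrite /acoord !mxE sum4 !mxE -!val_eqE /= !inordK //= /centre /=; lra.
Qed.

Lemma flip_unit : flip \in unitmx.
Proof.
have E (z : 'cV[R]_4) : flip *m (flip *m z) = z.
  apply: col4_eq => r r4; apply: (addrI (centre r)).
  rewrite -/(acoord _ _) -[RHS]/(acoord z r) acoord_flip // !acoord_flip //=.
  by case: r r4 => [|[|[|[|//]]]] _ //=; ring.
suff /mulmx1_unit[] : flip *m flip = 1%:M by [].
apply/matrixP => r k; have /(congr1 (fun M : 'cV_4 => M r 0)) := E (delta_mx k 0).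
by rewrite mulmxA -colE !mxE => ->; rewrite andbT.
Qed.

Lemma hY_flip j z : (j < 6)%N -> hY j (flip *m z) = hY (flipj j) z.
Proof.
move=> j6; rewrite /hY /haff !acoord_flip //=.
by case: j j6 => [|[|[|[|[|[|//]]]]]] _ /=; ring.
Qed.

Lemma flipj_lt j : (j < 6)%N -> (flipj j < 6)%N.
Proof. by case: j => [|[|[|[|[|[|//]]]]]]. Qed.

Lemma conv_Y_flip : pre 0 flip (conv VY) = conv VY.
Proof.
suff H z : conv VY z -> conv VY (flip *m z).
  apply/seteqP; split=> z; rewrite /pre /= add0r; last exact: H.
  move=> /conv_YP Hz; apply/conv_YP => j j6.
  have := Hz _ (flipj_lt j6); rewrite hY_flip ?flipj_lt //.
  by case: j j6 => [|[|[|[|[|[|//]]]]]].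
by move=> /conv_YP Hz; apply/conv_YP => j j6; rewrite hY_flip // Hz // flipj_lt.
Qed.

Lemma FY_flip j : (j < 6)%N -> pre 0 flip (FY j) = FY (flipj j).
Proof.
move=> j6; apply/seteqP; split=> z.
  rewrite /pre /= add0r => /(FY_P _ j6)[Vz hz]; apply/(FY_P _ (flipj_lt j6)).
  by split; [rewrite -conv_Y_flip /pre /= add0r|rewrite -hY_flip].
move=> /(FY_P _ (flipj_lt j6))[Vz hz]; rewrite /pre /= add0r; apply/(FY_P _ j6).
by rewrite hY_flip //; split=> //; move: Vz; rewrite -{1}conv_Y_flip /pre /= add0r.
Qed.

(** The prism has six vertices and the square pyramids have five each. *)
Lemma simplex_FY j k : (j < 6)%N -> is_simplex k (FY j) -> j = 3%N \/ j = 4%N.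
Proof.
move=> j6 /(simplex_facet_card conv_Y good_Y).
have -> : [set i | inc VY AY i (inord j)]%SET = [set i : 'I_7 | pat facetsY i j]%SET.
  by apply/setP => i; rewrite !inE inc_Y inordK.
have -> : #|[set i : 'I_7 | pat facetsY i j]%SET| = (\sum_(i < 7) pat facetsY i j)%N.
  by rewrite -sum1_card big_mkcond; apply: eq_bigr => i _; rewrite inE; case: pat.
rewrite !big_ord_recr big_ord0 /=.
by case: j j6 => [|[|[|[|[|[|//]]]]]] _ //= _; [left|right].
Qed.

End Pyramid.

(** * Placing a prism, its pyramid and the new point *)

Section Frame.
Context {R : realType} (Tv : 'M[R]_(4, 3)) (t p : 'cV[R]_4).

(** The coordinates in which the pyramid with apex [p] over the prism with
    triangle [Tv] and direction [t] takes its standard position. *)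
Definition prism_frame : 'M[R]_4 := \matrix_(r, k)
  if k == 3%N :> nat then t r 0 else Tv r (inord k) - p r 0.
Definition prism_origin : 'cV[R]_4 := p + prism_frame *m \col_r centre r.

Definition frame_point (u : nat -> R) : 'cV[R]_4 :=
  p + prism_frame *m \col_r u r.

Lemma frame_acoord z : prism_origin + prism_frame *m z = frame_point (acoord z).
Proof.
rewrite /prism_origin /frame_point -addrA -mulmxDr; congr (p + _ *m _).
by apply: col4_eq => r r4; rewrite !mxE inordK.
Qed.

Lemma frame_pointE u : frame_point u = (1 - u 0%N - u 1%N - u 2%N) *: p +
  (u 0%N *: col (inord 0) Tv + u 1%N *: col (inord 1) Tv + u 2%N *: col (inord 2) Tv) +
  u 3%N *: t.
Proof.
apply/matrixP => r c; rewrite ord1 !mxE sum4 !mxE !inordK //=; ring.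
Qed.

Lemma frame_point_prism u : u 0%N + u 1%N + u 2%N = 1 -> frame_point u =
  u 0%N *: col (inord 0) Tv + u 1%N *: col (inord 1) Tv + u 2%N *: col (inord 2) Tv + u 3%N *: t.
Proof.
move=> us; rewrite frame_pointE (_ : 1 - _ - _ - _ = 0) ?scale0r ?add0r //.
by rewrite -us; ring.
Qed.

Definition acol (u : nat -> R) : 'cV[R]_4 := \col_r (u r - centre r).

Lemma acoord_acol u r : (r < 4)%N -> acoord (acol u) r = u r.
Proof. by move=> r4; rewrite /acoord mxE inordK // subrKC. Qed.

Lemma eq_frame_point u u' : (forall r, (r < 4)%N -> u r = u' r) ->
  frame_point u = frame_point u'.
Proof. by move=> uu'; rewrite !frame_pointE !uu'. Qed.

Variables (T Y B : set 'cV[R]_4).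
Hypotheses (TE : T = conv Tv)
  (BE : B = [set y | exists x c, [/\ T x, 0 <= c, c <= 1 & y = x + c *: t]])
  (dB : has_dim B 3) (pB : ~ aff_hull B p) (YE : Y = conv_hull (B `|` [set p])).

Lemma prism_points y : B y <-> exists u, [/\ 0 <= u 0%N, 0 <= u 1%N, 0 <= u 2%N &
  [/\ u 0%N + u 1%N + u 2%N = 1, 0 <= u 3%N, u 3%N <= 1 & y = frame_point u]].
Proof.
rewrite BE; split=> [[x [c [Tx c0 c1 ->]]]|[u [u0 u1 u2 [us c0 c1 ->]]]].
  move: Tx; rewrite TE => /convP[w [w0 w1 ->]].
  exists (fun r => if r == 3%N then c else w (inord r) 0) => /=; split=> //.
  have s3 (V : zmodType) (f : 'I_3 -> V) : \sum_r f r = f (inord 0) + f (inord 1) + f (inord 2).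
    rewrite !big_ord_recr big_ord0 /= add0r.
    by congr (_ + _ + _); congr (f _); apply/val_inj; rewrite /= inordK.
  have w1' : w (inord 0) 0 + w (inord 1) 0 + w (inord 2) 0 = 1 by rewrite -w1 s3.
  split=> //; rewrite frame_point_prism //= mulmx_sum_colE s3.
  by [].
exists (\sum_(r < 3) u r *: col r Tv), (u 3%N); split=> //.
  rewrite TE; apply/convP; exists (\col_r u r); split=> [r||].
  - by rewrite mxE; case: r => -[|[|[|]]].
  - by rewrite !big_ord_recr big_ord0 /= add0r !mxE.
  - by rewrite mulmx_sum_colE; apply: eq_bigr => r _; rewrite mxE.
rewrite frame_point_prism // !big_ord_recr big_ord0 /= add0r.
by congr (_ + _ + _ + _); congr (_ *: col _ _); apply/val_inj; rewrite /= inordK.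
Qed.

(** If the frame were degenerate, the hyperplane through the apex containing
    the prism would be its affine hull. *)
Lemma prism_frame_unit : prism_frame \in unitmx.
Proof.
rewrite unitmxE unitfE; apply/negP => /det0P[y y0 yN]; apply: pB.
have yB x : aff_hull B x -> dot y^T x = dot y^T p.
  apply: aff_hull_const => _ /prism_points[u [_ _ _ [_ _ _ ->]]].
  rewrite dotDr [X in _ + X](_ : _ = 0) ?addr0 //.
  by rewrite /dot mulmxA trmxK yN mul0mx mxE.
have [p0 [Bm [rB hB]]] := dB.
have yp0 c : dot y^T (p0 + Bm *m c) = dot y^T p by apply: yB; rewrite hB; exists c.
have yBm : y *m Bm = 0.
  apply/matrixP => i k; rewrite ord1 [RHS]mxE.
  transitivity (dot y^T (col k Bm)); first by rewrite dotE mxE; apply: eq_bigr => r _; rewrite !mxE.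
  apply: (addrI (dot y^T p0)); rewrite colE -dotDr yp0 addr0 -(yp0 0).
  by rewrite mulmx0 addr0.
have sB : (Bm^T <= kermx y^T)%MS.
  by apply/sub_kermxP; rewrite -trmx_mul yBm trmx0.
have sp : ((p - p0)^T <= kermx y^T)%MS.
  apply/sub_kermxP; rewrite -trmx_mul; apply/matrixP => i k; rewrite !ord1 !mxE.
  have := yp0 0; rewrite mulmx0 addr0 => /eqP; rewrite eq_sym -subr_eq0 -dotBr => /eqP.
  by rewrite /dot trmxK mxE.
have rk : \rank (kermx y^T) = 3%N.
  by rewrite mxrank_ker mxrank_tr rank_rV y0.
have := (mxrank_leqif_eq sB).2; rewrite rk mxrank_tr rB eqxx => /esym/andP[_ ker].
have /submxP[D DE] := submx_trans sp ker.
rewrite hB; exists D^T => //; rewrite -[p](subrKC p0) -[p - p0]trmxK DE trmx_mul trmxK.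
by [].
Qed.

Let VY : 'M[R]_(4, 7) := vmx 7 vertsY.

Lemma frame_verts (i : 'I_7) : (i != 3%N :> nat) ->
  B (prism_origin + prism_frame *m col i VY).
Proof.
move=> i3; apply/prism_points; rewrite frame_acoord.
exists (fun r => (nth [::] vertsY i)`_r); rewrite (eq_frame_point (acoord_col vertsY i)).
by case: i i3 => -[|[|[|[|[|[|[|//]]]]]]] ? //= _; split; rewrite ?ler01 ?lexx //; split; rewrite ?ler01 ?lexx // ?addr0 ?add0r.
Qed.

Lemma frame_apex : prism_origin + prism_frame *m col (inord 3) VY = p.
Proof.
rewrite frame_acoord (eq_frame_point (acoord_col vertsY (inord 3))) frame_pointE inordK //=.
by rewrite !subr0 scale1r !scale0r !addr0.
Qed.

Lemma pre_prism : pre prism_origin prism_frame B = Fc VY (amx 6 funsY) [set inord 5]%SET.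
Proof.
have FP z := FY_P z (isT : (5 < 6)%N).
apply/seteqP; split=> z; rewrite /pre /=.
  move=> /prism_points[u [u0 u1 u2 [us u3 u31 E]]]; apply/FP.
  have {E} zE r : (r < 4)%N -> acoord z r = u r.
    have : prism_frame *m z = prism_frame *m acol u.
      apply: (addrI prism_origin); rewrite E frame_acoord; apply: eq_frame_point => l l4.
      by rewrite acoord_acol.
    by move=> /(can_inj (mulKmx prism_frame_unit)) -> r4; rewrite acoord_acol.
  split; last by rewrite (eq_haff _ zE) /haff /=; lra.
  apply/conv_YP => j j6; rewrite (eq_haff _ zE) /haff.
  by case: j j6 => [|[|[|[|[|[|//]]]]]] _ /=; lra.
move=> /FP[/conv_YP H h5]; apply/prism_points; exists (acoord z).
have h0 := H 0%N isT; have h1 := H 1%N isT; have h2 := H 2%N isT.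
have h3 := H 3%N isT; have h4 := H 4%N isT; clear H FP.
rewrite /haff /= in h0 h1 h2 h3 h4 h5; split; [lra|lra|lra|split; [lra|lra|lra|]].
exact: frame_acoord.
Qed.

Lemma pre_pyramid : pre prism_origin prism_frame Y = conv VY.
Proof.
rewrite YE pre_conv_hull ?prism_frame_unit //; apply/seteqP; split.
  apply: conv_hull_sub; first exact: conv_hull_convex.
  move=> z [Bz|zp].
    by have : pre prism_origin prism_frame B z by []; rewrite pre_prism => -[].
  have : prism_frame *m z = prism_frame *m col (inord 3) VY.
    by apply: (addrI prism_origin); rewrite frame_apex.
  by move=> /(can_inj (mulKmx prism_frame_unit)) ->; exact: conv_col.
apply: conv_hull_sub; first exact: conv_hull_convex.
move=> _ [i _ <-]; apply: sub_conv_hull; rewrite /pre /=.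
have [i3|i3] := eqVneq (i : nat) 3%N; last by left; exact: frame_verts.
right; rewrite -[RHS]frame_apex; congr (_ + _ *m col _ _).
by apply/val_inj; rewrite /= inordK.
Qed.

End Frame.

Section Types.
Context {R : realType}.
Implicit Types (Y B S F : set 'cV[R]_4) (q z c : 'cV[R]_4) (N : 'M[R]_4).

Let VY : 'M[R]_(4, 7) := vmx 7 vertsY.
Let FY (j : nat) : set 'cV[R]_4 := Fc VY (amx 6 funsY) [set inord j]%SET.
Let hY (j : nat) z : R := haff (nth [::] funsY j) (acoord z).

Lemma standard_position Y B : is_triangular_prism B -> is_pyramid_over Y B ->
  exists c N, [/\ N \in unitmx, pre c N Y = conv VY & pre c N B = FY 5].
Proof.
move=> [T [t [[[Tv TE] _] BE dB]]] [p [pB YE]].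
exists (prism_origin Tv t p), (prism_frame Tv t p); split.
- exact: (prism_frame_unit TE BE dB pB).
- exact: (pre_pyramid TE BE dB pB YE).
- exact: (pre_prism TE BE dB pB).
Qed.

Lemma pre_pre c N c' N' S : pre c' N' (pre c N S) = pre (c + N *m c') (N *m N') S.
Proof. by apply/seteqP; split=> z; rewrite /pre /= mulmxDr mulmxA addrA. Qed.

Lemma FY_cases F : is_facet (conv VY) F -> exists2 j, (j < 6)%N & F = FY j.
Proof.
move=> /(pattern_facet_cases (@conv_Y R) (@good_Y R))[j ->]; exists j => //.
by rewrite /FY inord_val.
Qed.

Lemma facet_FY j : is_facet (conv VY) (FY j).
Proof. exact: (pattern_facet (@conv_Y R) (@good_Y R)). Qed.

(** By the symmetry of the pyramid the chosen simplex facet may be taken to be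
    the one over the lower triangle. *)
Lemma standard_position_simplex Y B S :
  is_triangular_prism B -> is_pyramid_over Y B -> is_simplex_facet Y S ->
  exists c N, [/\ N \in unitmx, pre c N Y = conv VY, pre c N B = FY 5 & pre c N S = FY 4].
Proof.
move=> pB pY [fS [k sS]]; have [c [N [uN YE BE]]] := standard_position pB pY.
have := pre_facet c uN fS; rewrite YE => /FY_cases[j j6 SE].
have := pre_simplex c uN sS; rewrite SE => /(simplex_FY j6)[] jE; subst j; last first.
  by exists c, N.
have [N' [uN' Y' F']] : exists N' : 'M[R]_4, [/\ N' \in unitmx,
    pre 0 N' (conv VY) = conv VY & forall j, (j < 6)%N -> pre 0 N' (FY j) =
      FY (if j == 3 then 4 else if j == 4 then 3 else j)%N].
  by eexists; split; [exact: flip_unit|exact: conv_Y_flip|exact: FY_flip].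
exists (c + N *m 0), (N *m N'); split; first by rewrite unitmx_mul uN.
- by rewrite -pre_pre YE.
- by rewrite -pre_pre BE F'.
- by rewrite -pre_pre SE F'.
Qed.

Section Located.
Variables (c : 'cV[R]_4) (N : 'M[R]_4) (Y : set 'cV[R]_4) (q : 'cV[R]_4).
Hypotheses (uN : N \in unitmx) (YE : pre c N Y = conv VY).
Let z := invmx N *m (q - c).
Let u := acoord z.

Lemma located_sign j F a b : (j < 6)%N -> pre c N F = FY j -> defines_face Y F a b ->
  [/\ (dot a q < b) = (0 < hY j z), (dot a q == b) = (hY j z == 0) &
      (b < dot a q) = (hY j z < 0)].
Proof.
move=> j6 FE /(pre_defines_face c N); rewrite YE FE => /(facet_sign z j6).
have -> : dot (N^T *m a) z = dot a q - dot a c.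
  transitivity (dot a (N *m z)); first by rewrite /dot trmx_mul trmxK mulmxA.
  by rewrite /z mulKVmx // dotBr.
by rewrite !ltrD2r (inj_eq (addIr _)).
Qed.

(** All facets of the pyramid in standard position come from facets of [Y], so
    the condition on those outside [X] can be used for each of them. *)
Lemma located_beneath (X : set (set 'cV[R]_4)) :
  (forall F, is_facet Y F -> ~ X F -> beneath Y F q) ->
  forall j, (j < 6)%N -> (forall F, X F -> pre c N F <> FY j) -> 0 < hY j z.
Proof.
move=> Xq j j6 Xj; pose F := pre (- (invmx N *m c)) (invmx N) (FY j).
have FE : pre c N F = FY j by exact: preK'.
have [|XF|a [b [ab]]] := Xq F; last by rewrite -/(dot a q); have [-> _ _] := located_sign j6 FE ab.
- rewrite -(preK c Y uN) YE; apply: pre_facet; last exact: facet_FY.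
  by rewrite unitmx_inv.
- exact: Xj XF FE.
Qed.

Lemma located_beyond j F : (j < 6)%N -> pre c N F = FY j -> beyond Y F q -> hY j z < 0.
Proof. by move=> j6 FE [a [b [/(located_sign j6 FE)[_ _ <-]]]]. Qed.

Lemma located_on j F : (j < 6)%N -> pre c N F = FY j -> on_hyperplane Y F q -> hY j z = 0.
Proof.
by move=> j6 FE [a [b [/(located_sign j6 FE)[_ aE _] /eqP H]]]; apply/eqP; rewrite -aE.
Qed.

Lemma located_coordinates B : pre c N B = FY 5 -> beyond Y B q ->
  (forall j, (j < 4)%N -> 0 < hY j z) ->
  [/\ 0 < u 0%N, 0 < u 1%N, 0 < u 2%N, 0 < u 0%N + u 1%N + u 2%N - 1 &
      0 < u 0%N + u 1%N + u 2%N - u 3%N].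
Proof.
move=> BE /(located_beyond (isT : (5 < 6)%N) BE) h5 pos.
have h0 := pos 0%N isT; have h1 := pos 1%N isT; have h2 := pos 2%N isT.
have h3 := pos 3%N isT; clear pos; rewrite /hY /haff /= -/u in h0 h1 h2 h3 h5.
by split; lra.
Qed.

Lemma located_height : hY 4 z = u 3%N.
Proof. by rewrite /hY /haff /= -/u; ring. Qed.

Lemma located_hull : pre c N (conv_hull (Y `|` [set q])) =
  conv (vmx 8 (vertsZ (u 0) (u 1) (u 2) (u 3)))%N.
Proof.
set VZ := vmx 8 _.
have VZ7 i : (i < 7)%N -> col (inord i) VZ = col (inord i) VY.
  move=> i7; have i8 : (i < 8)%N by exact: ltn_trans i7 _.
  apply: col4_eq => r r4; rewrite !mxE !inordK //.
  by rewrite /vertsZ nth_rcons i7.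
have VZq : col (inord 7) VZ = z.
  apply: col4_eq => k k4; rewrite [LHS]mxE [LHS]mxE !inordK //= /u /acoord.
  by case: k k4 => [|[|[|[|//]]]] _ /=; ring.
have zq : pre c N [set q] z by rewrite /pre /= mulKVmx // subrKC.
rewrite pre_conv_hull //; apply/seteqP; split.
  apply: conv_hull_sub; first exact: conv_hull_convex.
  move=> x [Yx|xq].
    have : pre c N Y x by []; rewrite YE; apply: conv_hull_sub; first exact: conv_hull_convex.
    by move=> _ [i _ <-]; rewrite -[i]inord_val -VZ7 //; exact: conv_col.
  suff -> : x = z by rewrite -VZq; exact: conv_col.
  by apply: (can_inj (mulKmx uN)); apply: (addrI c); rewrite [LHS]xq zq.
apply: conv_hull_sub; first exact: conv_hull_convex.
move=> _ [i _ <-]; apply: sub_conv_hull; rewrite -[i]inord_val.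
have [i7|i7] := ltnP i 7.
  by left; rewrite VZ7 //; change (pre c N Y (col (inord i) VY)); rewrite YE; exact: conv_col.
have -> : (i : nat) = 7%N by apply/eqP; rewrite eqn_leq i7 -ltnS ltn_ord.
by right; rewrite VZq.
Qed.

Lemma located_equiv n m (P : labeled_polytope R 4 n m) :
  comb_equiv (conv_hull (Y `|` [set q])) (body P) ->
  comb_equiv (conv (vmx 8 (vertsZ (u 0) (u 1) (u 2) (u 3)))%N) (body P).
Proof.
move=> H; apply: comb_equiv_trans H; rewrite -located_hull.
set X := conv_hull _; rewrite -[X in comb_equiv _ X](preK c X uN).
by apply: pre_comb_equiv; rewrite unitmx_inv.
Qed.

End Located.

End Types.

Theorem proposition5p4 (R : realType) :
  [/\ (forall (n m : nat) (P : labeled_polytope R 4 n m), type_P1 P ->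
         [/\ smooth_manifold_of_dim (realization_space P) 26,
             (26 > 25 :> int) & 25 = NG P]),
      (forall (n m : nat) (P : labeled_polytope R 4 n m), type_P2 P ->
         [/\ smooth_manifold_of_dim (realization_space P) 27,
             (27 > 26 :> int) & 26 = NG P]) &
      (forall (n m : nat) (P : labeled_polytope R 4 n m), type_P3 P ->
         [/\ smooth_manifold_of_dim (realization_space P) 27,
             (27 > 26 :> int) & 26 = NG P])].
Proof.
have inj j k : (j < 6)%N -> (k < 6)%N -> j <> k ->
    Fc (vmx 7 vertsY : 'M[R]_(4, 7)) (amx 6 funsY) [set inord j]%SET <>
    Fc (vmx 7 vertsY) (amx 6 funsY) [set inord k]%SET.
  by move=> j6 k6 jk /(FY_inj j6 k6).
have pos2 c N Y B S q : N \in unitmx -> pre c N Y = conv (vmx 7 vertsY) ->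
    pre c N B = Fc (vmx 7 vertsY : 'M[R]_(4, 7)) (amx 6 funsY) [set inord 5]%SET ->
    pre c N S = Fc (vmx 7 vertsY) (amx 6 funsY) [set inord 4]%SET ->
    (forall F, is_facet Y F -> F <> B -> F <> S -> beneath Y F q) ->
    forall j, (j < 4)%N -> 0 < haff (nth [::] funsY j) (acoord (invmx N *m (q - c))).
  move=> uN YE BE SE qF j j4; have j6 : (j < 6)%N by exact: ltn_trans j4 _.
  apply: (@located_beneath _ c N Y q uN YE [set F | F = B \/ F = S]) => //.
    by move=> F fF nF; apply: qF => // E; apply: nF; [left|right].
  by move=> F [->|->]; rewrite ?BE ?SE; apply: inj => // E; move: j4; rewrite -E.
split=> n m P.
- move=> [Y [B [S [q [[prism pyr simp] [qB qS qF eqv]]]]]].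
  have [c [N [uN YE BE SE]]] := standard_position_simplex prism pyr simp.
  have pos := pos2 c N Y B S q uN YE BE SE qF.
  have [u0 u1 u2 sp Dp] := located_coordinates uN YE BE qB pos.
  have := located_on uN YE (isT : (4 < 6)%N) SE qS; rewrite located_height => u3.
  have [|sm ->] := @manifold_nine_facets R n m P _ _ (conv_Z1 erefl erefl u0 u1 u2 sp Dp u3) _ (located_equiv uN YE eqv).
    by apply: inc_pat; [exact: funs1_centre|move=> i j; exact: funs1_verts].
  by split.
- move=> [Y [B [q [[prism pyr] [qB qF eqv]]]]].
  have [c [N [uN YE BE]]] := standard_position prism pyr.
  have pos j : (j < 5)%N -> 0 < haff (nth [::] funsY j) (acoord (invmx N *m (q - c))).
    move=> j5; apply: (@located_beneath _ c N Y q uN YE [set B]) => //; first exact: ltn_trans j5 _.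
    by move=> F ->; rewrite BE; apply: inj => // [|E]; [exact: ltn_trans j5 _|move: j5; rewrite -E].
  have [|u0 u1 u2 sp Dp] := located_coordinates uN YE BE qB.
    by move=> j j4; apply: pos; exact: ltn_trans j4 _.
  have := pos 4%N isT; rewrite located_height => u3.
  have [|sm ->] := @manifold_ten_facets R n m P _ _ (conv_Z2 erefl erefl u0 u1 u2 sp Dp u3) _ (located_equiv uN YE eqv).
    by apply: inc_pat; [move=> j; exact: funs2_centre|move=> i j; exact: funs2_verts].
  by split.
- move=> [Y [B [S [q [[prism pyr simp] [qB qS qF eqv]]]]]].
  have [c [N [uN YE BE SE]]] := standard_position_simplex prism pyr simp.
  have pos := pos2 c N Y B S q uN YE BE SE qF.
  have [u0 u1 u2 sp Dp] := located_coordinates uN YE BE qB pos.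
  have := located_beyond uN YE (isT : (4 < 6)%N) SE qS; rewrite located_height => u3.
  have [|sm ->] := @manifold_eleven_facets R n m P _ _ (conv_Z3 erefl erefl u0 u1 u2 sp Dp u3) _ (located_equiv uN YE eqv).
    by apply: inc_pat; [move=> j; exact: funs3_centre|move=> i j; exact: funs3_verts].
  by split.
Qed.
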